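(* Let $\mathcal{G}(\mathbf{g},\mathbf{b})$ be a nonstationary Gabor Bessel sequence with $g_n\in L^2(\mathbb{R})$, $\operatorname{supp}(g_n)=[c_n,d_n]$, $c_n<d_n$, and $b_n\in\,]\frac1{d_n-c_n},\infty[$ for all $n\in\mathbb{Z}$, and suppose there is $\epsilon>0$ such that $d_{n-1}\le c_{n+1}$ and $b_n^{-1}\ge\max\{\frac{d_n-c_n}{2},c_{n+1}-c_n,d_n-d_{n-1}\}+\epsilon$ for all $n\in\mathbb{Z}$. Assume moreover that $b_n\in\,\big]0,\frac{b_{n-1}}{b_{n-1}(d_n-c_{n-1})-1}\big[$ and $c_n\le d_{n-1}$ for all $n\in\mathbb{Z}$. (a) Let $\mathcal{G}(\mathbf{h},\mathbf{b})$ be a nonstationary Gabor Bessel sequence with $h_n\in L^2(\mathbb{R})$ and $\operatorname{supp}(h_n)\subseteq[c_n,d_n]$ for all $n\in\mathbb{Z}$. Then $\mathcal{G}(\mathbf{g},\mathbf{b})$ and $\mathcal{G}(\mathbf{h},\mathbf{b})$ are dual frames if and only if the following hold for all $n\in\mathbb{Z}$: (a.i) $b_n^{-1}h_n\overline{g_n}+b_{n-1}^{-1}h_{n-1}\overline{g_{n-1}}=1$ almost everywhere on $[c_n,c_{n+1}[$; (a.ii) $h_n\mathbf{T}_{-b_n^{-1}}\overline{g_n}=0$ almost everywhere on $I^-_{n,1}$; (a.iii) $h_n\mathbf{T}_{b_n^{-1}}\overline{g_n}=0$ almost everywhere on $I^+_{n,1}$. (b) A Bessel sequence $\mathcal{G}(\mathbf{h},\mathbf{b})$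 with $h_n\in L^2(\mathbb{R})$ and $\operatorname{supp}(h_n)\subseteq[c_n,d_n]$ for all $n\in\mathbb{Z}$, such that the pair $\mathcal{G}(\mathbf{g},\mathbf{b})$, $\mathcal{G}(\mathbf{h},\mathbf{b})$ satisfies (a), exists if and only if there is some $A>0$ such that the following hold for all $n\in\mathbb{Z}$: (b.i) $b_n^{-1/2}|g_n(t)|\ge A$ or $b_{n-1}^{-1/2}|g_{n-1}(t)|\ge A$ for almost every $t\in[c_n,c_{n+1}[$; (b.ii) $b_{n-1}^{-1/2}|g_{n-1}|\ge A$ almost everywhere on $\operatorname{supp}(\mathbf{T}_{-b_n^{-1}}g_n)\cap I^-_{n,1}$; (b.iii) $b_{n+1}^{-1/2}|g_{n+1}|\ge A$ almost everywhere on $\operatorname{supp}(\mathbf{T}_{b_n^{-1}}g_n)\cap I^+_{n,1}$.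
   Context: $\mathbf{T}_xf(t)=f(t-x)$. $\operatorname{supp}(f)$ denotes the essential support of $f$, i.e. the support up to sets of measure zero (the set where $f\neq0$, with equalities and inclusions understood up to null sets). $[x,y]=\emptyset$ if $x>y$. A nonstationary Gabor system $\mathcal{G}(\mathbf{g},\mathbf{b})$, given by sequences $(g_n)_{n\in\mathbb{Z}}$ in $L^2(\mathbb{R})$ and $(b_n)_{n\in\mathbb{Z}}$ in $\mathbb{R}^+$, is the system $g_{m,n}(t)=g_n(t)e^{2\pi i mb_nt}$, $m,n\in\mathbb{Z}$. It is a Bessel sequence if there is $B<\infty$ with $\sum_{m,n}|\langle f,g_{m,n}\rangle|^2\le B\|f\|^2$ for all $f\in L^2(\mathbb{R})$, and a frame if in addition $A'\|f\|^2\le\sum_{m,n}|\langle f,g_{m,n}\rangle|^2$ for all $f$, for some $A'>0$. Two systems $\mathcal{G}(\mathbf{g},\mathbf{b})$, $\mathcal{G}(\mathbf{h},\mathbf{b})$ are dual frames if they are frames and $f=\sum_{m,n}\langle f,g_{m,n}\rangle h_{m,n}=\sum_{m,n}\langle f,h_{m,n}\rangle g_{m,n}$ for all $f\in L^2(\mathbb{R})$. $I^-_{n,1}=[c_n,d_n-b_n^{-1}]$ and $I^+_{n,1}=[c_n+b_n^{-1},d_n]$. ''The pair satisfies (a)'' means that conditions (a.i)--(a.iii) hold for all $n$, i.e. that the two systems are dual frames. *)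

(* Defs.v *)
From mathcomp Require Export all_boot all_order all_algebra.
From mathcomp Require Export finmap.
From mathcomp Require Export all_classical all_reals all_analysis.
From mathcomp Require Export complex.

Set Implicit Arguments.
Unset Strict Implicit.
Unset Printing Implicit Defensive.

Import Order.TTheory GRing.Theory Num.Theory.
Import numFieldNormedType.Exports.

Local Open Scope classical_set_scope.
Local Open Scope complex_scope.
Local Open Scope ring_scope.

Notation mu := lebesgue_measure (only parsing).

Definition cabs {R : realType} (z : R[i]) : R := complex.Re `|z|.

Definition expi {R : realType} (x : R) : R[i] := cos x +i* sin x.

Section L2.
Context {R : realType}.
Implicit Types f g : R -> R[i].

(* Elements of L^2(R) are represented by functions.  Measurability is with
   respect to the Borel sigma-algebra; every Lebesgue measurable function has a
   Borel representative, and all notions below are invariant under a.e.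
   equality. *)
Definition cmeasurable f : Prop :=
  measurable_fun [set: R] (fun t => complex.Re (f t)) /\
  measurable_fun [set: R] (fun t => complex.Im (f t)).

(* the squared L^2 norm *)
Definition sqnorm f : \bar R := (\int[mu]_t (cabs (f t) ^+ 2)%:E)%E.

Definition L2 f : Prop := cmeasurable f /\ (sqnorm f < +oo)%E.

Definition inner f g : R[i] :=
  Rintegral mu [set: R] (fun t => complex.Re (f t * (g t)^*%C)) +i*
  Rintegral mu [set: R] (fun t => complex.Im (f t * (g t)^*%C)).

Definition translation (x : R) f : R -> R[i] := fun t => f (t - x).

(* The essential support is the set where f is nonzero, considered up to null
   sets: it must only be compared with other sets through the two relations
   below, or used inside an a.e. quantifier. *)
Definition supp f : set R := [set t | f t != 0].

Definition ae_subset (A B : set R) : Prop := {ae mu, forall t, A t -> B t}.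
Definition ae_eq_set (A B : set R) : Prop := {ae mu, forall t, A t <-> B t}.

End L2.

Section Gabor.
Context {R : realType}.
Implicit Types (g h : int -> R -> R[i]) (b c d : int -> R).

(* g_{m,n}, with k = (m, n) *)
Definition gabor g b (k : int * int) : R -> R[i] :=
  fun t => g k.2 t * expi (2 * pi * k.1%:~R * b k.2 * t).

Definition frame_sum g b (f : R -> R[i]) : \bar R :=
  (\esum_(k in [set: int * int]) (cabs (inner f (gabor g b k)) ^+ 2)%:E)%E.

Definition bessel g b : Prop :=
  exists B : R, forall f, L2 f -> (frame_sum g b f <= B%:E * sqnorm f)%E.

Definition frame g b : Prop :=
  bessel g b /\
  exists2 A : R, 0 < A &
    forall f, L2 f -> (A%:E * sqnorm f <= frame_sum g b f)%E.

(* f = sum_(m,n) <f, g_{m,n}> h_{m,n} in L^2(R): the partial sums over finite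
   sets of indices, directed by inclusion, converge to f in norm (this is
   unconditional convergence, which is automatic when both systems are Bessel
   sequences). *)
Definition reconstructs g h b (f : R -> R[i]) : Prop :=
  forall e : R, 0 < e ->
    exists K : {fset int * int}, forall J : {fset int * int}, (K `<=` J)%fset ->
      (sqnorm (fun t => f t -
         \sum_(k <- J) inner f (gabor g b k) * gabor h b k t)%R < (e ^+ 2)%:E)%E.

Definition dual_frames g h b : Prop :=
  [/\ frame g b, frame h b &
      forall f, L2 f -> reconstructs g h b f /\ reconstructs h g b f].

Definition Iminus b c d (n : int) : set R := [set` `[c n, d n - (b n)^-1]].
Definition Iplus b c d (n : int) : set R := [set` `[c n + (b n)^-1, d n]].

Definition duality_conditions g h b c d : Prop :=
  forall n : int,
  [/\ {ae mu, forall t, t \in `[c n, c (n + 1)[ ->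
        (b n)^-1%:C * h n t * (g n t)^*%C +
        (b (n - 1))^-1%:C * h (n - 1) t * (g (n - 1) t)^*%C = 1},
      {ae mu, forall t, Iminus b c d n t ->
        h n t * translation (- (b n)^-1) (fun s => (g n s)^*%C) t = 0} &
      {ae mu, forall t, Iplus b c d n t ->
        h n t * translation (b n)^-1 (fun s => (g n s)^*%C) t = 0}].

End Gabor.

(* Main.v *)
Require Import Defs.
From mathcomp Require Import measure measurable_realfun zify ring lra.
Import Order.TTheory GRing.Theory Num.Theory.
Import numFieldNormedType.Exports HBNNSimple.

Local Open Scope classical_set_scope.
Local Open Scope complex_scope.
Local Open Scope ring_scope.
Local Notation "z ^*" := (conjc z) : ring_scope.

Set Implicit Arguments.
Unset Strict Implicit.
Unset Printing Implicit Defensive.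


(** Write p_n = 1 / b_n, I_n- = [c_n, d_n - p_n] and I_n+ = [c_n + p_n, d_n].

    The hypotheses say that the support of g_n is longer than p_n and shorter than
    2 p_n, that on the cell [c_n, c_(n+1)[ only the rows n and n - 1 live, that the
    cells tile the line with steps of at least eps, and that I_n- and I_n+ lie,
    up to an end point, in the cells n and n + 1 and never meet each other or those
    of a neighbour.

    Fix n. The products <f, g_mn> <h_mn, u>, with m running over the integers, are
    products of Fourier coefficients of period p_n of f conj g_n and u conj h_n.
    Folding these functions, supported in two periods, onto one period and applying
    Parseval's identity gives (fsums_gabor_row)
      p_n ( <f conj g_n, u conj h_n> + two aliasing terms ),
    where the aliasing terms pair f(t) with u(t + p_n) and f(t + p_n) with u(t).
    Products f conj g_n are square integrable because a Gabor Bessel sequence has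
    bounded windows, |g_n|^2 <= B b_n (bessel_bounded).

    (a) Under the last two conditions the aliasing terms vanish, and the first one
    makes the sum over the two rows of a cell equal to <f, u> when f lives on that
    cell (fsums_diagonal). Continuity extends this weak reconstruction to all f
    (weak_of_conditions), and for Bessel families weak reconstruction is norm
    convergence (weak_strong) and yields the lower frame bounds
    (weak_lower_bound). Conversely, weak reconstruction tested on f = 1_(I_n-) g_n
    and u = 1_(I_n+) h_n, and with the two intervals exchanged, leaves one aliasing
    term with a nonnegative integrand, which must vanish (weak_no_aliasing); testing
    on the indicator of a cell against the defect of the first condition gives that
    condition (conditions_of_weak).

    (b) If a dual h exists, it is bounded by its Bessel bound, so that two diagonal
    terms with sum 1 force one of the two windows to be large; on I_n- and I_n+ the
    aliasing conditions make h_n vanish and only the neighbour is left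
    (existence_necessary). Conversely, choose measurably at each point one window
    that is large and put h_n = b_n / conj g_n where the n-th window is chosen, and
    0 elsewhere (dual_window). The sets of choice are disjoint, so the Bessel
    property follows from Bessel's inequality in each row
    (dual_window_bessel).

    Parseval's identity rests on the density of trigonometric polynomials in L^2 of
    a period: with q = (1 + sin) / 2, the polynomials (1 - q^n)^(2^n) converge to the
    indicator of a half period; products of two of these give half-lines within the
    period, hence by a Dynkin argument all Borel sets, hence by simple functions all
    square integrable functions (approximable_L2). *)

(** * Complex numbers *)
Section ComplexValues.
Context {R : realType}.
Implicit Types z w : R[i].

Definition abs2 z : R := complex.Re z ^+ 2 + complex.Im z ^+ 2.

Lemma cReM z w : complex.Re (z * w) =
  complex.Re z * complex.Re w - complex.Im z * complex.Im w.
Proof. by case: z w => [a b] [c d]. Qed.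

Lemma cImM z w : complex.Im (z * w) =
  complex.Re z * complex.Im w + complex.Im z * complex.Re w.
Proof. by case: z w => [a b] [c d]. Qed.

Lemma cReD z w : complex.Re (z + w) = complex.Re z + complex.Re w.
Proof. by case: z w => [a b] [c d]. Qed.

Lemma cImD z w : complex.Im (z + w) = complex.Im z + complex.Im w.
Proof. by case: z w => [a b] [c d]. Qed.

Lemma cReN z : complex.Re (- z) = - complex.Re z.
Proof. by case: z. Qed.

Lemma cImN z : complex.Im (- z) = - complex.Im z.
Proof. by case: z. Qed.

Lemma cReJ z : complex.Re z^* = complex.Re z.
Proof. by case: z. Qed.

Lemma cImJ z : complex.Im z^* = - complex.Im z.
Proof. by case: z. Qed.

Definition cReImE := (cReM, cImM, cReD, cImD, cReN, cImN, cReJ, cImJ).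

Lemma conjcM z w : (z * w)^* = z^* * w^*.
Proof. exact: rmorphM. Qed.

Lemma conjcD z w : (z + w)^* = z^* + w^*.
Proof. exact: rmorphD. Qed.

Lemma conjc_invol z : z^*^* = z.
Proof. exact: conjcK. Qed.

Lemma complexP z w :
  complex.Re z = complex.Re w -> complex.Im z = complex.Im w -> z = w.
Proof. by case: z w => [a b] [c d] /= -> ->. Qed.

Lemma cabs_sqr z : cabs z ^+ 2 = abs2 z.
Proof.
by rewrite /cabs normc_def /= sqr_sqrtr // addr_ge0 // sqr_ge0.
Qed.

Lemma cabs_ge0 z : 0 <= cabs z.
Proof. by rewrite /cabs normc_def /= sqrtr_ge0. Qed.

Lemma cabsE z : cabs z = Num.sqrt (abs2 z).
Proof. by rewrite -cabs_sqr sqrtr_sqr ger0_norm // cabs_ge0. Qed.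

Lemma abs2_ge0 z : 0 <= abs2 z.
Proof. by rewrite addr_ge0 // sqr_ge0. Qed.

Lemma abs2_eq0 z : (abs2 z == 0) = (z == 0).
Proof.
rewrite paddr_eq0 ?sqr_ge0 // !sqrf_eq0 -[z == 0]/(z == Complex 0 0).
by rewrite eq_complex.
Qed.

Lemma abs20 : abs2 0 = 0.
Proof. by apply/eqP; rewrite abs2_eq0. Qed.

Lemma abs2_real (x : R) : abs2 x%:C = x ^+ 2.
Proof. by rewrite /abs2 /= expr0n addr0. Qed.

Lemma abs2M z w : abs2 (z * w) = abs2 z * abs2 w.
Proof. by rewrite /abs2 !cReImE; ring. Qed.

Lemma abs2J z : abs2 z^* = abs2 z.
Proof. by rewrite /abs2 !cReImE; ring. Qed.

Lemma abs2N z : abs2 (- z) = abs2 z.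
Proof. by rewrite /abs2 !cReImE; ring. Qed.

Lemma mulzJ z : z * z^* = (abs2 z)%:C.
Proof. by apply: complexP; rewrite !cReImE /abs2 /=; ring. Qed.

Lemma abs2V z : abs2 z^-1 = (abs2 z)^-1.
Proof.
have [->|z0] := eqVneq z 0; first by rewrite invr0 abs20 invr0.
have z20 : abs2 z != 0 by rewrite abs2_eq0.
apply: (mulIf z20); rewrite -abs2M !mulVf //.
by rewrite (abs2_real 1) expr1n.
Qed.

Lemma abs2D_le z w : abs2 (z + w) <= 2 * abs2 z + 2 * abs2 w.
Proof.
rewrite -subr_ge0 [leRHS](_ : _ = abs2 (z - w)) ?abs2_ge0 //.
by rewrite /abs2 !cReImE; ring.
Qed.

(** The weighted form of the arithmetic-geometric inequality is how every
    product of two coefficient sequences is estimated below; choosing the weight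
    replaces the Cauchy-Schwarz inequality for sums. *)
Lemma abs2_amgm (l : R) z w : 0 < l ->
  2 * `|complex.Re (z * w)| <= l * abs2 z + l^-1 * abs2 w.
Proof.
move=> l0.
have h (s : R) : s ^+ 2 = 1 ->
    0 <= l * abs2 z + l^-1 * abs2 w - 2 * (s * complex.Re (z * w)).
  move=> s1.
  rewrite [leRHS](_ : _ = l * abs2 (z - (s * l^-1)%:C * w^*)).
    by rewrite mulr_ge0 ?abs2_ge0 // ltW.
  rewrite /abs2 !cReImE /=.
  transitivity (l * (complex.Re z ^+ 2 + complex.Im z ^+ 2) +
    s ^+ 2 * l^-1 * (complex.Re w ^+ 2 + complex.Im w ^+ 2) -
    2 * (s * (complex.Re z * complex.Re w - complex.Im z * complex.Im w))).
    by rewrite s1 mul1r.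
  by field; rewrite gt_eqF.
have [h0|h0] := leP 0 (complex.Re (z * w)).
  by rewrite -subr_ge0 ger0_norm //; have := h 1 (expr1n _ _); rewrite mul1r.
rewrite -subr_ge0 ltr0_norm //; have := h (-1).
by rewrite sqrrN expr1n mulN1r => /(_ erefl).
Qed.

Lemma Re_le_abs2 z w : `|complex.Re (z * w)| <= abs2 z + abs2 w.
Proof.
have := @abs2_amgm 1 z w ltr01; rewrite invr1 !mul1r => h.
have := normr_ge0 (complex.Re (z * w)); lra.
Qed.

Lemma Im_le_abs2 z w : `|complex.Im (z * w)| <= abs2 z + abs2 w.
Proof.
have -> : complex.Im (z * w) = - complex.Re (z * ((0 +i* 1) * w)).
  by rewrite !cReImE /=; ring.
rewrite normrN; apply: le_trans (Re_le_abs2 _ _) _.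
by rewrite abs2M /abs2 /= expr0n expr1n add0r mul1r.
Qed.

End ComplexValues.

(** * Integration of complex functions *)
Section ComplexIntegral.
Context {R : realType}.
Implicit Types f g h : R -> R[i].
Local Notation mu := (@lebesgue_measure R).

Lemma aeS (P Q : R -> Prop) :
  {ae mu, forall t, P t} -> (forall t, P t -> Q t) -> {ae mu, forall t, Q t}.
Proof.
by move=> + PQ; exact: (@filterS _ _ (ae_filter_ringOfSetsType mu) _ _ PQ).
Qed.

Lemma aeS2 (P Q S : R -> Prop) :
  {ae mu, forall t, P t} -> {ae mu, forall t, Q t} ->
  (forall t, P t -> Q t -> S t) -> {ae mu, forall t, S t}.
Proof.
move=> aP aQ PQ.
exact: (@filterS2 _ _ (ae_filter_ringOfSetsType mu) _ _ _ PQ aP aQ).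
Qed.

Lemma aeT (P : R -> Prop) : (forall t, P t) -> {ae mu, forall t, P t}.
Proof. by move=> h; exact: aeW. Qed.

Local Notation integ f := (mu.-integrable [set: R] (EFin \o f)).

Lemma integ_le (f g : R -> R) : measurable_fun [set: R] f ->
  (forall x, `|f x| <= g x) -> integ g -> integ f.
Proof.
move=> mf fg; apply: le_integrable => //; first exact/measurable_EFinP.
by move=> x _ /=; rewrite lee_fin (le_trans (fg x)) // ler_norm.
Qed.

Lemma integ_ext (f g : R -> R) : f =1 g -> integ f -> integ g.
Proof. by move=> /funext ->. Qed.

Lemma integD (f g : R -> R) : integ f -> integ g -> integ (fun t => f t + g t).
Proof. by move=> hf hg; exact: (integrableD measurableT hf hg). Qed.

Lemma integZ (c : R) (f : R -> R) : integ f -> integ (fun t => c * f t).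
Proof. by move=> hf; exact: (integrableZl measurableT c hf). Qed.

Lemma integN (f : R -> R) : integ f -> integ (fun t => - f t).
Proof. by move=> /(integZ (-1)); apply: integ_ext => t; rewrite mulN1r. Qed.

Lemma integ0 : integ (fun=> 0).
Proof. exact: integrable0. Qed.

Lemma cmeasurable_cst (c : R[i]) : cmeasurable (fun=> c).
Proof. by split. Qed.

Lemma cmeasurableD f g :
  cmeasurable f -> cmeasurable g -> cmeasurable (fun t => f t + g t).
Proof.
move=> [f1 f2] [g1 g2]; split.
  rewrite (_ : (fun _ => _) = (fun t => complex.Re (f t) + complex.Re (g t))).
    exact: measurable_funD.
  by apply/funext => t; rewrite cReD.
rewrite (_ : (fun _ => _) = (fun t => complex.Im (f t) + complex.Im (g t))).
  exact: measurable_funD.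
by apply/funext => t; rewrite cImD.
Qed.

Lemma cmeasurableM f g :
  cmeasurable f -> cmeasurable g -> cmeasurable (fun t => f t * g t).
Proof.
move=> [f1 f2] [g1 g2]; split.
  rewrite (_ : (fun _ => _) = (fun t => complex.Re (f t) * complex.Re (g t)
    - complex.Im (f t) * complex.Im (g t))).
    by apply: measurable_funB; apply: measurable_funM.
  by apply/funext => t; case: (f t) (g t) => [? ?] [? ?] .
rewrite (_ : (fun _ => _) = (fun t => complex.Re (f t) * complex.Im (g t)
    + complex.Im (f t) * complex.Re (g t))).
  by apply: measurable_funD; apply: measurable_funM.
by apply/funext => t; case: (f t) (g t) => [? ?] [? ?].
Qed.

Lemma cmeasurable_real (f : R -> R) :
  measurable_fun [set: R] f -> cmeasurable (fun t => (f t)%:C).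
Proof. by split. Qed.

Lemma cmeasurableJ f : cmeasurable f -> cmeasurable (fun t => (f t)^*).
Proof.
move=> [f1 f2]; split.
  by rewrite (_ : (fun _ => _) = (fun t => complex.Re (f t))) //;
     apply/funext => t; rewrite cReJ.
rewrite (_ : (fun _ => _) = (fun t => - complex.Im (f t))).
  exact: measurable_funN.
by apply/funext => t; rewrite cImJ.
Qed.

Lemma cmeasurableN f : cmeasurable f -> cmeasurable (fun t => - f t).
Proof.
move=> mf; rewrite (_ : (fun _ => _) = (fun t => (-1) * f t)).
  by apply: cmeasurableM => //; exact: cmeasurable_cst.
by apply/funext => t; rewrite mulN1r.
Qed.

Lemma cmeasurable_sum (I : Type) (s : seq I) (F : I -> R -> R[i]) :
  (forall i, cmeasurable (F i)) -> cmeasurable (fun t => \sum_(i <- s) F i t).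
Proof.
move=> mF; elim: s => [|i s ih].
  by under eq_fun do rewrite big_nil; exact: cmeasurable_cst.
by under eq_fun do rewrite big_cons; exact: cmeasurableD.
Qed.

Lemma cmeasurable_shift f (a : R) :
  cmeasurable f -> cmeasurable (fun t => f (t + a)).
Proof.
have ma : measurable_fun [set: R] (fun t : R => t + a).
  by apply: measurable_funD.
move=> [f1 f2]; split.
  exact: (measurableT_comp f1 ma).
exact: (measurableT_comp f2 ma).
Qed.

Lemma measurable_abs2 f :
  cmeasurable f -> measurable_fun [set: R] (fun t => abs2 (f t)).
Proof. by move=> [f1 f2]; apply: measurable_funD; apply: measurable_funX. Qed.

Definition cintegrable f :=
  integ (fun t => complex.Re (f t)) /\ integ (fun t => complex.Im (f t)).

Definition cint f : R[i] :=
  Rintegral mu [set: R] (fun t => complex.Re (f t)) +i*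
  Rintegral mu [set: R] (fun t => complex.Im (f t)).

Lemma cintegrable_measurable f : cintegrable f -> cmeasurable f.
Proof.
by move=> [/measurable_int/measurable_EFinP ? /measurable_int/measurable_EFinP].
Qed.

Lemma cintegrableD f g :
  cintegrable f -> cintegrable g -> cintegrable (fun t => f t + g t).
Proof.
move=> [f1 f2] [g1 g2]; split.
  by apply: integ_ext (integD f1 g1) => t; rewrite cReD.
by apply: integ_ext (integD f2 g2) => t; rewrite cImD.
Qed.

Lemma cintD f g : cintegrable f -> cintegrable g ->
  cint (fun t => f t + g t) = cint f + cint g.
Proof.
move=> [f1 f2] [g1 g2]; apply: complexP; rewrite !cReImE /=.
  by rewrite -RintegralD //; congr Rintegral; apply/funext => t; rewrite cReD.
by rewrite -RintegralD //; congr Rintegral; apply/funext => t; rewrite cImD.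
Qed.

Lemma cintZ c f : cintegrable f -> cint (fun t => c * f t) = c * cint f.
Proof.
move=> [f1 f2]; apply: complexP; rewrite !cReImE /=.
  rewrite -!RintegralZl // -RintegralB //; try exact: integZ.
  by congr Rintegral; apply/funext => t; rewrite cReM.
rewrite -!RintegralZl // -RintegralD //; try exact: integZ.
by congr Rintegral; apply/funext => t; rewrite cImM.
Qed.

Lemma cintJ f : cintegrable f -> cint (fun t => (f t)^*) = (cint f)^*.
Proof.
move=> [f1 f2]; apply: complexP; rewrite !cReImE /=.
  by congr Rintegral; apply/funext => t; rewrite cReJ.
rewrite -mulN1r -RintegralZl //.
by congr Rintegral; apply/funext => t; rewrite cImJ mulN1r.
Qed.

Lemma Rintegral_ae_eq (f g : R -> R) :
  measurable_fun [set: R] f -> measurable_fun [set: R] g ->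
  {ae mu, forall t, f t = g t} ->
  Rintegral mu [set: R] f = Rintegral mu [set: R] g.
Proof.
move=> mf mg fg; rewrite /Rintegral; congr fine.
apply: ae_eq_integral => //; try exact/measurable_EFinP.
by apply: (aeS fg) => t -> _.
Qed.

Lemma cint_ae_eq f g : cmeasurable f -> cmeasurable g ->
  {ae mu, forall t, f t = g t} -> cint f = cint g.
Proof.
move=> [f1 f2] [g1 g2] fg; apply: complexP => /=.
  by apply: Rintegral_ae_eq => //; apply: (aeS fg) => t ->.
by apply: Rintegral_ae_eq => //; apply: (aeS fg) => t ->.
Qed.

Lemma cint_real (f : R -> R) :
  cint (fun t => (f t)%:C) = (Rintegral mu [set: R] f)%:C.
Proof. by apply: complexP => //=; rewrite Rintegral_cst // mul0r. Qed.

Lemma cint_eq0 f : cmeasurable f -> {ae mu, forall t, f t = 0} -> cint f = 0.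
Proof.
move=> mf f0; rewrite (cint_ae_eq mf (cmeasurable_cst 0) f0).
by rewrite (cint_real (fun=> 0)) Rintegral_cst // mul0r.
Qed.

Lemma integ_ae_eq0 (f : R -> R) : integ f -> (forall t, 0 <= f t) ->
  Rintegral mu [set: R] f = 0 -> {ae mu, forall t, f t = 0}.
Proof.
move=> hf f0 int0.
have mf : measurable_fun [set: R] (EFin \o f) by exact: measurable_int hf.
have /(ae_eq_integral_abs mu measurableT mf) : (\int[mu]_(x in [set: R]) `|(EFin \o f) x| = 0)%E.
  under eq_integral do rewrite gee0_abs ?lee_fin//.
  rewrite -[LHS]fineK; last exact: (integrable_fin_num _ hf).
  by move: int0; rewrite /Rintegral => ->.
by move=> h; apply: (aeS h) => t /(_ I) [].
Qed.

End ComplexIntegral.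

(** * Square integrable functions *)
Section HilbertSpace.
Context {R : realType}.
Implicit Types f g h u v : R -> R[i].
Local Notation mu := (@lebesgue_measure R).
Local Notation integ f := (mu.-integrable [set: R] (EFin \o f)).

Lemma L2P f : L2 f <-> cmeasurable f /\ integ (fun t => abs2 (f t)).
Proof.
have E : sqnorm f = (\int[mu]_t `|(abs2 (f t))%:E|)%E.
  by apply: eq_integral => t _; rewrite cabs_sqr gee0_abs // lee_fin abs2_ge0.
split=> -[mf hf]; split => //.
  by apply/integrableP; split; [apply/measurable_EFinP; exact: measurable_abs2|
    rewrite -E].
by rewrite E; case/integrableP : hf.
Qed.

Definition norm2 f : R := Rintegral mu [set: R] (fun t => abs2 (f t)).

Lemma L2_cmeasurable f : L2 f -> cmeasurable f.
Proof. by case. Qed.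

Lemma L2_integ f : L2 f -> integ (fun t => abs2 (f t)).
Proof. by case/L2P. Qed.

Lemma sqnormE f : L2 f -> sqnorm f = (norm2 f)%:E.
Proof.
move=> /L2_integ hf; rewrite /norm2 /Rintegral fineK ?(integrable_fin_num _ hf) //.
by apply: eq_integral => t _; rewrite cabs_sqr.
Qed.

Lemma norm2_ge0 f : 0 <= norm2 f.
Proof. by apply: Rintegral_ge0 => t _; exact: abs2_ge0. Qed.

Lemma L2_le f (G : R -> R) : cmeasurable f -> integ G ->
  (forall t, abs2 (f t) <= G t) -> L2 f.
Proof.
move=> mf hG fG; apply/L2P; split => //.
apply: (integ_le _ _ hG); first exact: measurable_abs2.
by move=> t; rewrite ger0_norm // abs2_ge0.
Qed.

Lemma L2D f g : L2 f -> L2 g -> L2 (fun t => f t + g t).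
Proof.
move=> /L2P[mf hf] /L2P[mg hg].
apply: (L2_le _ (integD (integZ 2 hf) (integZ 2 hg))).
  exact: cmeasurableD.
by move=> t; exact: abs2D_le.
Qed.

Lemma L2Z c f : L2 f -> L2 (fun t => c * f t).
Proof.
move=> /L2P[mf hf]; apply: (L2_le _ (integZ (abs2 c) hf)).
  by apply: cmeasurableM => //; exact: cmeasurable_cst.
by move=> t; rewrite abs2M.
Qed.

Lemma L2N f : L2 f -> L2 (fun t => - f t).
Proof.
move=> /(L2Z (-1)); congr L2.
by apply/funext => t; rewrite mulN1r.
Qed.

Lemma L2B f g : L2 f -> L2 g -> L2 (fun t => f t - g t).
Proof. by move=> hf hg; apply: L2D => //; exact: L2N. Qed.

Lemma L20 : L2 (fun=> 0 : R[i]).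
Proof.
apply: (L2_le (cmeasurable_cst 0) integ0) => t.
by rewrite abs20.
Qed.

Lemma L2J f : L2 f -> L2 (fun t => (f t)^*).
Proof.
move=> /L2P[mf hf]; apply: (L2_le (cmeasurableJ mf) hf) => t.
by rewrite abs2J.
Qed.

Lemma L2_sum (I : Type) (s : seq I) (F : I -> R -> R[i]) :
  (forall i, L2 (F i)) -> L2 (fun t => \sum_(i <- s) F i t).
Proof.
move=> mF; elim: s => [|i s ih].
  by under eq_fun do rewrite big_nil; exact: L20.
by under eq_fun do rewrite big_cons; exact: L2D.
Qed.

Lemma L2_cint f g : L2 f -> L2 g -> cintegrable (fun t => f t * (g t)^*).
Proof.
move=> /L2P[mf hf] /L2P[mg hg].
have [m1 m2] := cmeasurableM mf (cmeasurableJ mg).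
split; apply: (integ_le _ _ (integD hf hg)) => // t /=.
  by rewrite -(abs2J (g t)); exact: Re_le_abs2.
by rewrite -(abs2J (g t)); exact: Im_le_abs2.
Qed.

Lemma innerE f g : inner f g = cint (fun t => f t * (g t)^*).
Proof. by []. Qed.

Lemma innerJ f g : L2 f -> L2 g -> inner g f = (inner f g)^*.
Proof.
move=> hf hg; rewrite !innerE -cintJ; last exact: L2_cint.
by congr cint; apply/funext => t; rewrite conjcM conjc_invol mulrC.
Qed.

Lemma innerDl f g h : L2 f -> L2 g -> L2 h ->
  inner (fun t => f t + g t) h = inner f h + inner g h.
Proof.
move=> hf hg hh; rewrite !innerE -cintD; try exact: L2_cint.
by congr cint; apply/funext => t; rewrite mulrDl.
Qed.

Lemma innerZl c f h : L2 f -> L2 h -> inner (fun t => c * f t) h = c * inner f h.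
Proof.
move=> hf hh; rewrite !innerE -cintZ; try exact: L2_cint.
by congr cint; apply/funext => t; rewrite mulrA.
Qed.

Lemma innerNl f h : L2 f -> L2 h -> inner (fun t => - f t) h = - inner f h.
Proof.
move=> hf hh; rewrite -mulN1r -innerZl //; congr inner.
by apply/funext => t; rewrite mulN1r.
Qed.

Lemma innerBl f g h : L2 f -> L2 g -> L2 h ->
  inner (fun t => f t - g t) h = inner f h - inner g h.
Proof.
by move=> hf hg hh; rewrite innerDl // ?innerNl //; exact: L2N.
Qed.

Lemma innerDr f g h : L2 f -> L2 g -> L2 h ->
  inner h (fun t => f t + g t) = inner h f + inner h g.
Proof.
move=> hf hg hh; rewrite innerJ ?innerDl ?conjcD -?innerJ //.
exact: L2D.
Qed.

Lemma innerZr c f h : L2 f -> L2 h ->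
  inner h (fun t => c * f t) = c^* * inner h f.
Proof.
move=> hf hh; rewrite innerJ ?innerZl ?conjcM -?innerJ //.
exact: L2Z.
Qed.

Lemma inner0l h : inner (fun=> 0) h = 0.
Proof.
rewrite innerE (_ : (fun _ => _) = (fun=> (0 : R)%:C)).
  by rewrite cint_real Rintegral_cst // mul0r.
by apply/funext => t; rewrite mul0r.
Qed.

Lemma inner_suml (I : Type) (s : seq I) (a : I -> R[i]) (F : I -> R -> R[i]) h :
  (forall i, L2 (F i)) -> L2 h ->
  inner (fun t => \sum_(i <- s) a i * F i t) h = \sum_(i <- s) a i * inner (F i) h.
Proof.
move=> hF hh; elim: s => [|i s ih].
  by under eq_fun do rewrite big_nil; rewrite big_nil inner0l.
under eq_fun do rewrite big_cons.
rewrite big_cons innerDl ?ih ?innerZl //; first exact: L2Z.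
by apply: L2_sum => j; exact: L2Z.
Qed.

Lemma innerff f : L2 f -> inner f f = (norm2 f)%:C.
Proof.
by move=> hf; rewrite innerE -cint_real; congr cint; apply/funext => t; rewrite mulzJ.
Qed.

Lemma norm2D f g : L2 f -> L2 g ->
  norm2 (fun t => f t + g t) = norm2 f + norm2 g + 2 * complex.Re (inner f g).
Proof.
move=> hf hg; apply: complexI; rewrite -innerff; last exact: L2D.
rewrite innerDl ?innerDr //; try exact: L2D.
rewrite !innerff // [inner g f]innerJ //.
by apply: complexP; rewrite ?cReImE /= ?cReImE; ring.
Qed.

Lemma norm2Z c f : L2 f -> norm2 (fun t => c * f t) = abs2 c * norm2 f.
Proof.
move=> hf; rewrite /norm2 -RintegralZl //; last exact: L2_integ.
by congr Rintegral; apply/funext => t; rewrite abs2M.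
Qed.

Lemma norm2N f : norm2 (fun t => - f t) = norm2 f.
Proof. by rewrite /norm2; under eq_fun do rewrite abs2N. Qed.

Lemma norm2_sub f g : norm2 (fun t => f t - g t) = norm2 (fun t => g t - f t).
Proof.
by rewrite -norm2N /norm2; congr Rintegral; apply/funext => t; rewrite opprB.
Qed.

Lemma norm2D_le f g : L2 f -> L2 g ->
  norm2 (fun t => f t + g t) <= 2 * norm2 f + 2 * norm2 g.
Proof.
move=> hf hg; rewrite /norm2 -!RintegralZl ?L2_integ // -RintegralD //;
  try by apply: integZ; exact: L2_integ.
apply: le_Rintegral => //.
- exact: L2_integ (L2D hf hg).
- by apply: integD; apply: integZ; exact: L2_integ.
- by move=> t _; exact: abs2D_le.
Qed.

Lemma norm2_pythagoras f g : L2 f -> L2 g -> inner f g = 0 ->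
  norm2 (fun t => f t + g t) = norm2 f + norm2 g.
Proof. by move=> hf hg fg0; rewrite norm2D // fg0 /= mulr0 addr0. Qed.

Lemma cauchy_schwarz f g : L2 f -> L2 g ->
  abs2 (inner f g) <= norm2 f * norm2 g.
Proof.
move=> hf hg; set s := inner f g.
have key (r : R) : 0 <= norm2 f - 2 * r * abs2 s + r ^+ 2 * abs2 s * norm2 g.
  have := norm2_ge0 (fun t => f t + (- (r%:C * s)) * g t).
  rewrite norm2D // ?norm2Z ?innerZr //; last exact: L2Z.
  rewrite -/s abs2N abs2M abs2_real; clearbody s.
  by congr (0 <= _); rewrite !cReImE /abs2 /=; ring.
have [g0|g0] := eqVneq (norm2 g) 0.
  rewrite g0 mulr0; rewrite leNgt; apply/negP => s0.
  have := key ((norm2 f + 1) / (2 * abs2 s)).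
  rewrite g0 mulr0 addr0 [X in 0 <= X](_ : _ = - 1); first by rewrite oppr_ge0 ler10.
  by field; rewrite gt_eqF.
have gp : 0 < norm2 g by rewrite lt_def g0 norm2_ge0.
have := key (norm2 g)^-1.
rewrite [X in 0 <= X](_ : _ = (norm2 f * norm2 g - abs2 s) / norm2 g); last by field.
by rewrite pmulr_lge0 ?invr_gt0 // subr_ge0.
Qed.

Lemma norm2_le f g (M : R) : cmeasurable f -> L2 g ->
  {ae mu, forall t, abs2 (f t) <= M * abs2 (g t)} -> 0 <= M ->
  L2 f /\ norm2 f <= M * norm2 g.
Proof.
move=> mf hg fg M0; have mg := L2_cmeasurable hg.
have le : (sqnorm f <= (M * norm2 g)%:E)%E.
  rewrite EFinM -sqnormE // /sqnorm -ge0_integralZl_EFin //; last 2 first.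
  - by move=> t _; rewrite lee_fin sqr_ge0.
  - apply/measurable_EFinP; under eq_fun do rewrite cabs_sqr.
    exact: measurable_abs2.
  apply: ae_ge0_le_integral => //.
  - by move=> t _; rewrite lee_fin sqr_ge0.
  - apply/measurable_EFinP; under eq_fun do rewrite cabs_sqr.
    exact: measurable_abs2.
  - by move=> t _; rewrite -EFinM lee_fin mulr_ge0 ?sqr_ge0.
  - apply/measurable_EFinP/measurable_funM => //; under eq_fun do rewrite cabs_sqr.
    exact: measurable_abs2.
  - by apply: (aeS fg) => t h _; rewrite -EFinM lee_fin !cabs_sqr.
have hf : L2 f by split => //; apply: le_lt_trans le (ltry _).
by split => //; move: le; rewrite sqnormE // lee_fin.
Qed.

Lemma norm2_ae_eq f g : cmeasurable f -> cmeasurable g ->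
  {ae mu, forall t, f t = g t} -> norm2 f = norm2 g.
Proof.
move=> mf mg fg; apply: Rintegral_ae_eq; try exact: measurable_abs2.
by apply: (aeS fg) => t ->.
Qed.

Lemma L2_ae_eq f g : L2 f -> cmeasurable g ->
  {ae mu, forall t, f t = g t} -> L2 g.
Proof.
move=> hf mg fg; have [] // := @norm2_le g f 1 mg hf _ ler01.
by apply: (aeS fg) => t ->; rewrite mul1r.
Qed.

Lemma norm2_eq0 f : L2 f -> norm2 f = 0 -> {ae mu, forall t, f t = 0}.
Proof.
move=> /L2_integ hf /(integ_ae_eq0 hf) h.
by apply: (aeS (h _)) => [t|t /eqP]; [exact: abs2_ge0|rewrite abs2_eq0 => /eqP].
Qed.

Lemma L2_mul_bounded f g (M : R) : L2 f -> cmeasurable g -> 0 <= M ->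
  {ae mu, forall t, abs2 (g t) <= M} ->
  L2 (fun t => f t * g t) /\ norm2 (fun t => f t * g t) <= M * norm2 f.
Proof.
move=> hf mg M0 gM; apply: norm2_le => //.
  by apply: cmeasurableM => //; exact: L2_cmeasurable.
by apply: (aeS gM) => t h; rewrite abs2M mulrC ler_wpM2r // abs2_ge0.
Qed.

Definition cindic (A : set R) (t : R) : R[i] := (\1_A t)%:C.

Lemma cindicT (A : set R) t : A t -> cindic A t = 1.
Proof. by move=> At; rewrite /cindic indicE mem_set. Qed.

Lemma cindicF (A : set R) t : ~ A t -> cindic A t = 0.
Proof. by move=> At; rewrite /cindic indicE memNset. Qed.

Lemma cindicP (A : set R) t : (A t /\ cindic A t = 1) \/ (~ A t /\ cindic A t = 0).
Proof.
by have [At|At] := pselect (A t); [left; rewrite cindicT|right; rewrite cindicF].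
Qed.

Lemma cindicJ (A : set R) t : (cindic A t)^* = cindic A t.
Proof. by rewrite /cindic conjc_real. Qed.

Lemma cindic2 (A : set R) t : cindic A t * cindic A t = cindic A t.
Proof. by case: (cindicP A t) => -[_ ->]; rewrite ?mulr1 ?mulr0. Qed.

Lemma abs2_cindic_le (A : set R) t : abs2 (cindic A t) <= 1.
Proof.
by case: (cindicP A t) => -[_ ->]; rewrite abs2_real ?expr1n ?expr0n.
Qed.

Lemma cmeasurable_cindic (A : set R) : measurable A -> cmeasurable (cindic A).
Proof. by move=> mA; apply: cmeasurable_real; exact: measurable_indic. Qed.

Lemma L2_cindicM (A : set R) f : measurable A -> L2 f ->
  L2 (fun t => cindic A t * f t).
Proof.
move=> mA hf; apply: (L2_le _ (L2_integ hf)).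
  by apply: cmeasurableM; [exact: cmeasurable_cindic|exact: L2_cmeasurable].
by move=> t; rewrite abs2M ler_piMl ?abs2_ge0 // abs2_cindic_le.
Qed.

Lemma L2_cindic (A : set R) : measurable A -> (mu A < +oo)%E -> L2 (cindic A).
Proof.
move=> mA Aoo; apply: (L2_le (G := \1_A)); first exact: cmeasurable_cindic.
  apply/integrableP; split; first by apply/measurable_EFinP; exact: measurable_indic.
  under eq_integral do rewrite gee0_abs ?lee_fin//.
  by rewrite integral_indic // setIT.
move=> t; rewrite /cindic abs2_real indicE.
by case: (_ \in _); rewrite ?expr1n ?expr0n.
Qed.

End HilbertSpace.

(** * Unconditional sums *)
Section UnconditionalSums.
Context {R : realType} {I : choiceType}.
Implicit Types (a : I -> R[i]) (s : R[i]) (x : I -> R) (J K : {fset I}).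

(** Convergence along the finite index sets ordered by inclusion, measured by the
    squared modulus because that is what the norm estimates bound. *)
Definition fsums a s := forall e : R, 0 < e -> exists K, forall J,
  (K `<=` J)%fset -> abs2 (\sum_(k <- J) a k - s) < e.

Lemma fsums_uniq a s1 s2 : fsums a s1 -> fsums a s2 -> s1 = s2.
Proof.
move=> h1 h2; apply/eqP; rewrite -subr_eq0 -abs2_eq0.
apply: contraT => d0; have dp : 0 < abs2 (s1 - s2) by rewrite lt_def d0 abs2_ge0.
have d4 : 0 < abs2 (s1 - s2) / 4 by rewrite divr_gt0.
have [K1 hK1] := h1 _ d4; have [K2 hK2] := h2 _ d4.
have {}hK1 := hK1 _ (fsubsetUl K1 K2); have {}hK2 := hK2 _ (fsubsetUr K1 K2).
move: hK1 hK2; set S := \sum_(_ <- _) _ => k1 k2.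
have := abs2D_le (- (S - s1)) (S - s2); rewrite abs2N.
rewrite (_ : - (S - s1) + (S - s2) = s1 - s2); last by ring.
lra.
Qed.

Lemma fsums_ext a a' s s' : a =1 a' -> s = s' -> fsums a s -> fsums a' s'.
Proof. by move=> /funext -> ->. Qed.

Lemma fsums0 : fsums (fun=> 0) 0.
Proof. by move=> e e0; exists fset0 => J _; rewrite big1 // subr0 abs20. Qed.

Lemma fsumsD a a' s s' : fsums a s -> fsums a' s' ->
  fsums (fun k => a k + a' k) (s + s').
Proof.
move=> h h' e e0.
have e4 : 0 < e / 4 by rewrite divr_gt0.
have [K hK] := h _ e4; have [K' hK'] := h' _ e4.
exists (K `|` K')%fset => J; rewrite fsubUset => /andP[/hK k1 /hK' k2].
rewrite big_split /= opprD addrACA.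
apply: le_lt_trans (abs2D_le _ _) _; lra.
Qed.

Lemma fsums_sum (T : Type) (r : seq T) (A : T -> I -> R[i]) (s : T -> R[i]) :
  (forall i, fsums (A i) (s i)) ->
  fsums (fun k => \sum_(i <- r) A i k) (\sum_(i <- r) s i).
Proof.
move=> h; elim: r => [|i r ih].
  by rewrite big_nil; under eq_fun do rewrite big_nil; exact: fsums0.
by rewrite big_cons; under eq_fun do rewrite big_cons; exact: fsumsD.
Qed.

Lemma fsumsZ c a s : fsums a s -> fsums (fun k => c * a k) (c * s).
Proof.
move=> h e e0.
have c0 : 0 < 1 + abs2 c by rewrite ltr_pwDl // abs2_ge0.
have [K hK] := h _ (divr_gt0 e0 c0).
exists K => J /hK; rewrite -mulr_sumr -mulrBr abs2M ltr_pdivlMr //.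
apply: le_lt_trans; rewrite mulrC ler_wpM2l ?abs2_ge0 //.
by rewrite lerDr.
Qed.

Lemma fsumsJ a s : fsums a s -> fsums (fun k => (a k)^*) s^*.
Proof.
move=> h e e0; have [K hK] := h _ e0; exists K => J /hK.
rewrite -abs2J; congr (abs2 _ < e).
by rewrite [LHS]rmorphB /= [X in X - _]rmorph_sum.
Qed.

(** A finite set whose sum comes within e of the supremum leaves less than e to all
    further indices. *)
Lemma bounded_sums_tail x (M : R) : (forall k, 0 <= x k) ->
  (forall J, \sum_(k <- J) x k <= M) ->
  forall e : R, 0 < e -> exists K, forall J, (K `<=` J)%fset ->
    \sum_(k <- (J `\` K)%fset) x k < e.
Proof.
move=> x0 xM e e0.
pose S := [set \sum_(k <- J) x k | J in [set: {fset I}]].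
have hS : has_sup S.
  split; first by exists (\sum_(k <- fset0) x k), fset0.
  by exists M => _ [J _ <-].
have [_ [K _ <-] hK] := sup_adherent e0 hS.
exists K => J KJ; rewrite -(ltrD2l (\sum_(k <- K) x k)).
have -> : \sum_(k <- K) x k + \sum_(k <- (J `\` K)%fset) x k = \sum_(k <- J) x k.
  rewrite [RHS](big_fsetID _ (mem K)) /=; congr (_ + _).
    apply: eq_fbigl => k; rewrite !inE; apply/idP/andP => [kK|[]//].
    by rewrite (fsubsetP KJ).
  apply: eq_fbigl => k; rewrite !inE /=; by rewrite andbC.
have : \sum_(k <- J) x k <= sup S by apply: ub_le_sup; [case: hS|exists J].
lra.
Qed.

Lemma esum_leP x (c : R) : (forall k, 0 <= x k) ->
  (\esum_(k in [set: I]) (x k)%:E <= c%:E)%E <->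
  (forall J, \sum_(k <- J) x k <= c).
Proof.
move=> x0; split => [h J|h].
  rewrite -lee_fin; apply: le_trans h.
  rewrite -sumEFin; apply: esum_ge; exists [set` J].
    by split; [exact: finite_fset|].
  by rewrite fsbig_finite ?set_fsetK //; exact: finite_fset.
apply: ub_ereal_sup => _ [F [fF _] <-].
by rewrite fsbig_finite //= sumEFin lee_fin.
Qed.

End UnconditionalSums.

Section Rows.
Context {R : realType}.

(** A family supported in one row is summed by enlarging finite sets of that row:
    the other entries of a finite set of pairs contribute nothing. *)
Lemma fsums_row (a : int * int -> R[i]) n s :
  (forall k, k.2 != n -> a k = 0) ->
  fsums (fun m => a (m, n)) s -> fsums a s.
Proof.
move=> a0 h e e0; have [K hK] := h e e0.
exists [fset (m, n) | m in K]%fset => J KJ.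
pose Jn := [fset k in J | k.2 == n]%fset.
have -> : \sum_(k <- J) a k = \sum_(m <- [fset k.1 | k in Jn]%fset) a (m, n).
  rewrite big_imfset /=; last first.
    move=> [m1 n1] [m2 n2]; rewrite !inE /= => /andP[_ /eqP ->] /andP[_ /eqP ->].
    by move=> ->.
  rewrite (big_fsetID _ (fun k => k.2 == n)) /= [X in _ + X]big1_seq ?addr0.
    rewrite [LHS]big_seq [RHS]big_seq; apply: eq_bigr => -[m n'].
    by rewrite !inE /= => /andP[_ /eqP ->].
  by move=> k; rewrite !inE /= => /andP[_ /a0].
apply: hK; apply/fsubsetP => m mK; apply/imfsetP; exists (m, n) => //=.
rewrite !inE /= eqxx andbT; apply: (fsubsetP KJ).
by apply/imfsetP; exists m.
Qed.

Lemma fsums_rows (a : int * int -> R[i]) (N : seq int) (s : int -> R[i]) :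
  uniq N -> (forall k, k.2 \notin N -> a k = 0) ->
  (forall n, n \in N -> fsums (fun m => a (m, n)) (s n)) ->
  fsums a (\sum_(n <- N) s n).
Proof.
move=> uN a0 h.
pose A n (k : int * int) := if (k.2 == n) && (n \in N) then a k else 0.
pose s' n := if n \in N then s n else 0.
apply: (@fsums_ext _ _ (fun k => \sum_(n <- N) A n k) _ (\sum_(n <- N) s' n)).
- move=> k; have [kN|kN] := boolP (k.2 \in N).
    rewrite (bigD1_seq k.2) //= big1 ?addr0; first by rewrite /A eqxx kN.
    by move=> n nk; rewrite /A eq_sym (negbTE nk).
  rewrite a0 // big1_seq // => n /= nN; rewrite /A nN andbT.
  by case: eqP => // kn; move: kN; rewrite kn nN.
- by rewrite big_seq [RHS]big_seq; apply: eq_bigr => n nN; rewrite /s' nN.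
- apply: fsums_sum => n; apply: (@fsums_row _ n).
    by move=> k kn; rewrite /A (negbTE kn).
  rewrite /A /s' /=; case: ifPn => nN.
    by apply: fsums_ext (h n nN) => // m; rewrite eqxx.
  by apply: fsums_ext fsums0 => // m; rewrite andbF.
Qed.

End Rows.

(** * Bessel families and reconstruction *)
Section BesselFamilies.
Context {R : realType} {I : choiceType}.
Implicit Types (G H : I -> R -> R[i]) (f u : R -> R[i]) (J K : {fset I}).

(** The bound is taken positive because both B and its inverse serve as weights. *)
Definition bessel_family G (B : R) := [/\ forall k, L2 (G k), 0 < B &
  forall f, L2 f -> forall J,
    \sum_(k <- J) abs2 (inner f (G k)) <= B * norm2 f].

Definition synthesis G H f J : R -> R[i] :=
  fun t => \sum_(k <- J) inner f (G k) * H k t.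

Definition weakly_reconstructs G H f u :=
  fsums (fun k => inner f (G k) * inner (H k) u) (inner f u).

Definition strongly_reconstructs G H f := forall e : R, 0 < e ->
  exists K, forall J, (K `<=` J)%fset ->
    norm2 (fun t => f t - synthesis G H f J t) < e.

Lemma L2_synthesis G H f J : (forall k, L2 (H k)) -> L2 (synthesis G H f J).
Proof. by move=> hH; apply: L2_sum => k; exact: L2Z. Qed.

Lemma inner_synthesis G H f u J : (forall k, L2 (H k)) -> L2 u ->
  inner (synthesis G H f J) u = \sum_(k <- J) inner f (G k) * inner (H k) u.
Proof. exact: inner_suml. Qed.

(** Duality: the norm of a synthesized function is its pairing with itself, and
    the Bessel bound controls the coefficients of that pairing. *)
Lemma norm2_synthesis_le H (B : R) (a : I -> R[i]) J : bessel_family H B ->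
  norm2 (fun t => \sum_(k <- J) a k * H k t) <= B * \sum_(k <- J) abs2 (a k).
Proof.
move=> [hH B0 hB]; set v := fun t => _.
have hv : L2 v by apply: L2_sum => k; exact: L2Z.
have : 2 * norm2 v <= \sum_(k <- J) (B * abs2 (a k) + B^-1 * abs2 (inner v (H k))).
  rewrite -[norm2 v]/(complex.Re (norm2 v)%:C) -innerff //.
  rewrite {1}/v inner_suml // raddf_sum /= mulr_sumr; apply: ler_sum => k _.
  apply: le_trans (_ : 2 * `|complex.Re (a k * inner (H k) v)| <= _).
    by rewrite ler_wpM2l // ler_norm.
  by rewrite -(abs2J (inner v _)) -innerJ //; exact: abs2_amgm.
rewrite big_split /= -!mulr_sumr => h.
have : B^-1 * \sum_(k <- J) abs2 (inner v (H k)) <= norm2 v.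
  by rewrite ler_pdivrMl //; exact: hB.
lra.
Qed.

(** Boundedness of synthesis makes the partial sums a Cauchy net in norm, and a
    Cauchy net converges in norm to its weak limit. *)
Lemma weak_strong G H (B B' : R) f : bessel_family G B -> bessel_family H B' ->
  L2 f -> (forall u, L2 u -> weakly_reconstructs G H f u) ->
  strongly_reconstructs G H f.
Proof.
move=> [hG B0 hB] bH hf hw e e0; have [hH B'0 _] := bH.
have d0 : 0 < e / (4 * B') by rewrite divr_gt0 // mulr_gt0.
have [K hK] := bounded_sums_tail (fun k => abs2_ge0 _) (hB f hf) d0.
exists K => J0 KJ0.
set u := fun t => f t - _.
have hu : L2 u by apply: L2B => //; exact: L2_synthesis.
have Nu0 := norm2_ge0 u.
have key (eta : R) : 0 < eta -> norm2 u ^+ 2 <= 2 * eta + e / 2 * norm2 u.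
  move=> eta0; have [K' hK'] := hw u hu _ eta0.
  (* the tail estimate is available for index sets that contain K *)
  have JK : ((J0 `|` K') `\` J0 = ((J0 `|` K') `\` J0 `|` K) `\` K)%fset.
    apply/fsetP => k; rewrite !inE.
    have := fsubsetP KJ0 k; by case: (k \in K) => [->|_] //; rewrite ?orbF.
  have := hK _ (fsubsetUr ((J0 `|` K') `\` J0)%fset K); rewrite -JK => tail.
  have /(hK' _) := fsubsetUr J0 K'; rewrite -inner_synthesis // => close.
  pose w t := \sum_(k <- ((J0 `|` K') `\` J0)%fset) inner f (G k) * H k t.
  have hw' : L2 w by apply: L2_sum => k; exact: L2Z.
  have Nw : norm2 w <= e / 4.
    apply: le_trans (norm2_synthesis_le _ _ bH) _.
    have -> : e / 4 = B' * (e / (4 * B')) by field; rewrite gt_eqF.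
    by rewrite ler_pM2l // ltW.
  have split_sum t : synthesis G H f (J0 `|` K')%fset t = synthesis G H f J0 t + w t.
    rewrite /synthesis (big_fsetID _ (mem J0)) /=; congr (_ + _).
      by apply: eq_fbigl => k; rewrite !inE /= andbC; case: (k \in J0).
    by apply: eq_fbigl => k; rewrite !inE /= andbC.
  have E : inner u u = - (inner (synthesis G H f (J0 `|` K')%fset) u - inner f u)
      + inner w u.
    rewrite {1}/u innerBl //; last exact: L2_synthesis.
    have -> : synthesis G H f (J0 `|` K')%fset =
        fun t => synthesis G H f J0 t + w t by apply/funext.
    rewrite innerDl //; last exact: L2_synthesis.
    by ring.
  have : abs2 (inner u u) <= 2 * eta + 2 * (e / 4 * norm2 u).
    rewrite E; apply: le_trans (abs2D_le _ _) _; rewrite abs2N.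
    apply: lerD; first by rewrite ler_pM2l // ltW.
    rewrite ler_pM2l //; apply: le_trans (cauchy_schwarz hw' hu) _.
    by rewrite ler_wpM2r.
  by rewrite innerff // abs2_real; lra.
have {key} : norm2 u ^+ 2 <= e / 2 * norm2 u.
  apply/ler_addgt0Pr => eta eta0.
  have := key (eta / 2) (divr_gt0 eta0 _); rewrite ltr0n => /(_ isT); lra.
have [->//|u0] := eqVneq (norm2 u) 0.
rewrite expr2 ler_pM2r ?lt_def ?u0 //; lra.
Qed.

Lemma strong_weak G H f u : (forall k, L2 (H k)) -> L2 f -> L2 u ->
  strongly_reconstructs G H f -> weakly_reconstructs G H f u.
Proof.
move=> hH hf hu hs e e0.
have u0 : 0 < 1 + norm2 u by rewrite ltr_pwDl // norm2_ge0.
have [K hK] := hs _ (divr_gt0 e0 u0); exists K => J /hK h.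
have hS : L2 (synthesis G H f J) by exact: L2_synthesis.
rewrite -inner_synthesis // -innerBl //.
apply: le_lt_trans (cauchy_schwarz _ hu) _; first exact: L2B.
rewrite norm2_sub; move: h; rewrite ltr_pdivlMr // => h; apply: le_lt_trans h.
by rewrite ler_wpM2l ?norm2_ge0 // lerDr.
Qed.

Lemma weak_sym G H f u : (forall k, L2 (G k)) -> (forall k, L2 (H k)) ->
  L2 f -> L2 u ->
  weakly_reconstructs G H f u -> weakly_reconstructs H G u f.
Proof.
move=> hG hH hf hu /fsumsJ; apply: fsums_ext => [k|]; last by rewrite -innerJ.
by rewrite conjcM -!innerJ // mulrC.
Qed.

(** Partial sums depend continuously on f, uniformly in the index set, so weak
    reconstruction passes to limits. *)
Lemma weak_dense G H (B B' : R) f u : bessel_family G B -> bessel_family H B' ->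
  L2 f -> L2 u ->
  (forall e : R, 0 < e -> exists2 f', L2 f' &
    norm2 (fun t => f t - f' t) < e /\ weakly_reconstructs G H f' u) ->
  weakly_reconstructs G H f u.
Proof.
move=> [hG B0 hB] bH hf hu dense e e0; have [hH B'0 _] := bH.
have Nu0 := norm2_ge0 u.
set C := 4 * (B' * B + 1) * (1 + norm2 u).
have BB0 : 0 < B' * B by rewrite mulr_gt0.
have C0 : 0 < C by rewrite /C !mulr_gt0 // ltr_wpDr.
have [f' hf' [Nf' wf']] := dense _ (divr_gt0 e0 (mulr_gt0 C0 (ltr0Sn _ 1))).
have [K hK] := wf' _ (divr_gt0 e0 (ltr0Sn _ 3)).
exists K => J /hK.
pose r t := f t - f' t.
have hr : L2 r by exact: L2B.
rewrite -!inner_synthesis // => close.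
have hS g : L2 (synthesis G H g J) by exact: L2_synthesis.
have E : synthesis G H f J = fun t => synthesis G H f' J t + synthesis G H r J t.
  apply/funext => t; rewrite /synthesis -big_split /=; apply: eq_bigr => k _.
  by rewrite -mulrDl /r innerBl // addrC subrK.
rewrite E innerDl //.
have -> : inner f u = inner f' u + inner r u by rewrite /r innerBl // addrC subrK.
rewrite opprD addrACA.
have h1 : abs2 (inner (synthesis G H r J) u) <= B' * B * norm2 r * norm2 u.
  apply: le_trans (cauchy_schwarz (hS r) hu) _; rewrite ler_wpM2r //.
  apply: le_trans (norm2_synthesis_le _ _ bH) _.
  by rewrite -mulrA ler_pM2l //; exact: hB.
have h2 : abs2 (inner r u) <= norm2 r * norm2 u := cauchy_schwarz hr hu.
have h3 := abs2D_le (inner (synthesis G H r J) u) (- inner r u).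
rewrite abs2N in h3.
have h4 : 2 * (2 * (B' * B * norm2 r * norm2 u) + 2 * (norm2 r * norm2 u)) <= norm2 r * C.
  have -> : 2 * (2 * (B' * B * norm2 r * norm2 u) + 2 * (norm2 r * norm2 u)) =
    norm2 r * (4 * (B' * B + 1) * norm2 u) by ring.
  rewrite ler_wpM2l ?norm2_ge0 // /C ler_wpM2l ?lerDr //.
  by rewrite mulr_ge0 // addr_ge0 // ltW.
have h5 : norm2 r * C < e / 2.
  move: Nf'; rewrite -/(r) ltr_pdivlMr; last by rewrite mulr_gt0.
  rewrite -/(norm2 r) => h; rewrite ltr_pdivlMr //; apply: le_lt_trans h.
  by rewrite -[leLHS]mulrA.
apply: le_lt_trans (abs2D_le _ _) _.
lra.
Qed.

(** Pairing the reconstruction of a function with the function itself turns the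
    upper bound of one family into a lower bound of the other. *)
Lemma weak_lower_bound G H (B' c : R) f : bessel_family H B' ->
  (forall k, L2 (G k)) -> L2 f ->
  weakly_reconstructs G H f f ->
  (forall J, \sum_(k <- J) abs2 (inner f (G k)) <= c) ->
  norm2 f <= B' * c.
Proof.
move=> [hH B'0 hB] hG hf wf hc; have Nf0 := norm2_ge0 f.
have key (e : R) : 0 < e -> 2 * (norm2 f - e) <= B' * c + norm2 f.
  move=> e0; have e20 : 0 < e ^+ 2 by rewrite exprn_gt0.
  have [K hK] := wf _ e20; have {hK} := hK K (fsubset_refl K).
  rewrite innerff //; set S := \sum_(k <- K) _ => hS.
  have reS : norm2 f - e <= complex.Re S.
    rewrite leNgt; apply/negP => h.
    have : e ^+ 2 < abs2 (S - (norm2 f)%:C).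
      rewrite /abs2 !cReImE /=; apply: lt_le_trans (_ : (complex.Re S - norm2 f) ^+ 2 <= _).
        by rewrite -[ltRHS]sqrrN ltr_pXn2r // ?nnegrE; lra.
      by rewrite lerDl sqr_ge0.
    by rewrite ltNge ltW.
  have : 2 * complex.Re S <= B' * \sum_(k <- K) abs2 (inner f (G k)) +
      B'^-1 * \sum_(k <- K) abs2 (inner f (H k)).
    rewrite !mulr_sumr -big_split /= raddf_sum /= mulr_sumr.
    apply: ler_sum => k _.
    apply: le_trans (_ : 2 * `|complex.Re (inner f (G k) * inner (H k) f)| <= _).
      by rewrite ler_wpM2l // ler_norm.
    by rewrite -(abs2J (inner f (H k))) -innerJ //; exact: abs2_amgm.
  have h1 : B' * \sum_(k <- K) abs2 (inner f (G k)) <= B' * c by rewrite ler_pM2l.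
  have h2 : B'^-1 * \sum_(k <- K) abs2 (inner f (H k)) <= norm2 f.
    by rewrite ler_pdivrMl //; exact: hB.
  lra.
apply/ler_addgt0Pr => e e0.
have := key (e / 2) (divr_gt0 e0 (ltr0Sn _ 1)); lra.
Qed.

End BesselFamilies.

(** * Translations and exponentials *)
Section Translation.
Context {R : realType}.
Local Notation mu := (@lebesgue_measure R).
Local Notation integ f := (mu.-integrable [set: R] (EFin \o f)).

Definition shiftm (a : R) : measurableTypeR R -> measurableTypeR R := fun t => t + a.

Lemma measurable_shift (a : R) : measurable_fun [set: R] (fun t : R => t + a).
Proof. by apply: measurable_funD. Qed.

(** Half-open intervals determine the measure. *)
Lemma lebesgue_measure_shift (a : R) (A : set R) : measurable A ->
  pushforward mu (shiftm a) A = mu A.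
Proof.
move=> mA; apply/esym; apply: lebesgue_measure_unique => //=.
  exact: measurable_shift.
move=> mf _ [[x y]] _ <-.
rewrite /pushforward.
have -> : shiftm a @^-1` `]x, y]%classic = `]x - a, y - a]%classic.
  by apply/seteqP; split => t /=; rewrite !in_itv /= /shiftm ltrBlDr lerBrDr.
rewrite !lebesgue_measure_itv /= !lte_fin ltrD2r.
by rewrite -!EFinB opprB addrA subrK.
Qed.

Lemma integral_shift (a : R) (F : R -> \bar R) :
  measurable_fun [set: R] F -> (forall t, 0 <= F t)%E ->
  (\int[mu]_t F (t + a)%R = \int[mu]_t F t)%E.
Proof.
move=> mF F0.
rewrite -[LHS](ge0_integral_pushforward (phi := shiftm a) (measurable_shift a) mu measurableT mF).
  apply: eq_measure_integral; first exact: measurable_shift.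
  by move=> mf A mA _; exact: lebesgue_measure_shift.
by move=> t _.
Qed.

Lemma ae_shift (a : R) (P : R -> Prop) :
  {ae mu, forall t, P t} -> {ae mu, forall t, P (t + a)}.
Proof.
move=> [N [mN N0 PN]]; exists (shiftm a @^-1` N); split.
- by rewrite -[X in measurable X]setTI; exact: measurable_shift.
- by rewrite -[LHS]/(pushforward mu (shiftm a) N) lebesgue_measure_shift.
- by move=> t /= nP; exact: PN.
Qed.

Lemma integ_shift (a : R) (f : R -> R) : integ f -> integ (fun t => f (t + a)).
Proof.
move=> hf; have /measurable_EFinP mf := measurable_int _ hf.
apply/integrableP; split.
  by apply/measurable_EFinP; exact: (measurableT_comp mf (measurable_shift a)).
rewrite (integral_shift a (F := fun t => `|(f t)%:E|%E)) //.
  by case/integrableP : hf.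
by apply/measurable_EFinP; exact: measurableT_comp.
Qed.

Lemma Rintegral_shift (a : R) (f : R -> R) : integ f ->
  Rintegral mu [set: R] (fun t => f (t + a)) = Rintegral mu [set: R] f.
Proof.
move=> hf; have mf := measurable_int _ hf; rewrite /Rintegral; congr fine.
rewrite [LHS]integralE [RHS]integralE.
have mp : measurable_fun [set: R] (fun t => ((EFin \o f)^\+ t)%E) by exact: measurable_funepos.
have mn : measurable_fun [set: R] (fun t => ((EFin \o f)^\- t)%E) by exact: measurable_funeneg.
congr (_ - _)%E.
  rewrite -[RHS](integral_shift a mp (funepos_ge0 _)).
  by apply: eq_integral => t _; rewrite !funeposE.
rewrite -[RHS](integral_shift a mn (funeneg_ge0 _)).
by apply: eq_integral => t _; rewrite !funenegE.
Qed.

Implicit Types f g : R -> R[i].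

Lemma cintegrable_shift (a : R) f :
  cintegrable f -> cintegrable (fun t => f (t + a)).
Proof.
move=> [f1 f2]; split; first exact: (integ_shift a f1).
exact: (integ_shift a f2).
Qed.

Lemma cint_shift (a : R) f : cintegrable f -> cint (fun t => f (t + a)) = cint f.
Proof.
move=> [f1 f2]; apply: complexP => /=; first exact: (Rintegral_shift a f1).
exact: (Rintegral_shift a f2).
Qed.

Lemma L2_shift (a : R) f : L2 f -> L2 (fun t => f (t + a)).
Proof.
move=> /L2P[mf hf]; apply/L2P; split; first exact: cmeasurable_shift.
exact: (integ_shift a hf).
Qed.

Lemma norm2_shift (a : R) f : L2 f -> norm2 (fun t => f (t + a)) = norm2 f.
Proof. by move=> /L2_integ /(Rintegral_shift a). Qed.

End Translation.

Section Exponentials.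
Context {R : realType}.
Local Notation mu := (@lebesgue_measure R).

Lemma expiD (x y : R) : expi (x + y) = expi x * expi y.
Proof. by apply: complexP; rewrite ?cReImE /= ?cosD ?sinD //; ring. Qed.

Lemma expiN (x : R) : expi (- x) = (expi x)^*.
Proof. by apply: complexP; rewrite ?cReImE /= ?cosN ?sinN. Qed.

Lemma abs2_expi (x : R) : abs2 (expi x) = 1.
Proof. exact: cos2Dsin2. Qed.

Lemma expi0 : expi (0 : R) = 1.
Proof. by rewrite /expi cos0 sin0. Qed.

Lemma expi_2pi (m : int) : expi (2 * pi * m%:~R) = 1 :> R[i].
Proof.
have hn (n : nat) : expi (2 * pi * n%:R) = 1 :> R[i].
  elim: n => [|n ih]; first by rewrite mulr0 expi0.
  rewrite -[n.+1%:R]natr1 mulrDr mulr1 expiD ih mul1r /expi mulr_natl cos2pi.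
  by rewrite -[pi *+ 2]add0r sinD2pi sin0.
case: m => n; first exact: hn.
by rewrite NegzE rmorphN mulrN expiN (hn n.+1) conjc1.
Qed.

Lemma measurable_expi (w : R) : cmeasurable (fun t => expi (w * t)).
Proof.
have mw : measurable_fun [set: R] (fun t => w * t) by exact: measurable_funM.
split; apply: (measurableT_comp _ mw); apply: continuous_measurable_fun.
  exact: continuous_cos.
exact: continuous_sin.
Qed.

Variable b : R.
Hypothesis b0 : 0 < b.

Definition fexp (m : int) (t : R) : R[i] := expi (2 * pi * m%:~R * b * t).

Lemma fexpM m n t : fexp m t * fexp n t = fexp (m + n) t.
Proof. by rewrite /fexp -expiD rmorphD /=; congr expi; ring. Qed.

Lemma fexpJ m t : (fexp m t)^* = fexp (- m) t.
Proof. by rewrite /fexp -expiN rmorphN /=; congr expi; ring. Qed.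

Lemma fexpD m s t : fexp m (s + t) = fexp m s * fexp m t.
Proof. by rewrite /fexp -expiD mulrDr. Qed.

Lemma fexp0 t : fexp 0 t = 1.
Proof. by rewrite /fexp mulr0 !mul0r expi0. Qed.

Lemma fexp_periodic m t : fexp m (t + b^-1) = fexp m t.
Proof.
by rewrite fexpD /fexp [X in _ * expi X]mulfK ?gt_eqF // expi_2pi mulr1.
Qed.

Lemma abs2_fexp m t : abs2 (fexp m t) = 1.
Proof. exact: abs2_expi. Qed.

Lemma fexp_le1 m : {ae mu, forall t, abs2 (fexp m t) <= 1}.
Proof. by apply: aeT => t; rewrite abs2_fexp. Qed.

Lemma cmeasurable_fexp m : cmeasurable (fexp m).
Proof. exact: measurable_expi. Qed.

Variable a : R.
Let I : set R := `[a, a + b^-1[%classic.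

Definition wexp (m : int) (t : R) : R[i] := cindic I t * fexp m t.

Let mI : measurable I.
Proof. exact: measurable_itv. Qed.

Let bV0 : 0 < b^-1.
Proof. by rewrite invr_gt0. Qed.

Lemma measure_window : mu I = (b^-1)%:E.
Proof.
rewrite /I lebesgue_measure_itv /= lte_fin ltrDl bV0 -EFinB.
by rewrite addrC addKr.
Qed.

Lemma L2_window : L2 (cindic I).
Proof. by apply: L2_cindic => //; rewrite measure_window ltry. Qed.

Lemma L2_wexp m : L2 (wexp m).
Proof.
have [] // := @L2_mul_bounded R (cindic I) (fexp m) 1 L2_window.
  exact: cmeasurable_fexp.
exact: fexp_le1.
Qed.

Lemma cintegrable_wexp m : cintegrable (wexp m).
Proof.
have := L2_cint (L2_wexp m) L2_window; congr cintegrable.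
by apply/funext => t; rewrite cindicJ mulrAC cindic2.
Qed.

Lemma cint_window : cint (cindic I) = (b^-1)%:C.
Proof.
rewrite cint_real; congr (_ %:C).
transitivity (fine (mu I)); last by rewrite measure_window.
by rewrite /Rintegral integral_indic // setIT.
Qed.

(** Shifting the window by a part of the period multiplies the integral by a phase
    and, by periodicity, does not change it; half a period of the m-th exponential
    gives the phase -1. *)
Lemma cint_wexp m : m != 0 -> cint (wexp m) = 0.
Proof.
move=> m0.
pose s : R := b^-1 / (2 * `|m|%:~R).
have m1 : (1 : R) <= `|m|%:~R by rewrite -[1]/(1%:~R) ler_int -gtz0_ge1 normr_gt0.
have s0 : 0 < s by rewrite divr_gt0 // mulr_gt0 // (lt_le_trans ltr01).
have sp : s < b^-1.
  rewrite /s ltr_pdivrMr ?mulr_gt0 // ?(lt_le_trans ltr01) //.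
  rewrite ltr_pMr //; lra.
have es : fexp m s = -1.
  rewrite /fexp (_ : 2 * pi * m%:~R * b * s = pi * (sgz m)%:~R); last first.
    rewrite /s {1}[m]intEsg !intrM; field.
    by apply/andP; split; rewrite gt_eqF //; exact: lt_le_trans ltr01 m1.
  have : sgz m = 1 \/ sgz m = -1.
    case: (ltrgt0P m) m0 => // hm _; first by left; exact: gtr0_sgz.
    by right; exact: ltr0_sgz.
  case=> ->; rewrite ?mulr1 ?mulrN1 ?expiN /expi cospi sinpi.
    by apply: complexP => //=; rewrite oppr0.
  by apply: complexP => //=; rewrite !oppr0.
pose I1 : set R := `[a, a + b^-1 - s[%classic.
pose I2 : set R := `[a - s, a[%classic.
pose w (A : set R) t := cindic A t * fexp m t.
have cw A : measurable A -> (mu A < +oo)%E -> cintegrable (w A).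
  move=> mA Aoo; have hA := L2_cindic mA Aoo.
  have [hw _] := @L2_mul_bounded R (cindic A) (fexp m) 1 hA
    (cmeasurable_fexp m) ler01 (fexp_le1 m).
  have := L2_cint hw hA; congr cintegrable.
  by apply/funext => t; rewrite cindicJ mulrAC cindic2.
have foo x y : (mu `[x, y[%classic < +oo)%E.
  by rewrite lebesgue_measure_itv /=; case: ifP => _; rewrite ?ltry // -EFinB ltry.
have c1 : cintegrable (w I1) by apply: cw; [exact: measurable_itv|exact: foo].
have c2 : cintegrable (w I2) by apply: cw; [exact: measurable_itv|exact: foo].
have E1 : cint (wexp m) = - (cint (w I1) + cint (w I2)).
  rewrite -(cint_shift s (cintegrable_wexp m)) -cintD // -mulN1r -cintZ; last exact: cintegrableD.
  congr cint; apply/funext => t; rewrite /wexp /w fexpD es.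
  have -> : cindic I (t + s) = cindic I1 t + cindic I2 t.
    rewrite /cindic !indicE -rmorphD /=; congr (_ %:C).
    rewrite !mem_setE !in_itv /=.
    have [h1|h1] := leP a (t + s); have [h2|h2] := ltP (t + s) (a + b^-1);
    have [h3|h3] := leP a t; have [h4|h4] := ltP t (a + b^-1 - s);
    have [h5|h5] := leP (a - s) t; rewrite /= ?addr0 ?add0r //; lra.
  by ring.
pose I3 : set R := `[a + b^-1 - s, a + b^-1[%classic.
have c3 : cintegrable (w I3) by apply: cw; [exact: measurable_itv|exact: foo].
have E3 : cint (w I3) = cint (w I2).
  rewrite -(cint_shift b^-1 c3); congr cint; apply/funext => t.
  rewrite /w fexp_periodic; congr (_ * _); rewrite /cindic !indicE; congr (_ %:R%:C).
  rewrite !mem_setE !in_itv /= addrAC lerD2r ltrD2r //.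
have E2 : cint (wexp m) = cint (w I1) + cint (w I2).
  rewrite -E3 -cintD //; congr cint; apply/funext => t; rewrite /wexp /w -mulrDl.
  congr (_ * _).
  rewrite /cindic !indicE -rmorphD /=; congr (_ %:C).
  rewrite !mem_setE !in_itv /=.
  have [h1|h1] := leP a t; have [h2|h2] := ltP t (a + b^-1);
  have [h3|h3] := leP (a + b^-1 - s) t; rewrite /= ?addr0 ?add0r //; lra.
have : cint (wexp m) + cint (wexp m) = 0 by rewrite {1}E1 E2 addNr.
by move/eqP; rewrite -mulr2n mulrn_eq0 /= => /eqP.
Qed.

End Exponentials.

(** * Dominated convergence and cutoffs *)
Section Limits.
Context {R : realType}.
Local Notation mu := (@lebesgue_measure R).
Local Notation integ f := (mu.-integrable [set: R] (EFin \o f)).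

Lemma norm2_dominated (F : nat -> R -> R[i]) (G : R -> R) :
  (forall n, cmeasurable (F n)) -> integ G ->
  (forall n t, abs2 (F n t) <= G t) ->
  {ae mu, forall t, (fun n => abs2 (F n t)) @ \oo --> (0 : R)} ->
  forall e : R, 0 < e -> exists n, norm2 (F n) < e.
Proof.
move=> mF hG FG F0 e e0.
have [||||| _ _] := @dominated_convergence _ _ R mu [set: R] measurableT
  (fun n t => (abs2 (F n t))%:E) (fun=> 0%E) (EFin \o G).
- by move=> n; apply/measurable_EFinP; exact: measurable_abs2.
- exact: measurable_cst.
- by apply: (aeS F0) => t h _; apply: cvg_EFin => //; exact: nearW.
- exact: hG.
- by apply: aeT => t n _; rewrite lee_fin ger0_norm ?abs2_ge0.
rewrite integral0 => /fine_cvgP[_] /cvgrPdist_lt /(_ e e0) [n _ /(_ n (leqnn n))] /=.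
rewrite sub0r normrN ger0_norm; last first.
  by apply: fine_ge0; apply: integral_ge0 => t _; rewrite lee_fin abs2_ge0.
by move=> h; exists n.
Qed.

Lemma ae_neq (x : R) : {ae mu, forall t, t <> x}.
Proof.
exists [set x]; split; first exact: measurable_set1.
  exact: lebesgue_measure_set1.
by move=> t /= /contrapT.
Qed.

Lemma bernoulli_ineq (x : R) m : 0 <= x <= 1 -> 1 - m%:R * x <= (1 - x) ^+ m.
Proof.
move=> /andP[x0 x1]; elim: m => [|m ih]; first by rewrite mul0r subr0 expr0.
rewrite exprS -natr1; apply: le_trans (_ : (1 - x) * (1 - m%:R * x) <= _).
  have : 0 <= m%:R * x * x by rewrite !mulr_ge0.
  lra.
by rewrite ler_wpM2l // subr_ge0.
Qed.

Lemma bernoulli_ineq_add (x : R) m : 0 <= x -> 1 + m%:R * x <= (1 + x) ^+ m.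
Proof.
move=> x0; elim: m => [|m ih]; first by rewrite mul0r addr0 expr0.
rewrite exprS -natr1; apply: le_trans (_ : (1 + x) * (1 + m%:R * x) <= _).
  have : 0 <= m%:R * x * x by rewrite !mulr_ge0.
  lra.
by rewrite ler_wpM2l // addr_ge0.
Qed.

(** Powers of 1 - q^n with exponents growing like 2^n turn a continuous function
    with values in [0, 1] into the indicator of the set where it is below 1/2. *)
Definition cutoff (q : R) (n : nat) : R := (1 - q ^+ n) ^+ (2 ^ n).

Lemma cutoff_bounds q n : 0 <= q <= 1 -> 0 <= cutoff q n <= 1.
Proof.
move=> /andP[q0 q1]; have qn0 : 0 <= q ^+ n by exact: exprn_ge0.
have qn1 : q ^+ n <= 1 by exact: exprn_ile1.
by apply/andP; split; [apply: exprn_ge0|apply: exprn_ile1]; lra.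
Qed.

Lemma cutoff_below q : 0 <= q -> q < 1 / 2 -> cutoff q @ \oo --> (1 : R).
Proof.
move=> q0 q2; have q01 : 0 <= q <= 1 by apply/andP; split; lra.
apply: (@squeeze_cvgr _ _ _ _ (fun n => 1 - (2 * q) ^+ n) (fun=> 1)); last 2 first.
- rewrite -[X in _ --> X]subr0; apply: cvgB; first exact: cvg_cst.
  by apply: cvg_expr; rewrite ger0_norm; lra.
- exact: cvg_cst.
apply: nearW => n; apply/andP; split; last first.
  by case/andP: (cutoff_bounds n q01).
rewrite exprMn -natrX; apply: bernoulli_ineq.
by rewrite exprn_ge0 //= exprn_ile1 //; lra.
Qed.

Lemma cutoff_above q : 1 / 2 < q -> q <= 1 -> cutoff q @ \oo --> (0 : R).
Proof.
move=> q2 q1; have q0 : 0 < q by lra.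
have q01 : 0 <= q <= 1 by apply/andP; split; lra.
apply: (@squeeze_cvgr _ _ _ _ (fun=> 0) (fun n => (2 * q)^-1 ^+ n)); last 2 first.
- exact: cvg_cst.
- apply: cvg_expr; rewrite ger0_norm ?invr_ge0; last lra.
  by rewrite invf_lt1; lra.
apply: nearW => n; apply/andP; split.
  by case/andP: (cutoff_bounds n q01).
have qn0 : 0 < q ^+ n by exact: exprn_gt0.
have qn1 : q ^+ n <= 1 by apply: exprn_ile1; lra.
rewrite exprVn -[leRHS]mul1r ler_pdivlMr; last by apply: exprn_gt0; lra.
(* compare with the reciprocal of (1 + q^n)^(2^n), as (1 - x) (1 + x) <= 1 *)
apply: le_trans (_ : cutoff q n * (1 + q ^+ n) ^+ (2 ^ n) <= _).
  rewrite ler_wpM2l //; first by case/andP: (cutoff_bounds n q01).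
  apply: le_trans (bernoulli_ineq_add (2 ^ n) (ltW qn0)).
  by rewrite exprMn natrX lerDr.
rewrite /cutoff -exprMn; apply: exprn_ile1.
  by rewrite mulr_ge0 //; lra.
have -> : (1 - q ^+ n) * (1 + q ^+ n) = 1 - q ^+ n ^+ 2 by ring.
by rewrite gerBl sqr_ge0.
Qed.

End Limits.

(** * Density of trigonometric polynomials: half-lines *)
Section TrigonometricDensity.
Context {R : realType}.
Local Notation mu := (@lebesgue_measure R).
Local Notation integ f := (mu.-integrable [set: R] (EFin \o f)).
Variables (b : R) (b0 : 0 < b) (a : R).
Let I : set R := `[a, a + b^-1[%classic.

Let mI : measurable I.
Proof. exact: measurable_itv. Qed.

Definition trig_poly (P : R -> R[i]) := exists s : seq (R[i] * int),
  forall t, P t = \sum_(x <- s) x.1 * fexp b x.2 t.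

Lemma trig_ext P Q : P =1 Q -> trig_poly P -> trig_poly Q.
Proof. by move=> /funext ->. Qed.

Lemma trig_exp c m : trig_poly (fun t => c * fexp b m t).
Proof. by exists [:: (c, m)] => t; rewrite big_seq1. Qed.

Lemma trig_cst c : trig_poly (fun=> c).
Proof. by apply: trig_ext (trig_exp c 0) => t; rewrite fexp0 mulr1. Qed.

Lemma trigD P Q : trig_poly P -> trig_poly Q -> trig_poly (fun t => P t + Q t).
Proof.
by move=> [s hs] [s' hs']; exists (s ++ s') => t; rewrite big_cat /= -hs -hs'.
Qed.

Lemma trigM P Q : trig_poly P -> trig_poly Q -> trig_poly (fun t => P t * Q t).
Proof.
move=> [s hs] [s' hs'].
exists [seq (x.1 * y.1, x.2 + y.2) | x <- s, y <- s'] => t.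
rewrite hs hs' big_allpairs_dep /= mulr_suml; apply: eq_bigr => x _.
rewrite mulr_sumr; apply: eq_bigr => y _ /=.
by rewrite -fexpM; ring.
Qed.

Lemma trigX P n : trig_poly P -> trig_poly (fun t => P t ^+ n).
Proof.
move=> hP; elim: n => [|n ih].
  by apply: trig_ext (trig_cst 1) => t; rewrite expr0.
by apply: trig_ext (trigM hP ih) => t; rewrite exprS.
Qed.

Lemma cmeasurable_trig P : trig_poly P -> cmeasurable P.
Proof.
move=> [s hs]; rewrite (funext hs); apply: cmeasurable_sum => x.
by apply: cmeasurableM; [exact: cmeasurable_cst|exact: cmeasurable_fexp].
Qed.

Lemma L2_window_trig P : trig_poly P -> L2 (fun t => cindic I t * P t).
Proof.
move=> [s hs]; have := L2_sum s (fun x => L2Z x.1 (L2_wexp b0 a x.2)).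
congr L2; apply/funext => t; rewrite hs mulr_sumr; apply: eq_bigr => x _.
by rewrite /wexp mulrCA.
Qed.

Definition approximable (f : R -> R[i]) := L2 (fun t => cindic I t * f t) /\
  forall e : R, 0 < e -> exists2 P, trig_poly P &
    norm2 (fun t => cindic I t * (f t - P t)) < e.

Lemma L2_windowB f g : L2 (fun t => cindic I t * f t) ->
  L2 (fun t => cindic I t * g t) -> L2 (fun t => cindic I t * (f t - g t)).
Proof.
move=> hf hg; have := L2B hf hg; congr L2.
by apply/funext => t; rewrite mulrBr.
Qed.

Lemma approximable_ext f g : (forall t, I t -> f t = g t) ->
  approximable f -> approximable g.
Proof.
move=> fg; have E h : (fun t => cindic I t * (f t - h t)) = (fun t => cindic I t * (g t - h t)).
  by apply/funext => t; case: (cindicP I t) => -[It ->]; rewrite ?mul0r // fg.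
move=> [hf hP]; split.
  move: hf; congr L2; apply/funext => t.
  by case: (cindicP I t) => -[It ->]; rewrite ?mul0r // fg.
by move=> e /hP[P hp]; rewrite E; exists P.
Qed.

Lemma approximable_ae_eq f g : cmeasurable f -> cmeasurable g ->
  {ae mu, forall t, I t -> f t = g t} -> approximable f -> approximable g.
Proof.
move=> mf mg fg [hf hP].
have mc := cmeasurable_cindic mI.
have E h : {ae mu, forall t, cindic I t * (f t - h t) = cindic I t * (g t - h t)}.
  by apply: (aeS fg) => t; case: (cindicP I t) => -[It ->] fgt; rewrite ?mul0r ?fgt.
split.
  apply: (L2_ae_eq hf); first exact: cmeasurableM.
  apply: (aeS fg) => t; case: (cindicP I t) => -[It ->] fgt; last by rewrite !mul0r.
  by rewrite fgt.
move=> e /hP[P hp fP]; exists P => //; rewrite -(@norm2_ae_eq _ _ _ _ _ (E P)) //.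
  apply: cmeasurableM => //; apply: cmeasurableD => //.
  by apply: cmeasurableN; exact: cmeasurable_trig.
apply: cmeasurableM => //; apply: cmeasurableD => //.
by apply: cmeasurableN; exact: cmeasurable_trig.
Qed.

Lemma approximable_lim f : L2 (fun t => cindic I t * f t) ->
  (forall e : R, 0 < e -> exists2 g, approximable g &
     norm2 (fun t => cindic I t * (f t - g t)) < e) -> approximable f.
Proof.
move=> hf h; split => // e e0; have e4 : 0 < e / 4 by rewrite divr_gt0.
have [g [hg hg2] fg] := h _ e4; have [P hP gP] := hg2 _ e4.
exists P => //.
have := norm2D_le (L2_windowB hf hg) (L2_windowB hg (L2_window_trig hP)).
rewrite (_ : (fun t => _ + _) = (fun t => cindic I t * (f t - P t))); last first.
  by apply/funext => t; rewrite -mulrDr addrA subrK.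
lra.
Qed.

Lemma approximable_trig P : trig_poly P -> approximable P.
Proof.
move=> hP; split; first exact: L2_window_trig.
move=> e e0; exists P => //; rewrite (_ : (fun _ => _) = (fun=> 0)).
  by rewrite /norm2; under eq_Rintegral do rewrite abs20; rewrite Rintegral_cst // mul0r.
by apply/funext => t; rewrite subrr mulr0.
Qed.

Lemma approximableD f g : approximable f -> approximable g ->
  approximable (fun t => f t + g t).
Proof.
move=> [hf hf2] [hg hg2]; split.
  by have := L2D hf hg; congr L2; apply/funext => t; rewrite mulrDr.
move=> e e0; have e4 : 0 < e / 4 by rewrite divr_gt0.
have [P hP fP] := hf2 _ e4; have [Q hQ gQ] := hg2 _ e4.
exists (fun t => P t + Q t); first exact: trigD.
have := norm2D_le (L2_windowB hf (L2_window_trig hP)) (L2_windowB hg (L2_window_trig hQ)).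
rewrite (_ : (fun t => _ + _) = (fun t => cindic I t * (f t + g t - (P t + Q t)))).
  lra.
by apply/funext => t; rewrite -mulrDr opprD addrACA.
Qed.

Lemma approximableZ c f : approximable f -> approximable (fun t => c * f t).
Proof.
move=> [hf hf2]; split.
  by have := L2Z c hf; congr L2; apply/funext => t; rewrite mulrCA.
move=> e e0; have c0 : 0 < 1 + abs2 c by rewrite ltr_pwDl // abs2_ge0.
have [P hP fP] := hf2 _ (divr_gt0 e0 c0).
exists (fun t => c * P t).
  by apply: trigM => //; exact: trig_cst.
rewrite (_ : (fun t => _) = (fun t => c * (cindic I t * (f t - P t)))); last first.
  by apply/funext => t; ring.
rewrite norm2Z; last exact: L2_windowB (L2_window_trig hP).
move: fP; rewrite ltr_pdivlMr //; apply: le_lt_trans.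
by rewrite mulrC ler_wpM2l ?norm2_ge0 // lerDr.
Qed.

Lemma approximable_sum (T : Type) (r : seq T) (F : T -> R -> R[i]) :
  (forall i, approximable (F i)) -> approximable (fun t => \sum_(i <- r) F i t).
Proof.
move=> hF; elim: r => [|i r ih].
  by apply: approximable_ext (approximable_trig (trig_cst 0)) => t _; rewrite big_nil.
by apply: approximable_ext (approximableD (hF i) ih) => t _; rewrite big_cons.
Qed.

Lemma approximable_dominated f (F : nat -> R -> R[i]) (G : R -> R) :
  (forall n, approximable (F n)) -> cmeasurable f -> (forall n, cmeasurable (F n)) ->
  integ G -> L2 (fun t => cindic I t * f t) ->
  (forall n t, abs2 (cindic I t * (f t - F n t)) <= G t) ->
  {ae mu, forall t, I t -> (fun n => abs2 (f t - F n t)) @ \oo --> (0 : R)} ->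
  approximable f.
Proof.
move=> hF mf mF hG hf fFG F0; apply: approximable_lim => // e e0.
have [|||| n hn] := @norm2_dominated R (fun n t => cindic I t * (f t - F n t)) G _ _ _ _ e e0.
- move=> n; apply: cmeasurableM; first exact: cmeasurable_cindic.
  by apply: cmeasurableD => //; exact: cmeasurableN.
- exact: hG.
- exact: fFG.
- apply: (aeS F0) => t h; case: (cindicP I t) => -[It ->].
    by under eq_fun do rewrite mul1r; exact: h.
  by under eq_fun do rewrite mul0r abs20; exact: cvg_cst.
by exists (F n).
Qed.

Lemma integ_window (c : R) : integ (fun t => c * abs2 (cindic I t)).
Proof. by apply: integZ; apply: L2_integ; exact: L2_window. Qed.

Lemma L2_window_le1 f : cmeasurable f -> (forall t, abs2 (f t) <= 1) ->
  L2 (fun t => cindic I t * f t).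
Proof.
move=> mf f1; have [] // := @L2_mul_bounded R (cindic I) f 1 (L2_window b0 a) mf ler01.
exact: aeT.
Qed.

Let wave x t : R := (1 + sin (2 * pi * b * (t - x))) / 2.

Let wave01 x t : 0 <= wave x t <= 1.
Proof.
have := sin_geN1 (2 * pi * b * (t - x)); have := sin_le1 (2 * pi * b * (t - x)).
by rewrite /wave => h1 h2; apply/andP; split; lra.
Qed.

Let trig_wave x : trig_poly (fun t => (wave x t)%:C).
Proof.
pose c : R[i] := (0 -i* (1 / 4)).
pose P t := (1 / 2)%:C + (c * expi (- (2 * pi * b * x)) * fexp b 1 t +
  (- c * expi (2 * pi * b * x)) * fexp b (-1) t).
apply: (@trig_ext P); last first.
  by apply: trigD; [exact: trig_cst|apply: trigD; exact: trig_exp].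
move=> t; rewrite /P /wave; set w := 2 * pi * b * (t - x).
have -> : c * expi (- (2 * pi * b * x)) * fexp b 1 t = c * expi w.
  by rewrite -mulrA /fexp -expiD; congr (_ * expi _); rewrite /w; ring.
have -> : - c * expi (2 * pi * b * x) * fexp b (-1) t = - c * (expi w)^*.
  by rewrite -mulrA /fexp -expiD -expiN; congr (_ * expi _); rewrite /w; ring.
by apply: complexP; rewrite /c ?cReImE /= ?cReImE /=; field.
Qed.

Let halfcut x n t : R := cutoff (wave x t) n.

Let trig_halfcut x n : trig_poly (fun t => (halfcut x n t)%:C).
Proof.
apply: (@trig_ext (fun t => (1 + (-1) * (wave x t)%:C ^+ n) ^+ (2 ^ n))).
  by move=> t; rewrite mulN1r /halfcut /cutoff !rmorphE.
apply: trigX; apply: trigD; first exact: trig_cst.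
by apply: trigM; [exact: trig_cst|exact: trigX (trig_wave x)].
Qed.

Let halfcut_neg x t : sin (2 * pi * b * (t - x)) < 0 ->
  halfcut x ^~ t @ \oo --> (1 : R).
Proof.
move=> h; have /andP[h1 h2] := wave01 x t.
by apply: cutoff_below => //; rewrite /wave; lra.
Qed.

Let halfcut_pos x t : 0 < sin (2 * pi * b * (t - x)) ->
  halfcut x ^~ t @ \oo --> (0 : R).
Proof.
move=> h; have /andP[h1 h2] := wave01 x t.
by apply: cutoff_above => //; rewrite /wave; lra.
Qed.

Let halfcut01 x n t : 0 <= halfcut x n t <= 1.
Proof. exact: cutoff_bounds. Qed.

Let approximable_arc x y (A : set R) : measurable A ->
  {ae mu, forall t, I t ->
     (fun n => halfcut x n t * halfcut y n t) @ \oo --> (\1_A t : R)} ->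
  approximable (cindic A).
Proof.
move=> mA hA.
have mF n : cmeasurable (fun t => (halfcut x n t * halfcut y n t)%:C).
  apply: (@cmeasurable_trig (fun t => (halfcut x n t * halfcut y n t)%:C)).
  apply: trig_ext (trigM (trig_halfcut x n) (trig_halfcut y n)) => t.
  by rewrite rmorphM.
apply: (approximable_dominated (F := fun n t => (halfcut x n t * halfcut y n t)%:C)
  _ _ mF (integ_window 1)).
- move=> n; apply: approximable_trig.
  apply: trig_ext (trigM (trig_halfcut x n) (trig_halfcut y n)) => t.
  by rewrite rmorphM.
- exact: cmeasurable_cindic.
- apply: L2_window_le1; first exact: cmeasurable_cindic.
  by move=> t; exact: abs2_cindic_le.
- move=> n t; rewrite abs2M mul1r ler_piMr ?abs2_ge0 //.
  rewrite /cindic -rmorphB abs2_real /= -real_normK ?num_real // exprn_ile1 //.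
  have /andP[h1 h2] := halfcut01 x n t; have /andP[h3 h4] := halfcut01 y n t.
  have h5 : 0 <= halfcut x n t * halfcut y n t by rewrite mulr_ge0.
  have h6 : halfcut x n t * halfcut y n t <= 1 by rewrite mulr_ile1.
  by rewrite indicE ler_norml; case: (_ \in _); apply/andP; split => /=; lra.
- apply: (aeS hA) => t h /h {}h.
  under eq_fun do rewrite /cindic -rmorphB abs2_real /=.
  have hc : (fun n => \1_A t - halfcut x n t * halfcut y n t) @ \oo --> (0 : R).
    by rewrite -(subrr (\1_A t : R)); apply: cvgB => //; exact: cvg_cst.
  by rewrite -(mulr0 (0 : R)); exact: (cvgM hc hc).
Qed.

Let halfcut_prod0 x y t : 0 < sin (2 * pi * b * (t - x)) ->
  (fun n => halfcut x n t * halfcut y n t) @ \oo --> (0 : R).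
Proof.
move=> /halfcut_pos h.
apply: (@squeeze_cvgr _ _ _ _ (fun=> 0) (halfcut x ^~ t)) => //; last exact: cvg_cst.
apply: nearW => n.
have /andP[h1 h2] := halfcut01 x n t; have /andP[h3 h4] := halfcut01 y n t.
by rewrite mulr_ge0 //= ler_piMr.
Qed.

Let sinw_pos s : 0 < s < b^-1 / 2 -> 0 < sin (2 * pi * b * s).
Proof.
have pi0 := pi_gt0 R; move=> /andP[s0 s1]; apply: sin_gt0_pi.
rewrite !mulr_gt0 //=; apply: lt_le_trans (_ : 2 * pi * b * (b^-1 / 2) <= _).
  by rewrite ltr_pM2l // !mulr_gt0.
by rewrite le_eqVlt; apply/orP; left; apply/eqP; field; rewrite gt_eqF.
Qed.

Let sinw_neg s : - (b^-1 / 2) < s < 0 -> sin (2 * pi * b * s) < 0.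
Proof.
move=> /andP[s0 s1]; rewrite -[s]opprK mulrN sinN oppr_lt0; apply: sinw_pos.
by apply/andP; split; lra.
Qed.

Let sinw_half s : sin (2 * pi * b * (s - b^-1 / 2)) = - sin (2 * pi * b * s).
Proof.
rewrite -[s in RHS](subrK (b^-1 / 2)) [in RHS]mulrDr.
have -> : 2 * pi * b * (b^-1 / 2) = pi by field; rewrite gt_eqF.
by rewrite sinDpi opprK.
Qed.

Let sinw_neg2 s : b^-1 / 2 < s < b^-1 -> sin (2 * pi * b * s) < 0.
Proof.
move=> /andP[s0 s1]; rewrite -oppr_gt0 -sinw_half; apply: sinw_pos.
by apply/andP; split; lra.
Qed.

(** In the first half of the period, the points to the left of x form the
    intersection of two half periods; in the second half, so do the points to the
    right of x. *)
Lemma approximable_ray x : approximable (cindic `]-oo, x[%classic).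
Proof.
have p0 : 0 < b^-1 by rewrite invr_gt0.
have inI t : I t -> a <= t < a + b^-1 by rewrite /I /= in_itv.
have ind0 (y : R) t : y <= t -> \1_(`]-oo, y[%classic) t = 0 :> R.
  by move=> yt; rewrite indicE memNset //= in_itv /= ltNge yt.
have ind1 (y : R) t : t < y -> \1_(`]-oo, y[%classic) t = 1 :> R.
  by move=> ty; rewrite indicE mem_set //= in_itv /=.
have ind0' (y : R) t : t <= y -> \1_(`]y, +oo[%classic) t = 0 :> R.
  by move=> ty; rewrite indicE memNset //= in_itv /= andbT ltNge ty.
have ind1' (y : R) t : y < t -> \1_(`]y, +oo[%classic) t = 1 :> R.
  by move=> ty; rewrite indicE mem_set //= in_itv /= andbT.
have [xa|ax] := leP x a.
  apply: approximable_ext (approximable_trig (trig_cst 0)) => t /inI/andP[h1 h2].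
  by rewrite /cindic ind0 //; exact: le_trans h1.
have [xb|bx] := ltP x (a + b^-1); last first.
  apply: approximable_ext (approximable_trig (trig_cst 1)) => t /inI/andP[h1 h2].
  by rewrite /cindic ind1 //; exact: lt_le_trans bx.
have ae3 (P : R -> Prop) : (forall t, t <> a -> t <> a + b^-1 / 2 -> t <> x ->
    I t -> P t) -> {ae mu, forall t, I t -> P t}.
  move=> h; apply: (aeS2 (ae_neq a) (aeS2 (ae_neq (a + b^-1 / 2)) (ae_neq x)
    (fun t h1 h2 => conj h1 h2))) => t h1 [h2 h3]; exact: h.
have [xh|hx] := leP x (a + b^-1 / 2).
  apply: (@approximable_arc (a + b^-1 / 2) x); first exact: measurable_itv.
  apply: ae3 => t /eqP ta /eqP th /eqP tx /inI/andP[t1 t2].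
  have {}ta : a < t by rewrite lt_def ta.
  have [h|h] := ltP t (a + b^-1 / 2).
    have c1 : halfcut (a + b^-1 / 2) ^~ t @ \oo --> (1 : R).
      apply: halfcut_neg; rewrite opprD addrA sinw_half oppr_lt0; apply: sinw_pos.
      by apply/andP; split; lra.
    have [h'|h'] := ltP t x.
      rewrite ind1 // -[X in _ --> X](mulr1 1); apply: cvgM => //.
      by apply: halfcut_neg; apply: sinw_neg; apply/andP; split; lra.
    rewrite ind0 // -[X in _ --> X](mulr0 1); apply: cvgM => //.
    have {}h' : x < t by rewrite lt_def tx.
    by apply: halfcut_pos; apply: sinw_pos; apply/andP; split; lra.
  have {}h : a + b^-1 / 2 < t by rewrite lt_def th.
  rewrite ind0; last lra.
  apply: halfcut_prod0; rewrite opprD addrA sinw_half oppr_gt0.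
  by apply: sinw_neg2; apply/andP; split; lra.
have hr : approximable (cindic `]x, +oo[%classic).
  apply: (@approximable_arc a (x + b^-1 / 2)); first exact: measurable_itv.
  apply: ae3 => t /eqP ta /eqP th /eqP tx /inI/andP[t1 t2].
  have {}ta : a < t by rewrite lt_def ta.
  have [h|h] := ltP t (a + b^-1 / 2).
    rewrite ind0'; last lra.
    by apply: halfcut_prod0; apply: sinw_pos; apply/andP; split; lra.
  have {}h : a + b^-1 / 2 < t by rewrite lt_def th.
  have c1 : halfcut a ^~ t @ \oo --> (1 : R).
    by apply: halfcut_neg; apply: sinw_neg2; apply/andP; split; lra.
  have [h'|h'] := ltP t x.
    rewrite ind0' ?ltW // -[X in _ --> X](mulr0 1); apply: cvgM => //.
    apply: halfcut_pos; rewrite opprD addrA sinw_half oppr_gt0.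
    by apply: sinw_neg; apply/andP; split; lra.
  have {}h' : x < t by rewrite lt_def tx.
  rewrite ind1' // -[X in _ --> X](mulr1 1); apply: cvgM => //.
  apply: halfcut_neg; rewrite opprD addrA sinw_half oppr_lt0.
  by apply: sinw_pos; apply/andP; split; lra.
have mr : measurable `]x, +oo[%classic by exact: measurable_itv.
apply: (approximable_ae_eq (f := fun t => 1 + (-1) * cindic `]x, +oo[%classic t)).
- apply: cmeasurableD; first exact: cmeasurable_cst.
  by apply: cmeasurableM; [exact: cmeasurable_cst|exact: cmeasurable_cindic].
- by apply: cmeasurable_cindic; exact: measurable_itv.
- apply: (aeS (ae_neq x)) => t tx It; rewrite /cindic; case: (ltgtP t x) => // tx'.
  + by rewrite ind1 // ind0' ?ltW // mulr0 addr0.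
  + by rewrite ind0 ?ltW // ind1' // mulr1 subrr.
- by apply: approximableD; [exact: approximable_trig (trig_cst 1)|exact: approximableZ].
Qed.

End TrigonometricDensity.

(** * Density of trigonometric polynomials: square integrable functions *)
Section Parseval.
Context {R : realType}.
Local Notation mu := (@lebesgue_measure R).
Local Notation integ f := (mu.-integrable [set: R] (EFin \o f)).
Variables (b : R) (b0 : 0 < b) (a : R).
Let I : set R := `[a, a + b^-1[%classic.
Local Notation approximable := (approximable b a).

(** Half-lines are stable under intersection and generate the Borel sets, and the
    sets with approximable indicator form a Dynkin system. *)
Lemma approximable_cindic (A : set R) : measurable A -> approximable (cindic A).
Proof.
move=> mA.
have L2w (S : set R) : measurable S -> L2 (fun t => cindic I t * cindic S t).
  move=> mS; apply: (L2_window_le1 b0); first exact: cmeasurable_cindic.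
  by move=> t; exact: abs2_cindic_le.
apply: (@dynkin_induction _ (measurableTypeR R) (@RGenInftyO.G R)
  (fun S => approximable (cindic S))).
- exact: RGenInftyO.measurableE.
- move=> _ _ [x ->] [y ->]; exists (Num.min x y).
  by apply/seteqP; split => t /=; rewrite !in_itv /= lt_min => /andP.
- apply: approximable_ext (approximable_trig b0 a (trig_cst b 1)) => t _.
  by rewrite cindicT.
- by move=> _ [x ->]; exact: approximable_ray.
- move=> S mS hS.
  apply: approximable_ext (approximableD b0 (approximable_trig b0 a (trig_cst b 1))
    (approximableZ b0 (-1) hS)) => t _.
  case: (cindicP S t) => -[St ->]; first by rewrite cindicF ?mulr1 ?subrr // => /(_ St).
  by rewrite cindicT // mulr0 addr0.
- move=> F mF tF hF.
  have mU : measurable (\bigcup_k F k) by apply: bigcup_measurable.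
  pose S n t := \sum_(k <- iota 0 n) cindic (F k) t.
  have S_in n t k : F k t -> S n t = (k < n)%:R.
    move=> Fkt.
    have Z j : j != k -> cindic (F j) t = 0.
      move=> jk; apply: cindicF => Fjt; move/eqP: jk; apply.
      by apply: (tF j k Logic.I Logic.I); exists t.
    rewrite /S; case: (ltnP k n) => kn.
      rewrite (bigD1_seq k) ?iota_uniq ?mem_iota //= cindicT // big1 ?addr0 //; exact: Z.
    rewrite big1_seq // => j /andP[_]; rewrite mem_iota add0n => /andP[_ jn].
    by apply: Z; rewrite ltn_eqF // (leq_trans jn).
  have S_out n t : ~ (\bigcup_k F k) t -> S n t = 0.
    move=> nFt; rewrite /S big1 // => k _; apply: cindicF => Fkt; apply: nFt.
    by exists k.
  have mS n : cmeasurable (S n).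
    by apply: cmeasurable_sum => k; exact: cmeasurable_cindic (mF k).
  apply: (approximable_dominated b0 (F := S) _ _ mS (integ_window b0 a 1)).
  + by move=> n; apply: (approximable_sum b0) => k; exact: hF.
  + exact: cmeasurable_cindic.
  + exact: L2w.
  + move=> n t; rewrite abs2M mul1r ler_piMr ?abs2_ge0 //.
    case: (cindicP (\bigcup_k F k) t) => -[Ut ->].
      case: (Ut) => k _ /(S_in n) ->.
      by case: (k < n)%N; rewrite /= ?subrr ?subr0 ?abs20 // (abs2_real 1) expr1n.
    by rewrite S_out // subrr abs20.
  + apply: aeT => t _; case: (cindicP (\bigcup_k F k) t) => -[Ut ->].
      case: (Ut) => k _ Fkt; apply: cvg_near_cst; exists k.+1 => // n /= kn.
      by rewrite (S_in n t k Fkt) kn subrr abs20.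
    by apply: cvg_near_cst; apply: nearW => n; rewrite S_out // subrr abs20.
- rewrite -[X in X A]/((@RGenInftyO.G R).-sigma.-measurable).
  by rewrite -RGenInftyO.measurableE.
Qed.

Lemma approximable_nonneg (f : R -> R) : measurable_fun [set: R] f ->
  (forall t, 0 <= f t) -> L2 (fun t => cindic I t * (f t)%:C) ->
  approximable (fun t => (f t)%:C).
Proof.
move=> mf f0 hf.
have mf' : measurable_fun [set: R] (EFin \o f) by exact/measurable_EFinP.
pose s := nnsfun_approx measurableT mf'.
have s_cvg t : (fun n => s n t) @ \oo --> f t.
  have /fine_cvgP[_] := @cvg_nnsfun_approx _ _ _ _ measurableT _ mf'
    (fun t _ => f0 t) t Logic.I.
  by [].
have s_ge0 n t : 0 <= s n t by exact: fun_ge0.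
have s_le n t : s n t <= f t.
  rewrite -(cvg_lim _ (s_cvg t)) //; apply: nondecreasing_cvgn_le.
    by move=> i j ij; have /lefP := nd_nnsfun_approx measurableT mf' ij; exact.
  by apply/cvg_ex; exists (f t); exact: s_cvg.
apply: (approximable_dominated b0 (F := fun n t => (s n t)%:C) _ _ _ (L2_integ hf)).
- move=> n; apply: (approximable_ext (f := fun t =>
    \sum_(y <- fset_set (range (s n))) y%:C * cindic (s n @^-1` [set y]) t)).
    move=> t _; rewrite fimfunE fsbig_finite //= rmorph_sum /=.
    by apply: eq_bigr => y _; rewrite rmorphM.
  by apply: (approximable_sum b0) => y; apply: (approximableZ b0); apply: approximable_cindic.
- exact: cmeasurable_real.
- by move=> n; exact: cmeasurable_real.
- exact: hf.
- move=> n t; rewrite !abs2M ler_wpM2l ?abs2_ge0 // -rmorphB !abs2_real /=.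
  by rewrite ler_pXn2r ?nnegrE ?subr_ge0 // gerBl.
- apply: aeT => t _.
  under eq_fun do rewrite -rmorphB abs2_real /=.
  have hc : (fun n => f t - s n t) @ \oo --> (0 : R).
    by rewrite -(subrr (f t)); apply: cvgB => //; exact: cvg_cst.
  by rewrite -(mulr0 (0 : R)); exact: (cvgM hc hc).
Qed.

Lemma approximable_L2 (f : R -> R[i]) : L2 f -> approximable f.
Proof.
move=> hf; have [[m1 m2] _] := hf.
have real_case (x : R -> R) : measurable_fun [set: R] x ->
    (forall t, x t ^+ 2 <= abs2 (f t)) -> approximable (fun t => (x t)%:C).
  move=> mx xf.
  have pos (y : R -> R) : measurable_fun [set: R] y -> (forall t, 0 <= y t) ->
      (forall t, y t <= `|x t|) -> approximable (fun t => (y t)%:C).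
    move=> my y0 yx; apply: approximable_nonneg => //.
    have mC : cmeasurable (fun t => (y t)%:C) by exact: cmeasurable_real.
    apply: L2_cindicM; first exact: measurable_itv.
    apply: (L2_le mC (L2_integ hf)) => t; apply: le_trans (xf t).
    by rewrite abs2_real -[leRHS]real_normK ?num_real // ler_pXn2r // nnegrE.
  have h1 := pos (x^\+)%R (measurable_funrpos mx) (funrpos_ge0 x).
  have h2 := pos (x^\-)%R (measurable_funrneg mx) (funrneg_ge0 x).
  apply: approximable_ext (approximableD b0 (h1 _) (approximableZ b0 (-1) (h2 _))).
  - move=> t _; rewrite mulN1r -rmorphB /=; congr (_ %:C).
    rewrite /funrpos /funrneg.
    by case: (leP (x t) 0) => h; case: (leP (- x t) 0) => h'; lra.
  - by move=> t; rewrite /funrpos ge_max ler_norm normr_ge0.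
  - by move=> t; rewrite /funrneg ge_max normr_ge0 andbT -normrN ler_norm.
apply: approximable_ext (approximableD b0 (real_case _ m1 _)
  (approximableZ b0 (0 +i* 1) (real_case _ m2 _))).
- by move=> t _; apply: complexP; rewrite !cReImE /=; ring.
- by move=> t; rewrite /abs2 lerDl sqr_ge0.
- by move=> t; rewrite /abs2 lerDr sqr_ge0.
Qed.

End Parseval.

(** * Fourier series on one period *)
Section WindowFourierSeries.
Context {R : realType}.
Local Notation mu := (@lebesgue_measure R).
Variables (b : R) (b0 : 0 < b) (a : R).
Let I : set R := `[a, a + b^-1[%classic.
Implicit Types (f g u : R -> R[i]) (J : {fset int}).

Let mI : measurable I.
Proof. exact: measurable_itv. Qed.

Let bC : b%:C * (b^-1)%:C = 1 :> R[i].
Proof. by rewrite -rmorphM /= mulfV ?gt_eqF. Qed.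

Lemma inner_wexp m n : inner (wexp b a m) (wexp b a n) = if m == n then (b^-1)%:C else 0.
Proof.
have E : inner (wexp b a m) (wexp b a n) = cint (wexp b a (m - n)).
  rewrite innerE; congr cint; apply/funext => t; rewrite /wexp conjcM cindicJ.
  by rewrite fexpJ -fexpM -[in RHS](cindic2 _ t); ring.
rewrite E; case: eqP => [->|/eqP mn].
  rewrite subrr -(cint_window b0 a); congr cint; apply/funext => t.
  by rewrite /wexp fexp0 mulr1.
by rewrite cint_wexp // subr_eq0.
Qed.

(** The exponentials on one period are orthogonal of squared norm 1 / b, which makes
    this the biorthogonal family. *)
Definition window_dual (m : int) : R -> R[i] := fun t => b%:C * wexp b a m t.

Let hw := L2_wexp b0 a.

Lemma L2_window_dual m : L2 (window_dual m).
Proof. exact: L2Z (hw m). Qed.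

Let proj f (J : {fset int}) := synthesis (wexp b a) window_dual f J.

Let L2_proj f J : L2 (proj f J).
Proof. by apply: L2_synthesis => m; exact: L2_window_dual. Qed.

Let residual_orth f (J : {fset int}) m : L2 f -> m \in J ->
  inner (fun t => f t - proj f J t) (wexp b a m) = 0.
Proof.
move=> hf mJ; rewrite innerBl // inner_synthesis //; last exact: L2_window_dual.
rewrite (big_fsetD1 m) //= big1_seq ?addr0.
  by rewrite innerZl // inner_wexp eqxx bC mulr1 subrr.
move=> n; rewrite !inE => /andP[_ /andP[nm _]].
by rewrite innerZl // inner_wexp (negbTE nm) !mulr0.
Qed.

Let residual_proj f J : L2 f -> inner (proj f J) (fun t => f t - proj f J t) = 0.
Proof.
move=> hf; have hr := L2B hf (L2_proj f J).
rewrite inner_synthesis //; last exact: L2_window_dual.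
rewrite big1_seq // => m /= mJ.
by rewrite innerZl // (innerJ hr (hw m)) residual_orth // conjc0 !mulr0.
Qed.

Lemma window_bessel f J : L2 f ->
  \sum_(m <- J) abs2 (inner f (wexp b a m)) <= b^-1 * norm2 f.
Proof.
move=> hf; have hr := L2B hf (L2_proj f J).
have E : norm2 f = norm2 (proj f J) + norm2 (fun t => f t - proj f J t).
  rewrite -norm2_pythagoras ?residual_proj //; congr norm2.
  by apply/funext => t; rewrite addrC subrK.
have P : (norm2 (proj f J))%:C = (b * \sum_(m <- J) abs2 (inner f (wexp b a m)))%:C.
  rewrite -innerff // -[LHS]addr0 -(residual_proj J hf) -innerDr //.
  rewrite (_ : (fun t => _ + _) = f); last by apply/funext => t; rewrite addrC subrK.
  rewrite inner_synthesis //; last exact: L2_window_dual.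
  rewrite mulr_sumr rmorph_sum /=; apply: eq_bigr => m _.
  by rewrite innerZl // (innerJ hf (hw m)) mulrCA mulzJ -rmorphM.
have {}P : norm2 (proj f J) = b * \sum_(m <- J) abs2 (inner f (wexp b a m)) by case: P.
by rewrite ler_pdivlMl // -P E lerDl norm2_ge0.
Qed.

Lemma bessel_family_window_dual : bessel_family window_dual b.
Proof.
split => // [m|f hf J]; first exact: L2_window_dual.
under eq_bigr do rewrite innerZr // abs2M abs2J abs2_real.
rewrite -mulr_sumr expr2 -mulrA ler_pM2l //.
by have := window_bessel J hf; rewrite ler_pdivlMl // mulrC.
Qed.

(** Orthogonal projections are best approximations, so density of the
    trigonometric polynomials yields convergence of the Fourier series. *)
Lemma window_fourier_series f : L2 f -> (forall t, f t = cindic I t * f t) ->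
  strongly_reconstructs (wexp b a) window_dual f.
Proof.
move=> hf fI e e0; have [_ /(_ e e0)[P [s hs] hP]] := approximable_L2 b0 a hf.
exists [fset x.2 | x in s]%fset => J sJ.
apply: le_lt_trans hP.
have hr := L2B hf (L2_proj f J).
pose q t := proj f J t - \sum_(x <- s) x.1 * wexp b a x.2 t.
have hs' : L2 (fun t => \sum_(x <- s) x.1 * wexp b a x.2 t).
  by apply: L2_sum => x; exact: L2Z.
have hq : L2 q by exact: L2B.
have qr : inner q (fun t => f t - proj f J t) = 0.
  rewrite innerBl // residual_proj // inner_suml // big1_seq ?subr0 // => x /= xs.
  rewrite (innerJ hr (hw _)) residual_orth ?conjc0 ?mulr0 //.
  by apply: (fsubsetP sJ); apply/imfsetP; exists x.
rewrite (_ : (fun t => cindic _ t * _) = (fun t => q t + (f t - proj f J t))).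
  by rewrite [leRHS]norm2_pythagoras // lerDr norm2_ge0.
apply/funext => t; rewrite mulrBr -fI hs mulr_sumr /q.
rewrite (eq_bigr (fun x => x.1 * wexp b a x.2 t)); first by ring.
by move=> x _; rewrite mulrCA.
Qed.

Lemma window_parseval f u : L2 f -> L2 u -> (forall t, f t = cindic I t * f t) ->
  fsums (fun m => inner f (wexp b a m) * inner (wexp b a m) u) ((b^-1)%:C * inner f u).
Proof.
move=> hf hu fI.
have := strong_weak L2_window_dual hf hu (window_fourier_series hf fI).
move/(fsumsZ (b^-1)%:C); apply: fsums_ext => // m.
by rewrite innerZl // mulrCA (mulrA _ b%:C) [(b^-1)%:C * _]mulrC bC mul1r.
Qed.

(** The half of Parseval's identity that detects large functions from their
    coefficients. *)
Lemma window_lower_bound f (c : R) : L2 f -> (forall t, f t = cindic I t * f t) ->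
  (forall J, \sum_(m <- J) abs2 (inner f (wexp b a m)) <= c) -> norm2 f <= b * c.
Proof.
move=> hf fI; apply: (weak_lower_bound bessel_family_window_dual) => //.
exact: (strong_weak L2_window_dual hf hf (window_fourier_series hf fI)).
Qed.

Let I2 : set R := `[a + b^-1, a + 2 * b^-1[%classic.

Lemma cindic_next_period t : cindic I2 (t + b^-1) = cindic I t.
Proof.
rewrite /cindic !indicE; congr (_ %:R%:C); rewrite !mem_setE !in_itv /=.
rewrite lerD2r (_ : a + 2 * b^-1 = a + b^-1 + b^-1); last by ring.
by rewrite ltrD2r.
Qed.

Lemma cindic_two_periods t (z : R[i]) : (~ (a <= t < a + 2 * b^-1) -> z = 0) ->
  z = (cindic I t + cindic I2 t) * z.
Proof.
move=> h; have [/andP[h1 h2]|ht] := boolP (a <= t < a + 2 * b^-1); last first.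
  by rewrite h ?mulr0 //; exact/negP.
rewrite -[LHS]mul1r; congr (_ * _).
have bV0 : 0 < b^-1 by rewrite invr_gt0.
rewrite /cindic !indicE -rmorphD /= !mem_setE !in_itv /= h1 h2 andbT /=.
by case: ltP => h3 /=; rewrite ?addr0 ?add0r.
Qed.

(** Folds a function supported in two consecutive periods onto the first one. *)
Definition periodize f : R -> R[i] := fun t => cindic I t * (f t + f (t + b^-1)).

Definition fcoef f (m : int) : R[i] := cint (fun t => f t * (fexp b m t)^*).

Lemma L2_periodize f : L2 f -> L2 (periodize f).
Proof.
by move=> hf; apply: L2_cindicM => //; apply: L2D => //; exact: L2_shift.
Qed.

Lemma periodize_window f t : periodize f t = cindic I t * periodize f t.
Proof. by rewrite /periodize mulrA cindic2. Qed.

Lemma inner_windowE f m : inner (fun t => cindic I t * f t) (wexp b a m) =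
  fcoef (fun t => cindic I t * f t) m.
Proof.
rewrite innerE /fcoef; congr cint; apply/funext => t.
by rewrite /wexp conjcM cindicJ -[in RHS](cindic2 _ t); ring.
Qed.

(** The exponentials have the period that is folded. *)
Lemma fcoef_periodize f m : L2 f ->
  {ae mu, forall t, ~ (a <= t < a + 2 * b^-1) -> f t = 0} ->
  fcoef f m = inner (periodize f) (wexp b a m).
Proof.
move=> hf f0.
have mI2 : measurable I2 by exact: measurable_itv.
have me := cmeasurableJ (cmeasurable_fexp b m).
have ci (h : R -> R[i]) : L2 h -> cintegrable (fun t => cindic I t * h t * (fexp b m t)^*).
  move=> hh; have := L2_cint hh (hw m); congr cintegrable.
  by apply/funext => t; rewrite /wexp conjcM cindicJ; ring.
have hfs := L2_shift b^-1 hf.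
have c2 : cintegrable (fun t => cindic I2 t * f t * (fexp b m t)^*).
  have := cintegrable_shift (- b^-1) (ci _ hfs); congr cintegrable.
  by apply/funext => t; rewrite -cindic_next_period subrK -(fexp_periodic b0) subrK.
have -> : fcoef f m = cint (fun t => cindic I t * f t * (fexp b m t)^* +
    cindic I2 t * f t * (fexp b m t)^*).
  apply: cint_ae_eq.
  - by apply: cmeasurableM => //; exact: L2_cmeasurable.
  - apply: cmeasurableD; apply: cmeasurableM => //; apply: cmeasurableM;
      by [exact: cmeasurable_cindic|exact: L2_cmeasurable].
  - apply: (aeS f0) => t h; rewrite -!mulrDl; congr (_ * _).
    exact: cindic_two_periods.
rewrite cintD //; last exact: ci.
rewrite -(cint_shift b^-1 c2) -cintD; last 2 first.
- exact: ci.
- exact: cintegrable_shift c2.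
rewrite innerE; congr cint; apply/funext => t.
rewrite cindic_next_period (fexp_periodic b0) /periodize /wexp conjcM cindicJ.
by case: (cindicP I t) => -[_ ->]; ring.
Qed.

End WindowFourierSeries.

(** * The rows of a Gabor system *)
Section FoldedPairing.
Context {R : realType}.
Local Notation mu := (@lebesgue_measure R).
Variables (b : R) (b0 : 0 < b) (a : R).
Let I : set R := `[a, a + b^-1[%classic.

Let mI : measurable I.
Proof. exact: measurable_itv. Qed.

Lemma cintegrable_cindic f g : L2 f -> L2 g ->
  cintegrable (fun t => cindic I t * (f t * (g t)^*)).
Proof.
move=> hf hg; have := L2_cint (L2_cindicM mI hf) hg; congr cintegrable.
by apply/funext => t; rewrite mulrA.
Qed.

(** Folding preserves the pairing up to the two terms that mix points one period
    apart. *)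
Lemma inner_periodize f g : L2 f -> L2 g ->
  {ae mu, forall t, ~ (a <= t < a + 2 * b^-1) -> f t = 0} ->
  inner (periodize b a f) (periodize b a g) = inner f g +
    cint (fun t => cindic I t * (f t * (g (t + b^-1))^*)) +
    cint (fun t => cindic I t * (f (t + b^-1) * (g t)^*)).
Proof.
move=> hf hg f0.
have hf' := L2_shift b^-1 hf; have hg' := L2_shift b^-1 hg.
have -> : inner f g = cint (fun t => cindic I t * (f t * (g t)^*)) +
    cint (fun t => cindic I t * (f (t + b^-1) * (g (t + b^-1))^*)).
  pose I2 : set R := `[a + b^-1, a + 2 * b^-1[%classic.
  have mI2 : measurable I2 by exact: measurable_itv.
  have c2 : cintegrable (fun t => cindic I2 t * (f t * (g t)^*)).
    have := L2_cint (L2_cindicM mI2 hf) hg; congr cintegrable.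
    by apply/funext => t; rewrite mulrA.
  rewrite (_ : cint (fun t => cindic I t * (f (t + b^-1) * _)) =
    cint (fun t => cindic I2 t * (f t * (g t)^*))); last first.
    rewrite -(cint_shift b^-1 c2); congr cint; apply/funext => t.
    by rewrite cindic_next_period.
  rewrite -cintD //; last exact: cintegrable_cindic.
  rewrite innerE; apply: cint_ae_eq.
  - exact: cintegrable_measurable (L2_cint hf hg).
  - exact: cintegrable_measurable (cintegrableD (cintegrable_cindic hf hg) c2).
  - apply: (aeS f0) => t h; rewrite -mulrDl; apply: (cindic_two_periods b0) => ht.
    by rewrite h // mul0r.
have i1 := cintegrable_cindic hf hg; have i2 := cintegrable_cindic hf' hg'.
have i3 := cintegrable_cindic hf hg'; have i4 := cintegrable_cindic hf' hg.
have i12 := cintegrableD i1 i2; have i123 := cintegrableD i12 i3.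
rewrite -(cintD i1 i2) -(cintD i12 i3) -(cintD i123 i4).
rewrite innerE; congr cint; apply/funext => t.
by rewrite /periodize -/I conjcM cindicJ conjcD; case: (cindicP I t) => -[_ ->]; ring.
Qed.

End FoldedPairing.

Section GaborRows.
Context {R : realType}.
Local Notation mu := (@lebesgue_measure R).
Implicit Types (f u : R -> R[i]) (g h : int -> R -> R[i]) (b : int -> R).

Lemma inner_gabor g b f k :
  inner f (gabor g b k) = fcoef (b k.2) (fun t => f t * (g k.2 t)^*) k.1.
Proof.
rewrite innerE /fcoef; congr cint; apply/funext => t.
by rewrite /gabor conjcM mulrA.
Qed.

Lemma L2_gabor g b k : L2 (g k.2) -> L2 (gabor g b k).
Proof.
move=> hg; have [] // := @L2_mul_bounded R (g k.2) (fexp (b k.2) k.1) 1 hg.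
  exact: cmeasurable_fexp.
exact: fexp_le1.
Qed.

Lemma frame_sum_leP g b f (c : R) : (frame_sum g b f <= c%:E)%E <->
  (forall J : {fset int * int}, \sum_(k <- J) abs2 (inner f (gabor g b k)) <= c).
Proof.
rewrite -esum_leP; last by move=> k; exact: abs2_ge0.
by rewrite /frame_sum; under eq_esum do rewrite cabs_sqr.
Qed.

Lemma besselP g b : (forall n, L2 (g n)) ->
  bessel g b <-> exists B, bessel_family (gabor g b) B.
Proof.
move=> hg; split => [[B hB]|[B [_ B0 hB]]]; last first.
  exists B => f hf; rewrite sqnormE // -EFinM; apply/frame_sum_leP => J.
  exact: hB.
exists (1 + `|B|); split => [k||f hf].
- exact: L2_gabor.
- by rewrite ltr_pwDl.
- have := hB f hf; rewrite sqnormE // -EFinM => /frame_sum_leP h J.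
  apply: le_trans (h J) _; rewrite ler_wpM2r ?norm2_ge0 //.
  by have := ler_norm B; lra.
Qed.

(** Testing the Bessel bound on the indicator of a set on which g_n is too large:
    on one period the coefficients determine the norm. *)
Lemma bessel_bounded_window g b (B : R) n (a : R) : 0 < b n ->
  (forall n, L2 (g n)) -> bessel_family (gabor g b) B ->
  {ae mu, forall t, a <= t < a + (b n)^-1 -> abs2 (g n t) <= B * b n}.
Proof.
move=> bn0 hg [_ B0 hB].
pose E := `[a, a + (b n)^-1[%classic `&` [set t | B * b n < abs2 (g n t)].
have mE : measurable E.
  apply: measurableI; first exact: measurable_itv.
  rewrite -[X in measurable X]setTI.
  have := measurable_fun_ltr (measurable_cst (B * b n)) (measurable_abs2 (L2_cmeasurable (hg n))).
  by move=> /(_ measurableT [set true]); apply.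
have hE : L2 (cindic E).
  have Ioo : (mu `[a, (a + (b n)^-1)%R[%classic < +oo)%E by rewrite measure_window ?ltry.
  apply: L2_cindic => //; apply: (le_lt_trans _ Ioo).
  by apply: le_measure; rewrite ?inE //; exact: subIsetl.
pose f t := cindic E t * (g n t)^*.
have hf : L2 f by apply: L2_cindicM => //; exact: L2J.
have fI t : f t = cindic `[a, a + (b n)^-1[%classic t * f t.
  rewrite /f; case: (cindicP E t) => -[Et ->]; last by rewrite !mul0r mulr0.
  by rewrite cindicT ?mul1r //; case: Et.
have : norm2 f <= b n * (B * norm2 (cindic E)).
  apply: (window_lower_bound bn0 hf fI) => J.
  rewrite (eq_bigr (fun m => abs2 (inner (cindic E) (gabor g b (m, n))))); last first.
    move=> m _; rewrite inner_gabor /=; congr abs2.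
    rewrite (_ : f = (fun t => cindic `[a, a + (b n)^-1[%classic t * f t)); last exact/funext.
    by rewrite inner_windowE; congr fcoef; apply/funext => t; rewrite -fI.
  have := hB _ hE [fset (m, n) | m in J]%fset.
  by rewrite big_imfset //= => m1 m2 _ _ [].
move=> le.
pose F t := abs2 (f t) + - (b n * B * abs2 (cindic E t)).
have F0 t : 0 <= F t.
  rewrite /F /f abs2M abs2J; case: (cindicP E t) => -[Et ->].
    by rewrite (abs2_real 1) expr1n mul1r mulr1 subr_ge0 mulrC ltW //; case: Et.
  by rewrite abs20 mul0r mulr0 subr0.
have iE : mu.-integrable [set: R] (EFin \o (fun t => - (b n * B * abs2 (cindic E t)))).
  by apply: integN; apply: integZ; exact: L2_integ.
have iF : mu.-integrable [set: R] (EFin \o F) by apply: integD => //; exact: L2_integ.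
have : Rintegral mu [set: R] F = 0.
  apply: le_anti; apply/andP; split; last by apply: Rintegral_ge0 => t _; exact: F0.
  rewrite /F RintegralD //; last exact: (L2_integ hf).
  rewrite (_ : (fun t => - _) = (fun t => - (b n * B) * abs2 (cindic E t))); last first.
    by apply/funext => t; rewrite mulNr.
  rewrite RintegralZl //; last exact: L2_integ.
  by rewrite mulNr subr_le0 -mulrA.
move/(integ_ae_eq0 iF F0) => ae0; apply: (aeS ae0) => t Ft tI.
rewrite leNgt; apply/negP => Et.
have {}Et : E t by split => //=; rewrite in_itv.
move: Ft; rewrite /F /f abs2M abs2J (cindicT Et) (abs2_real 1) expr1n mul1r mulr1.
case: Et => _ /= lt /eqP; rewrite subr_eq0 => /eqP; lra.
Qed.

(** Two windows cover the support. *)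
Lemma bessel_bounded g b (B : R) n (a : R) : 0 < b n ->
  (forall n, L2 (g n)) -> bessel_family (gabor g b) B ->
  {ae mu, forall t, ~ (a <= t < a + 2 * (b n)^-1) -> g n t = 0} ->
  {ae mu, forall t, abs2 (g n t) <= B * b n}.
Proof.
move=> bn0 hg hB g0.
have h1 := bessel_bounded_window a bn0 hg hB.
have h2 := bessel_bounded_window (a + (b n)^-1) bn0 hg hB.
apply: (aeS2 g0 (aeS2 h1 h2 (fun t x y => conj x y))) => t {g0 h1 h2} g0 [h1 h2].
have [/andP[t1 t2]|ht] := boolP (a <= t < a + 2 * (b n)^-1); last first.
  rewrite g0 ?abs20; last exact/negP.
  by case: hB => _ B0 _; rewrite mulr_ge0 // ltW.
have [t3|t3] := ltP t (a + (b n)^-1); first by apply: h1; rewrite t1.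
by apply: h2; rewrite t3 /=; lra.
Qed.

Section Row.
Variables (g h : int -> R -> R[i]) (b : int -> R) (n : int) (a M : R).
Hypotheses (bn0 : 0 < b n) (hg : L2 (g n)) (hh : L2 (h n)) (M0 : 0 <= M).
Hypothesis gM : {ae mu, forall t, abs2 (g n t) <= M}.
Hypothesis hM : {ae mu, forall t, abs2 (h n t) <= M}.
Hypothesis g0 : {ae mu, forall t, ~ (a <= t < a + 2 * (b n)^-1) -> g n t = 0}.
Hypothesis h0 : {ae mu, forall t, ~ (a <= t < a + 2 * (b n)^-1) -> h n t = 0}.
Let I : set R := `[a, a + (b n)^-1[%classic.

Lemma L2_mulJ (w : R -> R[i]) f : cmeasurable w ->
  {ae mu, forall t, abs2 (w t) <= M} -> L2 f -> L2 (fun t => f t * (w t)^*).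
Proof.
move=> mw wM hf; have [] // := L2_mul_bounded hf (cmeasurableJ mw) M0.
by apply: (aeS wM) => t; rewrite abs2J.
Qed.

Let gJ f : L2 f -> L2 (fun t => f t * (g n t)^*).
Proof. exact: L2_mulJ (L2_cmeasurable hg) gM. Qed.

Let hJ f : L2 f -> L2 (fun t => f t * (h n t)^*).
Proof. exact: L2_mulJ (L2_cmeasurable hh) hM. Qed.

Let ae0M (w : R -> R[i]) f :
  {ae mu, forall t, ~ (a <= t < a + 2 * (b n)^-1) -> w t = 0} ->
  {ae mu, forall t, ~ (a <= t < a + 2 * (b n)^-1) -> f t * (w t)^* = 0}.
Proof. by move=> w0; apply: (aeS w0) => t /[apply] ->; rewrite conjc0 mulr0. Qed.

(** The pairing over one frequency row: besides the diagonal term there are the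
    two terms in which the arguments differ by one period. Higher shifts do not
    occur because the support is shorter than two periods. *)
Lemma fsums_gabor_row f u : L2 f -> L2 u ->
  fsums (fun m => inner f (gabor g b (m, n)) * inner (gabor h b (m, n)) u)
   (((b n)^-1)%:C * (inner (fun t => f t * (g n t)^*) (fun t => u t * (h n t)^*) +
     cint (fun t => cindic I t *
       (f t * (g n t)^* * (u (t + (b n)^-1) * (h n (t + (b n)^-1))^*)^*)) +
     cint (fun t => cindic I t *
       (f (t + (b n)^-1) * (g n (t + (b n)^-1))^* * (u t * (h n t)^*)^*)))).
Proof.
move=> hf hu.
pose p t := f t * (g n t)^*; pose q t := u t * (h n t)^*.
have hp : L2 p by exact: gJ.
have hq : L2 q by exact: hJ.
have p0 := ae0M f g0; have q0 := ae0M u h0.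
rewrite -(inner_periodize bn0 hp hq p0).
have := window_parseval bn0 (L2_periodize (b n) a hp) (L2_periodize (b n) a hq)
  (periodize_window (b n) a p).
apply: fsums_ext => // m.
rewrite -(fcoef_periodize bn0 m hp p0) inner_gabor; congr (_ * _).
rewrite (innerJ hu) ?inner_gabor; last exact: (L2_gabor b (k := (m, n))).
rewrite -[fcoef _ _ _]/(fcoef (b n) q m) (fcoef_periodize bn0 m hq q0).
apply: innerJ; [exact: L2_periodize|exact: L2_wexp].
Qed.

Lemma gabor_row_bessel f (J : {fset int}) : L2 f ->
  \sum_(m <- J) abs2 (inner f (gabor g b (m, n))) <=
  (b n)^-1 * (4 * norm2 (fun t => f t * (g n t)^*)).
Proof.
move=> hf.
pose p t := f t * (g n t)^*.
have hp : L2 p by exact: gJ.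
have p0 := ae0M f g0.
under eq_bigr do rewrite inner_gabor /= (fcoef_periodize bn0 _ hp p0).
apply: le_trans (window_bessel bn0 a J (L2_periodize (b n) a hp)) _.
rewrite ler_pM2l ?invr_gt0 //.
have -> : 4 * norm2 p = 2 * norm2 p + 2 * norm2 (fun t => p (t + (b n)^-1)).
  by rewrite (norm2_shift _ hp); ring.
apply: le_trans (norm2D_le hp (L2_shift _ hp)).
have hs := L2D hp (L2_shift (b n)^-1 hp).
have fle : {ae mu, forall t, abs2 (periodize (b n) a p t) <= 1 * abs2 (p t + p (t + (b n)^-1))}.
  apply: aeT => t; rewrite mul1r /periodize abs2M ler_piMl ?abs2_ge0 //.
  exact: abs2_cindic_le.
have [_] := norm2_le (L2_cmeasurable (L2_periodize (b n) a hp)) hs fle ler01.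
by rewrite mul1r.
Qed.

End Row.

End GaborRows.

(** * Position of the supports *)
Section Geometry.
Context {R : realType}.
Variables (b c d : int -> R) (eps : R).
Local Notation p n := ((b n)^-1).

(** The consequences of the hypotheses that the proof uses: the length of the n-th
    support lies between one and two periods (geo_long, geo_short), only
    neighbouring supports overlap (geo_far, geo_near), consecutive supports start,
    and end, less than one period apart (geo_c, geo_d), and I_n- ends before the I+
    of its left neighbour begins (geo_disj). *)
Record geometry : Prop := Geometry {
  geo_eps : 0 < eps;
  geo_b : forall n, 0 < b n;
  geo_long : forall n, p n < d n - c n;
  geo_short : forall n, d n - c n + 2 * eps <= 2 * p n;
  geo_c : forall n, c (n + 1) - c n + eps <= p n;
  geo_d : forall n, d n - d (n - 1) + eps <= p n;
  geo_far : forall n, d (n - 1) <= c (n + 1);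
  geo_near : forall n, c n <= d (n - 1);
  geo_disj : forall n, d n - p n < c (n - 1) + p (n - 1) }.

Hypothesis geo : geometry.

(** A support longer than its period can exceed its left neighbour by at most the
    period minus eps, so it starts at least eps before that neighbour ends, and its
    right neighbour starts only after that. *)
Lemma geo_step n : c n + eps <= c (n + 1).
Proof.
have := geo_long geo n; have := geo_d geo n; have := geo_far geo n; lra.
Qed.

Lemma geo_steps n (k : nat) : c n + k%:R * eps <= c (n + k%:Z).
Proof.
elim: k => [|k ih]; first by rewrite mul0r !addr0.
have := geo_step (n + k%:Z).
have -> : n + k%:Z + 1 = n + k.+1%:Z by rewrite -addrA -PoszD addn1.
rewrite -[k.+1%:R]natr1; lra.
Qed.

Lemma geo_mono m n : m <= n -> c m <= c n.
Proof.
move=> mn; have [k ->] : exists k : nat, n = m + k%:Z.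
  by exists `|n - m|%N; rewrite gez0_abs ?subr_ge0 // [RHS]addrC subrK.
apply: le_trans (geo_steps m k); rewrite lerDl mulr_ge0 // ltW //.
exact: geo_eps geo.
Qed.

Lemma geo_d_le m n : m + 1 < n -> d m <= c n.
Proof.
move=> mn; have := geo_far geo (m + 1); rewrite addrK => h.
by apply: le_trans h _; apply: geo_mono; lia.
Qed.

Lemma supp_two_periods (w : R -> R[i]) n :
  {ae (@lebesgue_measure R), forall t, ~ (c n <= t <= d n) -> w t = 0} ->
  {ae (@lebesgue_measure R), forall t, ~ (c n <= t < c n + 2 * p n) -> w t = 0}.
Proof.
move=> w0; apply: (aeS w0) => t h0 ht; apply: h0 => /andP[h1 h2]; apply: ht.
rewrite h1 /=; have := geo_short geo n; have := geo_eps geo; lra.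
Qed.

End Geometry.

(** * Duality conditions and weak reconstruction *)
Section DualityConditions.
Context {R : realType}.
Local Notation mu := (@lebesgue_measure R).
Variables (g h : int -> R -> R[i]) (b c d : int -> R) (eps : R).
Hypothesis geo : geometry b c d eps.
Hypotheses (hgL2 : forall n, L2 (g n)) (hhL2 : forall n, L2 (h n)).
Variables (B B' : R).
Hypotheses (bG : bessel_family (gabor g b) B) (bH : bessel_family (gabor h b) B').
Hypothesis gsupp : forall n, {ae mu, forall t, ~ (c n <= t <= d n) -> g n t = 0}.
Hypothesis hsupp : forall n, {ae mu, forall t, ~ (c n <= t <= d n) -> h n t = 0}.
Local Notation p n := ((b n)^-1).
Implicit Types f u : R -> R[i].

Let p0 n : 0 < p n.
Proof. by rewrite invr_gt0; exact: geo_b geo n. Qed.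

Let M n : R := (B + B') * b n.

Let M0 n : 0 <= M n.
Proof.
have [_ B0 _] := bG; have [_ B'0 _] := bH; have := geo_b geo n.
by move=> bn0; rewrite mulr_ge0 ?addr_ge0 // ltW.
Qed.

Let gM n : {ae mu, forall t, abs2 (g n t) <= M n}.
Proof.
have bn0 := geo_b geo n.
have := bessel_bounded bn0 hgL2 bG (supp_two_periods geo (gsupp n)) => le.
apply: (aeS le) => t /le_trans; apply.
have [_ B'0 _] := bH; by rewrite ler_pM2r // lerDl ltW.
Qed.

Let hM n : {ae mu, forall t, abs2 (h n t) <= M n}.
Proof.
have bn0 := geo_b geo n.
have := bessel_bounded bn0 hhL2 bH (supp_two_periods geo (hsupp n)) => le.
apply: (aeS le) => t /le_trans; apply.
have [_ B0 _] := bG; by rewrite ler_pM2r // lerDr ltW.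
Qed.

Let gJ n f : L2 f -> L2 (fun t => f t * (g n t)^*).
Proof. exact: (L2_mulJ (M0 n) (L2_cmeasurable (hgL2 n)) (gM n)). Qed.

Let hJ n f : L2 f -> L2 (fun t => f t * (h n t)^*).
Proof. exact: (L2_mulJ (M0 n) (L2_cmeasurable (hhL2 n)) (hM n)). Qed.

Lemma inner_gabor_eq0 (w : int -> R -> R[i]) f k : L2 f -> L2 (w k.2) ->
  {ae mu, forall t, f t * (w k.2 t)^* = 0} -> inner f (gabor w b k) = 0.
Proof.
move=> hf hw fw; rewrite innerE; apply: cint_eq0.
  exact: cintegrable_measurable (L2_cint hf (L2_gabor b hw)).
by apply: (aeS fw) => t h0; rewrite /gabor conjcM mulrA h0 mul0r.
Qed.

(** Two of the three duality conditions say that the terms mixing different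
    points of one support vanish. *)
Definition no_aliasing := forall n,
  {ae mu, forall t, Iminus b c d n t ->
     h n t * translation (- p n) (fun s => (g n s)^*) t = 0} /\
  {ae mu, forall t, Iplus b c d n t ->
     h n t * translation (p n) (fun s => (g n s)^*) t = 0}.

Lemma fsums_row_diagonal n f u : no_aliasing -> L2 f -> L2 u ->
  fsums (fun m => inner f (gabor g b (m, n)) * inner (gabor h b (m, n)) u)
   ((p n)%:C * inner (fun t => f t * (g n t)^*) (fun t => u t * (h n t)^*)).
Proof.
move=> /(_ n) [alm alp] hf hu.
have := fsums_gabor_row (geo_b geo n) (hgL2 n) (hhL2 n) (M0 n) (gM n) (hM n)
  (supp_two_periods geo (gsupp n)) (supp_two_periods geo (hsupp n)) hf hu.
apply: fsums_ext => //; congr (_ * _); rewrite -addrA -[RHS]addr0; congr (_ + _).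
have hgf := gJ n hf; have hhu := hJ n hu.
have cc f1 f2 : L2 f1 -> L2 f2 -> cmeasurable (fun t =>
    cindic `[c n, c n + p n[%classic t * (f1 t * (f2 t)^*)).
  by move=> h1 h2; exact: cintegrable_measurable (cintegrable_cindic _ _ h1 h2).
have [gs hs] := (gsupp n, hsupp n).
rewrite !cint_eq0 ?addr0 //.
- exact: (cc _ _ (L2_shift (p n) hgf) hhu).
- have gs' := ae_shift (p n) gs.
  apply: (aeS2 alm gs') => t a1 a2.
  case: (cindicP `[c n, c n + p n[%classic t) => -[It ->]; last by rewrite mul0r.
  rewrite mul1r conjcM conjc_invol.
  have [ht|ht] := boolP (t + p n <= d n).
    have := a1; rewrite /Iminus /= in_itv /= lerBrDr ht andbT /translation opprK.
    move: It; rewrite /= in_itv /= => /andP[-> _] /(_ isT) e.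
    by rewrite mulrACA [(g n _)^* * _]mulrC e mulr0.
  by rewrite a2 ?conjc0 ?mulr0 ?mul0r // => /andP[_]; exact/negP.
- exact: (cc _ _ hgf (L2_shift (p n) hhu)).
- have alp' := ae_shift (p n) alp; have hs' := ae_shift (p n) hs.
  apply: (aeS2 alp' hs') => t a1 a2.
  case: (cindicP `[c n, c n + p n[%classic t) => -[It ->]; last by rewrite mul0r.
  rewrite mul1r conjcM conjc_invol.
  have [ht|ht] := boolP (t + p n <= d n).
    have := a1; rewrite /Iplus /= in_itv /= ht andbT lerD2r /translation addrK.
    move: It; rewrite /= in_itv /= => /andP[-> _] /(_ isT) e.
    by rewrite mulrACA [(g n t)^* * _]mulrC e mulr0.
  by rewrite a2 ?mulr0 // => /andP[_]; exact/negP.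
Qed.

(** Up to an end point, only the supports of the rows j and j - 1 meet this
    interval. *)
Definition cell j : set R := `[c j, c (j + 1)[%classic.

Lemma measurable_cell j : measurable (cell j).
Proof. exact: measurable_itv. Qed.

Lemma cell_foreign (w : R -> R[i]) n j : n != j -> n != j - 1 ->
  {ae mu, forall t, ~ (c n <= t <= d n) -> w t = 0} ->
  {ae mu, forall t, cell j t -> w t = 0}.
Proof.
move=> nj nj1 w0; apply: (aeS2 w0 (ae_neq (c j))) => t h0 tj /=.
rewrite /cell /= in_itv /= => /andP[t1 t2]; apply: h0 => /andP[t3 t4].
have [ltjn|] := ltP j n.
  have := geo_mono geo (_ : j + 1 <= n); rewrite lezD1 => /(_ ltjn); lra.
rewrite le_eqVlt (negbTE nj) /= => nj'.
have : d n <= c j by apply: (geo_d_le geo); lia.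
by move=> dc; apply: tj; apply: le_anti; rewrite t1 (le_trans t4).
Qed.

Definition diagonal j t : R[i] :=
  (p j)%:C * h j t * (g j t)^* + (p (j - 1))%:C * h (j - 1) t * (g (j - 1) t)^*.

Let L2_diag_term n f : L2 f -> L2 (fun t => f t * ((p n)%:C * h n t * (g n t)^*)).
Proof.
move=> hf; have hfh : L2 (fun t => f t * h n t).
  by have [] := L2_mul_bounded hf (L2_cmeasurable (hhL2 n)) (M0 n) (hM n).
have := L2Z (p n)%:C (gJ n hfh); congr L2; apply/funext => t; ring.
Qed.

Lemma L2_diagonal j f : L2 f -> L2 (fun t => f t * diagonal j t).
Proof.
move=> hf; have := L2D (L2_diag_term j hf) (L2_diag_term (j - 1) hf); congr L2.
by apply/funext => t; rewrite /diagonal mulrDr.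
Qed.

(** Between consecutive c_j only two of the supports are present. *)
Lemma fsums_diagonal j f u : no_aliasing -> L2 f -> L2 u ->
  (forall t, f t = cindic (cell j) t * f t) ->
  fsums (fun k => inner f (gabor g b k) * inner (gabor h b k) u)
    (inner (fun t => f t * diagonal j t) u).
Proof.
move=> na hf hu fQ.
have jj : j - 1 != j by lia.
pose s n := (p n)%:C * inner (fun t => f t * (g n t)^*) (fun t => u t * (h n t)^*).
have -> : inner (fun t => f t * diagonal j t) u = \sum_(n <- [:: j; j - 1]) s n.
  have sE n : s n = inner (fun t => f t * ((p n)%:C * h n t * (g n t)^*)) u.
    rewrite /s -innerZl ?innerE; [|exact: gJ|exact: hJ].
    by congr cint; apply/funext => t; rewrite conjcM conjc_invol; ring.
  rewrite !big_cons big_nil addr0 !sE -innerDl //; try exact: L2_diag_term.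
  by congr inner; apply/funext => t; rewrite mulrDr.
apply: fsums_rows.
- by rewrite /= inE andbT eq_sym.
- move=> [m n] /=; rewrite !inE negb_or => /andP[nj nj1].
  rewrite (inner_gabor_eq0 (w := g) (k := (m, n))) ?mul0r //=.
  apply: (aeS (cell_foreign nj nj1 (gsupp n))) => t gt; rewrite fQ.
  case: (cindicP (cell j) t) => -[Qt ->]; last by rewrite !mul0r.
  by rewrite gt // conjc0 mulr0.
- by move=> n _; exact: fsums_row_diagonal.
Qed.

(** On one cell the diagonal is 1. Finitely many consecutive cells follow by
    additivity, and these exhaust the line because the c_n are eps apart. *)
Lemma weak_of_conditions f u : duality_conditions g h b c d -> L2 f -> L2 u ->
  weakly_reconstructs (gabor g b) (gabor h b) f u.
Proof.
move=> dc hf hu.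
have na : no_aliasing by move=> n; have [_ ? ?] := dc n.
have one j f1 : L2 f1 ->
    weakly_reconstructs (gabor g b) (gabor h b) (fun t => cindic (cell j) t * f1 t) u.
  move=> hf1; have hf' := L2_cindicM (measurable_cell j) hf1.
  have fQ t : cindic (cell j) t * f1 t = cindic (cell j) t * (cindic (cell j) t * f1 t).
    by rewrite mulrA cindic2.
  apply: fsums_ext (fsums_diagonal na hf' hu fQ) => //.
  rewrite !innerE; apply: cint_ae_eq.
  - exact: cintegrable_measurable (L2_cint (L2_diagonal j hf') hu).
  - exact: cintegrable_measurable (L2_cint hf' hu).
  - have [dj _ _] := dc j; apply: (aeS dj) => t h1.
    case: (cindicP (cell j) t) => -[Qt ->]; last by rewrite !mul0r.
    by rewrite /diagonal h1 // mulr1.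
have many j (k : nat) : weakly_reconstructs (gabor g b) (gabor h b)
    (fun t => cindic `[c j, c (j + k%:Z)[%classic t * f t) u.
  have mI x y : measurable (`[x, y[%classic : set R) by exact: measurable_itv.
  elim: k => [|k ih].
    rewrite /weakly_reconstructs (_ : (fun t => cindic _ t * f t) = (fun=> 0)); last first.
      apply/funext => t; rewrite cindicF ?mul0r //= in_itv /= addr0.
      by case: ltP; rewrite ?andbF // => /le_gtF ->; rewrite ?andbF.
    rewrite inner0l; apply: fsums_ext fsums0 => // x.
    by rewrite inner0l mul0r.
  have := fsumsD ih (one (j + k%:Z) f hf); rewrite /weakly_reconstructs.
  have L1 := L2_cindicM (mI (c j) (c (j + k%:Z))) hf.
  have L2' := L2_cindicM (measurable_cell (j + k%:Z)) hf.
  have E : (fun t => cindic `[c j, c (j + k.+1%:Z)[%classic t * f t) =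
      (fun t => cindic `[c j, c (j + k%:Z)[%classic t * f t + cindic (cell (j + k%:Z)) t * f t).
    apply/funext => t; rewrite -mulrDl; congr (_ * _).
    rewrite /cindic !indicE -rmorphD /=; congr (_ %:C); rewrite !mem_setE /cell !in_itv /=.
    have -> : j + k.+1%:Z = j + k%:Z + 1 by rewrite -addrA -PoszD addn1.
    have h1 := geo_steps geo j k; have h2 := geo_step geo (j + k%:Z).
    have e0 := geo_eps geo.
    have h3 : 0 <= k%:R * eps by rewrite mulr_ge0 // ltW.
    case: (ltP t (c (j + k%:Z))) => t1; case: (leP (c j) t) => t2;
      case: (ltP t (c (j + k%:Z + 1))) => t3; rewrite /= ?addr0 ?add0r //; lra.
  rewrite E; apply: fsums_ext => [x|].
    rewrite -mulrDl -innerDl //; exact: (L2_gabor b (hgL2 _)).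
  by rewrite innerDl.
apply: (weak_dense bG bH hf hu) => e e0.
have mI x y : measurable (`[x, y[%classic : set R) by exact: measurable_itv.
pose F (n : nat) t := cindic `[c (- n%:Z), c (- n%:Z + (n + n)%N%:Z)[%classic t * f t.
have hF n : L2 (F n) by exact: L2_cindicM.
have [||||n hn] := @norm2_dominated R (fun n t => f t - F n t) (fun t => abs2 (f t)) _ _ _ _ e e0.
- by move=> n; exact: L2_cmeasurable (L2B hf (hF n)).
- exact: L2_integ.
- move=> n t; rewrite /F; case: (cindicP `[c (- n%:Z), c (- n%:Z + (n + n)%N%:Z)[%classic t) => -[_ ->].
    by rewrite mul1r subrr abs20 abs2_ge0.
  by rewrite mul0r subr0.
- apply: aeT => t; apply: cvg_near_cst.
  have eps0 := geo_eps geo.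
  exists (Num.truncn (`|t - c 0| / eps)).+1 => // n /= hn.
  rewrite /F cindicT ?mul1r ?subrr ?abs20 //= in_itv /=.
  have : `|t - c 0| / eps < n%:R.
    by apply: lt_le_trans (truncnS_gt _) _; rewrite ler_nat.
  rewrite ltr_pdivrMr // => h1.
  have h2 := geo_steps geo (- n%:Z) n; rewrite addNr in h2.
  have -> : - n%:Z + (n + n)%N%:Z = 0 + n%:Z by rewrite PoszD addKr add0r.
  have h3 := geo_steps geo 0 n.
  have h4 := ler_norm (t - c 0);
  have h6 : - (t - c 0) <= `|t - c 0| by rewrite -normrN ler_norm.
  by apply/andP; split; lra.
by exists (F n) => //; split => //; exact: many.
Qed.

Lemma cint_ge0_eq0 (F : R -> R) : cintegrable (fun t => (F t)%:C) ->
  (forall t, 0 <= F t) -> cint (fun t => (F t)%:C) = 0 ->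
  {ae mu, forall t, F t = 0}.
Proof.
by move=> [hF _] F0; rewrite cint_real => -[]; exact: integ_ae_eq0.
Qed.

Hypothesis weak : forall f u, L2 f -> L2 u ->
  weakly_reconstructs (gabor g b) (gabor h b) f u.

(** Reconstruction tested on a piece of g_n against a disjoint piece of h_n that
    no other row sees: only the two aliasing terms are left. *)
Lemma aliasing_pairing (A A' : set R) n : measurable A -> measurable A' ->
  (forall t, A t -> ~ A' t) ->
  (forall n', n' != n -> {ae mu, forall t, A t -> g n' t = 0} \/
                        {ae mu, forall t, A' t -> h n' t = 0}) ->
  let f t := cindic A t * g n t in let u t := cindic A' t * h n t in
  cint (fun t => cindic `[c n, c n + p n[%classic t *
    (f t * (g n t)^* * (u (t + p n) * (h n (t + p n))^*)^*)) +
  cint (fun t => cindic `[c n, c n + p n[%classic t *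
    (f (t + p n) * (g n (t + p n))^* * (u t * (h n t)^*)^*)) = 0.
Proof.
move=> mA mA' AA' foreign f u.
have hf : L2 f by exact: L2_cindicM.
have hu : L2 u by exact: L2_cindicM.
have fu t : f t * (u t)^* = 0.
  rewrite /f /u; case: (cindicP A t) => -[At ->]; last by rewrite !mul0r.
  by rewrite (cindicF (AA' t At)) mul0r conjc0 mulr0.
have row := fsums_gabor_row (geo_b geo n) (hgL2 n) (hhL2 n) (M0 n) (gM n) (hM n)
  (supp_two_periods geo (gsupp n)) (supp_two_periods geo (hsupp n)) hf hu.
set X := (X in fsums _ (_ * X)) in row.
have total : fsums (fun k => inner f (gabor g b k) * inner (gabor h b k) u)
    ((p n)%:C * X).
  apply: fsums_row row => -[m n'] /= n'n.
  case: (foreign n' n'n) => h0.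
    rewrite (inner_gabor_eq0 (w := g) (k := (m, n'))) ?mul0r //=.
    apply: (aeS h0) => t gt; rewrite /f.
    case: (cindicP A t) => -[At ->]; last by rewrite !mul0r.
    by rewrite gt // conjc0 mulr0.
  have hG : L2 (gabor h b (m, n')) by exact: (L2_gabor b (k := (m, n')) (hhL2 n')).
  rewrite (innerJ hu hG) (inner_gabor_eq0 (w := h) (k := (m, n')) hu (hhL2 n')).
    by rewrite conjc0 mulr0.
  apply: (aeS h0) => t ht; rewrite /u.
  case: (cindicP A' t) => -[At ->]; last by rewrite !mul0r.
  by rewrite ht // conjc0 mulr0.
have X0 : X = 0.
  have /eqP := fsums_uniq total (weak hf hu).
  rewrite innerE (_ : (fun t => f t * _) = (fun=> 0)); last exact/funext.
  rewrite cint_eq0 ?mulf_eq0; [|exact: cmeasurable_cst|exact: aeT].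
  case/orP => /eqP // /complexI /eqP; by rewrite gt_eqF.
rewrite -X0 /X -addrA -[LHS]add0r; congr (_ + _).
rewrite innerE cint_eq0 //.
  exact: cintegrable_measurable (L2_cint (gJ n hf) (hJ n hu)).
apply: aeT => t; rewrite conjcM conjc_invol mulrACA fu mul0r //.
Qed.

Let mItv (i : interval R) : measurable ([set` i] : set R).
Proof. exact: measurable_itv. Qed.

Let minus_foreign (w : int -> R -> R[i]) n n' : n < n' ->
  {ae mu, forall t, ~ (c n' <= t <= d n') -> w n' t = 0} ->
  {ae mu, forall t, Iminus b c d n t -> w n' t = 0}.
Proof.
move=> nn' w0; apply: (aeS w0) => t h0; rewrite /Iminus /= in_itv /= => /andP[_ t2].
apply: h0 => /andP[t3 _].
have := geo_mono geo (_ : n + 1 <= n'); rewrite lezD1 => /(_ nn').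
have := geo_d geo n; have := geo_far geo n; have := geo_eps geo; lra.
Qed.

Let plus_foreign (w : int -> R -> R[i]) n n' : n' < n ->
  {ae mu, forall t, ~ (c n' <= t <= d n') -> w n' t = 0} ->
  {ae mu, forall t, Iplus b c d n t -> w n' t = 0}.
Proof.
move=> nn' w0; apply: (aeS w0) => t h0; rewrite /Iplus /= in_itv /= => /andP[t2 _].
apply: h0 => /andP[_ t3].
have := geo_d_le geo (_ : n' + 1 < n + 1); rewrite ltrD2r => /(_ nn').
have := geo_c geo n; have := geo_eps geo; lra.
Qed.

Let minus_plus n t : Iminus b c d n t -> ~ Iplus b c d n t.
Proof.
rewrite /Iminus /Iplus /= !in_itv /= => /andP[_ h1] /andP[h2 _].
have := geo_short geo n; have := geo_eps geo; lra.
Qed.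

Let plus_shift n t : Iminus b c d n t <-> Iplus b c d n (t + p n).
Proof. by rewrite /Iminus /Iplus /= !in_itv /= lerD2r lerBrDr. Qed.

Let minus_window n t : Iminus b c d n t -> c n <= t < c n + p n.
Proof.
rewrite /Iminus /= in_itv /= => /andP[-> h2].
have := geo_short geo n; have := geo_eps geo; lra.
Qed.

(** Where I_n- and I_n+ carry the tests, the remaining integrand is
    |g_n|^2 |h_n|^2 at two points one period apart. *)
Lemma weak_no_aliasing : no_aliasing.
Proof.
move=> n; have e0 := geo_eps geo; have hs := geo_short geo n.
pose I : set R := `[c n, c n + p n[%classic.
pose Im := Iminus b c d n; pose Ip := Iplus b c d n.
have mm : measurable Im by exact: mItv.
have mp : measurable Ip by exact: mItv.
have IE t : I t <-> c n <= t < c n + p n by rewrite /I /= in_itv.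
have mulz (x y : R[i]) : x * x^* * (y * y^*)^* = (abs2 (x * y))%:C.
  by rewrite !mulzJ conjc_real -rmorphM abs2M.
have conclude (x y : R[i]) : abs2 (x * y) = 0 -> y * x^* = 0.
  move/eqP; rewrite abs2_eq0 mulf_eq0 => /orP[/eqP ->|/eqP ->].
    by rewrite conjc0 mulr0.
  by rewrite mul0r.
split.
- pose f t := cindic Ip t * g n t; pose u t := cindic Im t * h n t.
  have hf : L2 f by exact: L2_cindicM.
  have hu : L2 u by exact: L2_cindicM.
  have foreign n' : n' != n -> {ae mu, forall t, Ip t -> g n' t = 0} \/
                        {ae mu, forall t, Im t -> h n' t = 0}.
    rewrite neq_lt => /orP[nn'|nn']; [left|right].
      exact: plus_foreign nn' (gsupp n').
    exact: minus_foreign nn' (hsupp n').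
  have := aliasing_pairing mp mm (fun t h1 h2 => minus_plus h2 h1) foreign.
  rewrite -/I /= (_ : (fun t => cindic I t * (cindic Ip t * _ * _ * _)) = (fun=> 0)).
    rewrite cint_eq0 ?add0r; [|exact: cmeasurable_cst|exact: aeT].
    pose F t := abs2 (cindic I t * cindic Ip (t + p n) * cindic Im t *
      (g n (t + p n) * h n t)).
    have E : (fun t => cindic I t * (cindic Ip (t + p n) * g n (t + p n) * (g n (t + p n))^* *
       (cindic Im t * h n t * (h n t)^*)^*)) = (fun t => (F t)%:C).
      apply/funext => t; rewrite /F; case: (cindicP I t) => -[_ ->]; last first.
        by rewrite !mul0r abs20.
      case: (cindicP Ip (t + p n)) => -[_ ->]; last first.
        by rewrite mulr0 !mul0r mulr0 abs20.
      case: (cindicP Im t) => -[_ ->]; last first.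
        by rewrite mulr0 !mul0r conjc0 !mulr0 abs20.
      by rewrite !mul1r mulz.
    rewrite E => X0.
    have iF : cintegrable (fun t => (F t)%:C).
      by rewrite -E; exact: (cintegrable_cindic _ _ (L2_shift (p n) (gJ n hf)) (hJ n hu)).
    have := cint_ge0_eq0 iF (fun t => abs2_ge0 _) X0 => F0.
    apply: (aeS F0) => t; rewrite /F => Ft tm.
    rewrite /translation opprK; apply: conclude; rewrite -[RHS]Ft.
    rewrite (cindicT tm) (cindicT (proj1 (plus_shift n t) tm)).
    by rewrite (cindicT (proj2 (IE t) (minus_window tm))) !mul1r.
  apply/funext => t; case: (cindicP I t) => -[It ->]; last by rewrite mul0r.
  rewrite cindicF ?mul0r ?mulr0 // /Ip /Iplus /= in_itv /= => /andP[h1 _].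
  by move/IE: It => /andP[_]; rewrite ltNge h1.
- pose f t := cindic Im t * g n t; pose u t := cindic Ip t * h n t.
  have hf : L2 f by exact: L2_cindicM.
  have hu : L2 u by exact: L2_cindicM.
  have foreign n' : n' != n -> {ae mu, forall t, Im t -> g n' t = 0} \/
                        {ae mu, forall t, Ip t -> h n' t = 0}.
    rewrite neq_lt => /orP[nn'|nn']; [right|left].
      exact: plus_foreign nn' (hsupp n').
    exact: minus_foreign nn' (gsupp n').
  have := aliasing_pairing mm mp (@minus_plus n) foreign.
  rewrite -/I /= (_ : (fun t => cindic I t * (cindic Im (t + p n) * _ * _ * _)) = (fun=> 0)).
    rewrite [X in _ + X]cint_eq0 ?addr0; [|exact: cmeasurable_cst|exact: aeT].
    pose F t := abs2 (cindic I t * cindic Im t * cindic Ip (t + p n) *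
      (g n t * h n (t + p n))).
    have E : (fun t => cindic I t * (cindic Im t * g n t * (g n t)^* *
       (cindic Ip (t + p n) * h n (t + p n) * (h n (t + p n))^*)^*)) = (fun t => (F t)%:C).
      apply/funext => t; rewrite /F; case: (cindicP I t) => -[_ ->]; last first.
        by rewrite !mul0r abs20.
      case: (cindicP Im t) => -[_ ->]; last first.
        by rewrite mulr0 !mul0r mulr0 abs20.
      case: (cindicP Ip (t + p n)) => -[_ ->]; last first.
        by rewrite mulr0 !mul0r conjc0 !mulr0 abs20.
      by rewrite !mul1r mulz.
    rewrite E => X0.
    have iF : cintegrable (fun t => (F t)%:C).
      by rewrite -E; exact: (cintegrable_cindic _ _ (gJ n hf) (L2_shift (p n) (hJ n hu))).
    have := ae_shift (- p n) (cint_ge0_eq0 iF (fun t => abs2_ge0 _) X0) => F0.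
    apply: (aeS F0) => t; rewrite /F subrK => Ft tp.
    rewrite /translation; apply: conclude; rewrite -[RHS]Ft.
    have tm : Im (t - p n) by apply/plus_shift; rewrite subrK.
    rewrite (cindicT tp) (cindicT tm).
    by rewrite (cindicT (proj2 (IE _) (minus_window tm))) !mul1r.
  apply/funext => t; case: (cindicP I t) => -[It ->]; last by rewrite mul0r.
  rewrite cindicF ?mul0r ?mulr0 // /Im /Iminus /= in_itv /= => /andP[_ h1].
  move/IE: It => /andP[h2 _]; lra.
Qed.

(** Testing the indicator of the cell against the defect of the first condition on it
    computes the squared norm of that defect. *)
Lemma conditions_of_weak : duality_conditions g h b c d.
Proof.
move=> n; have na := weak_no_aliasing; have [am ap] := na n; split => //.
pose D t := diagonal n t - 1.
have h1 : L2 (cindic (cell n)).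
  apply: L2_cindic; first exact: measurable_cell.
  rewrite /cell lebesgue_measure_itv /=; case: ifP => _; last exact: ltry.
  by rewrite -EFinB ltry.
pose u t := cindic (cell n) t * D t.
have hd := L2_diagonal n h1.
have hu : L2 u.
  have := L2B hd h1; congr L2; apply/funext => t.
  by rewrite /u /D mulrBr mulr1.
have := fsums_uniq (fsums_diagonal na h1 hu (fun t => esym (cindic2 (cell n) t))) (weak h1 hu).
move/eqP; rewrite -subr_eq0 -innerBl //.
rewrite (_ : (fun t => _ - _) = u); last first.
  by apply/funext => t; rewrite /u /D mulrBr mulr1.
rewrite innerff // => /eqP /complexI /(norm2_eq0 hu) u0.
apply: (aeS u0) => t; rewrite /u /D => ut tQ.
have {}tQ : cell n t by [].
by move/eqP: ut; rewrite (cindicT tQ) mul1r subr_eq0 => /eqP.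
Qed.

End DualityConditions.

(** * Dual frames *)
Section DualFrames.
Context {R : realType}.
Local Notation mu := (@lebesgue_measure R).
Implicit Types (g h : int -> R -> R[i]) (b : int -> R) (f : R -> R[i]).

Lemma reconstructsP g h b f : (forall n, L2 (h n)) -> L2 f ->
  reconstructs g h b f <-> strongly_reconstructs (gabor g b) (gabor h b) f.
Proof.
move=> hh hf.
have hS J : L2 (fun t => f t - synthesis (gabor g b) (gabor h b) f J t).
  by apply: L2B => //; apply: L2_synthesis => k; exact: L2_gabor.
split=> H e e0.
  have e0' : 0 < Num.sqrt e by rewrite sqrtr_gt0.
  have [K hK] := H _ e0'; exists K => J /hK.
  by rewrite sqr_sqrtr ?ltW // (sqnormE (hS J)) lte_fin.
have [K hK] := H _ (exprn_gt0 2 e0); exists K => J /hK.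
by rewrite -lte_fin -(sqnormE (hS J)).
Qed.

Lemma frame_of_weak g h b (B B' : R) : (forall n, L2 (g n)) ->
  bessel_family (gabor g b) B -> bessel_family (gabor h b) B' ->
  (forall f, L2 f -> weakly_reconstructs (gabor g b) (gabor h b) f f) ->
  frame g b.
Proof.
move=> hg bG bH wf; split; first by apply/(besselP b hg); exists B.
have [hG B0 hB] := bG; have [_ B'0 _] := bH.
exists B'^-1; first by rewrite invr_gt0.
move=> f hf; rewrite sqnormE //.
have up : (frame_sum g b f <= (B * norm2 f)%:E)%E.
  by apply/frame_sum_leP => J; exact: hB.
have lo : (0 <= frame_sum g b f)%E.
  by apply: esum_ge0 => k _; rewrite lee_fin sqr_ge0.
have fn : frame_sum g b f \is a fin_num.
  by rewrite ge0_fin_numE // (le_lt_trans up) // ltry.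
rewrite -(fineK fn) -EFinM lee_fin ler_pdivrMl //.
apply: (weak_lower_bound bH hG hf (wf f hf)).
by apply/frame_sum_leP; rewrite fineK.
Qed.

Lemma dual_framesP g h b c d eps : geometry b c d eps ->
  (forall n, L2 (g n)) -> (forall n, L2 (h n)) -> bessel g b -> bessel h b ->
  (forall n, {ae mu, forall t, ~ (c n <= t <= d n) -> g n t = 0}) ->
  (forall n, {ae mu, forall t, ~ (c n <= t <= d n) -> h n t = 0}) ->
  dual_frames g h b <-> duality_conditions g h b c d.
Proof.
move=> geo hg hh /(besselP b hg)[B bG] /(besselP b hh)[B' bH] gs hs.
have hG k : L2 (gabor g b k) by exact: L2_gabor.
have hH k : L2 (gabor h b k) by exact: L2_gabor.
split=> [[_ _ rec]|dc].
  apply: (conditions_of_weak geo hg hh bG bH gs hs) => f u hf hu.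
  apply: strong_weak => //; apply/reconstructsP => //.
  by case: (rec f hf).
have wk f u : L2 f -> L2 u -> weakly_reconstructs (gabor g b) (gabor h b) f u.
  by move=> hf hu; exact: (weak_of_conditions geo hg hh bG bH gs hs).
have wk' f u : L2 f -> L2 u -> weakly_reconstructs (gabor h b) (gabor g b) f u.
  by move=> hf hu; apply: weak_sym => //; exact: wk.
split.
- by apply: (frame_of_weak hg bG bH) => f hf; exact: wk.
- by apply: (frame_of_weak hh bH bG) => f hf; exact: wk'.
- move=> f hf; split; apply/reconstructsP => //.
    by apply: (weak_strong bG bH hf) => u hu; exact: wk.
  by apply: (weak_strong bH bG hf) => u hu; exact: wk'.
Qed.

End DualFrames.

Section GeometryOfHypotheses.
Context {R : realType}.
Variables (b c d : int -> R).

Lemma geometry_of_hypotheses (eps : R) :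
  (forall n, c n < d n) -> (forall n, 1 / (d n - c n) < b n) -> 0 < eps ->
  (forall n, d (n - 1) <= c (n + 1) /\
     Num.max (Num.max ((d n - c n) / 2) (c (n + 1) - c n)) (d n - d (n - 1))
       + eps <= (b n)^-1) ->
  (forall n, 0 < b n < b (n - 1) / (b (n - 1) * (d n - c (n - 1)) - 1)) ->
  (forall n, c n <= d (n - 1)) -> geometry b c d eps.
Proof.
move=> hcd hb e0 heps hb2 hnear.
have b0 n : 0 < b n by case/andP: (hb2 n).
have hmax n : [/\ (d n - c n) / 2 + eps <= (b n)^-1, c (n + 1) - c n + eps <= (b n)^-1
    & d n - d (n - 1) + eps <= (b n)^-1].
  have [_] := heps n; rewrite -lerBrDr !ge_max => /andP[/andP[h1 h2] h3].
  by split; rewrite -lerBrDr.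
split => // n.
- have dc0 : 0 < d n - c n by rewrite subr_gt0.
  by have := hb n; rewrite div1r -ltf_pV2 ?posrE ?invr_gt0 // invrK.
- have [h _ _] := hmax n; lra.
- by have [] := hmax n.
- by have [] := hmax n.
- by have [] := heps n.
- have /andP[_ lt] := hb2 n; have bn := b0 n; have bn1 := b0 (n - 1).
  set D := b (n - 1) * (d n - c (n - 1)) - 1 in lt.
  (* a quotient of a positive number by D <= 0 is nonpositive, also for D = 0 *)
  have D0 : 0 < D.
    rewrite ltNge; apply/negP => D0.
    have : b (n - 1) / D <= 0 by rewrite mulr_ge0_le0 ?invr_le0 // ltW.
    lra.
  have : D / b (n - 1) < (b n)^-1.
    by rewrite ltr_pdivrMr // ltr_pdivlMl // -ltr_pdivlMr.
  rewrite /D mulrBl mulrAC mulfV ?gt_eqF // mul1r; lra.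
Qed.

End GeometryOfHypotheses.

(** * Existence of a dual system *)
Section ExistenceOfDual.
Context {R : realType}.
Local Notation mu := (@lebesgue_measure R).
Variables (g : int -> R -> R[i]) (b c d : int -> R) (eps : R).
Hypothesis geo : geometry b c d eps.
Hypothesis hgL2 : forall n, L2 (g n).
Hypothesis gsupp : forall n, ae_eq_set (supp (g n)) [set` `[c n, d n]].
Local Notation p n := ((b n)^-1).

(** The normalization under which a Bessel bound B becomes the bound B for the
    square, whatever the row. *)
Definition level (w : int -> R -> R[i]) n t : R :=
  (Num.sqrt (b n))^-1 * cabs (w n t).

Lemma level_ge0 w n t : 0 <= level w n t.
Proof. by rewrite mulr_ge0 ?invr_ge0 ?sqrtr_ge0 ?cabs_ge0. Qed.

Lemma level_sqr w n t : level w n t ^+ 2 = p n * abs2 (w n t).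
Proof.
by rewrite exprMn exprVn sqr_sqrtr ?cabs_sqr // ltW //; exact: geo_b geo n.
Qed.

Definition existence_conditions (A : R) := forall n,
  [/\ {ae mu, forall t, t \in `[c n, c (n + 1)[ ->
         A <= level g n t \/ A <= level g (n - 1) t},
      {ae mu, forall t,
         (supp (translation (- p n) (g n)) `&` Iminus b c d n) t ->
         A <= level g (n - 1) t} &
      {ae mu, forall t,
         (supp (translation (p n) (g n)) `&` Iplus b c d n) t ->
         A <= level g (n + 1) t}].

Lemma ae_supp_zero (w : R -> R[i]) n : ae_subset (supp w) [set` `[c n, d n]] ->
  {ae mu, forall t, ~ (c n <= t <= d n) -> w t = 0}.
Proof.
move=> ws; apply: (aeS ws) => t h0 ht; apply: contrapT => wt; apply: ht.
by move: h0; rewrite /supp /= in_itv /=; apply; exact/eqP.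
Qed.

Lemma gsupp_zero n : {ae mu, forall t, ~ (c n <= t <= d n) -> g n t = 0}.
Proof. by apply: ae_supp_zero; apply: (aeS (gsupp n)) => t [h0 _]. Qed.

(** Two diagonal terms with sum 1 cannot both have modulus less than 1/2, and the
    modulus of a diagonal term is at most the square root of the Bessel bound of h
    times the level of g. *)
Lemma existence_necessary h : (forall n, L2 (h n)) -> bessel h b ->
  (forall n, ae_subset (supp (h n)) [set` `[c n, d n]]) ->
  duality_conditions g h b c d -> exists2 A : R, 0 < A & existence_conditions A.
Proof.
move=> hh /(besselP b hh)[B bH] hs dc.
have [_ B0 _] := bH; have e0 := geo_eps geo.
have hb n : {ae mu, forall t, abs2 (h n t) <= B * b n}.
  by apply: (bessel_bounded (geo_b geo n) hh bH); apply: (supp_two_periods geo); exact: ae_supp_zero.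
(* chosen so that B A^2 = 1/4 *)
pose A : R := (2 * Num.sqrt B)^-1.
have sB : 0 < Num.sqrt B by rewrite sqrtr_gt0.
have A0 : 0 < A by rewrite invr_gt0 mulr_gt0.
have BA : B * A ^+ 2 = 1 / 4.
  rewrite /A exprVn exprMn sqr_sqrtr ?ltW //.
  by rewrite -natrX; field; rewrite gt_eqF.
(* a diagonal term is small wherever the level of g is below A *)
have small n t : abs2 (h n t) <= B * b n -> ~ (A <= level g n t) ->
    abs2 ((p n)%:C * h n t * (g n t)^*) < 1 / 4.
  move=> hn /negP; rewrite -ltNge => lt.
  have bn := geo_b geo n.
  rewrite !abs2M abs2J abs2_real -BA.
  apply: le_lt_trans (_ : B * level g n t ^+ 2 < _).
    rewrite level_sqr expr2.
    have -> : B * (p n * abs2 (g n t)) = p n * p n * (B * b n) * abs2 (g n t).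
      by field; rewrite gt_eqF.
    by rewrite ler_wpM2r ?abs2_ge0 // ler_wpM2l // mulr_ge0 // invr_ge0 ltW.
  by rewrite ltr_pM2l // ltr_pXn2r ?nnegrE ?level_ge0 // ltW.
have one1 : abs2 (1 : R[i]) = 1 by rewrite (abs2_real 1) expr1n.
exists A => // n; have [d1 d2 d3] := dc n.
split.
- apply: (aeS2 d1 (aeS2 (hb n) (hb (n - 1)) (fun t x y => conj x y))) => t a1 [a2 a3] tQ.
  apply: contrapT => /not_orP[n1 n2].
  have := abs2D_le ((p n)%:C * h n t * (g n t)^*)
    ((p (n - 1))%:C * h (n - 1) t * (g (n - 1) t)^*).
  rewrite a1 // one1; have := small n t a2 n1; have := small (n - 1) t a3 n2; lra.
- apply: (aeS2 d1 (aeS2 d2 (hb (n - 1)) (fun t x y => conj x y))) => t a1 [a2 a3].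
  move=> [/= gt tm]; apply: contrapT => n2.
  have tQ : t \in `[c n, c (n + 1)[.
    move: tm; rewrite /Iminus /= !in_itv /= => /andP[-> h2] /=.
    have := geo_d geo n; have := geo_far geo n; lra.
  have h0 : h n t = 0.
    have /eqP := a2 tm; rewrite mulf_eq0 => /orP[/eqP //|].
    by rewrite /translation conjc_eq0; move: gt; rewrite /supp /= /translation => /negbTE ->.
  have := a1 tQ; rewrite h0 mulr0 mul0r add0r => E.
  have := small (n - 1) t a3 n2; rewrite E one1; lra.
- have [d1' _ _] := dc (n + 1).
  apply: (aeS2 (aeS2 d1' (ae_neq (c (n + 1 + 1))) (fun t x y => conj x y))
    (aeS2 d3 (hb (n + 1)) (fun t x y => conj x y))) => t [a1 tc] [a2 a3].
  move=> [/= gt tp]; apply: contrapT => n2.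
  have tQ : t \in `[c (n + 1), c (n + 1 + 1)[.
    move: tp; rewrite /Iplus /= !in_itv /= => /andP[h1 h2].
    have h3 := geo_far geo (n + 1); rewrite addrK in h3.
    rewrite lt_neqAle (le_trans h2 h3) andbT; apply/andP; split.
      have := geo_c geo n; lra.
    exact/eqP.
  have h0 : h n t = 0.
    have /eqP := a2 tp; rewrite mulf_eq0 => /orP[/eqP //|].
    by rewrite /translation conjc_eq0; move: gt; rewrite /supp /= /translation => /negbTE ->.
  have := a1 tQ; rewrite addrK h0 mulr0 mul0r addr0 => E.
  have := small (n + 1) t a3 n2; rewrite E one1; lra.
Qed.

Section Construction.
Variable A : R.
Hypotheses (A0 : 0 < A) (hA : existence_conditions A).

Let big n : set R := [set t | A <= level g n t].

(** Where both neighbours are large the one that starts later is chosen, which makes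
    these sets disjoint; on its aliasing intervals a row leaves the choice to the
    neighbour. *)
Definition active n : set R := big n `&`
  ((cell c n `\` Iminus b c d n) `|`
   ((cell c (n + 1) `\` Iplus b c d n) `&` (Iminus b c d (n + 1) `|` ~` big (n + 1)))).

Definition dual_window n t : R[i] :=
  cindic (active n) t * ((b n)%:C * ((g n t)^*)^-1).

Let mItv (i : interval R) : measurable ([set` i] : set R).
Proof. exact: measurable_itv. Qed.

Let mbig n : measurable (big n).
Proof.
have ml : measurable_fun [set: R] (level g n).
  apply: measurable_funM => //.
  rewrite (_ : (fun t => _) = (fun t => Num.sqrt (abs2 (g n t)))); last first.
    by apply/funext => t; rewrite cabsE.
  have ms : measurable_fun [set: R] (@Num.sqrt R).
    by apply: continuous_measurable_fun; exact: sqrt_continuous.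
  by apply: (measurableT_comp ms); apply: measurable_abs2; exact: L2_cmeasurable.
rewrite -[X in measurable X]setTI.
have := measurable_fun_ler (measurable_cst A) ml.
by move=> /(_ measurableT [set true]); apply.
Qed.

Lemma measurable_active n : measurable (active n).
Proof.
have mD (i i' : interval R) : measurable ([set` i] `\` [set` i'] : set R).
  by apply: measurableD; exact: mItv.
apply: measurableI; first exact: mbig.
apply: measurableU; first exact: mD.
apply: measurableI; first exact: mD.
by apply: measurableU; [exact: mItv|apply: measurableC; exact: mbig].
Qed.

Let cell_inj m n t : cell c m t -> cell c n t -> m = n.
Proof.
have lt i j : cell c i t -> cell c j t -> ~ (i < j).
  rewrite /cell /= !in_itv /= => /andP[_ t1] /andP[t2 _] ij.
  have := geo_mono geo (_ : i + 1 <= j); rewrite lezD1 => /(_ ij); lra.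
move=> tm tn; case: (ltgtP m n) => // h; first by have := lt _ _ tm tn h.
by have := lt _ _ tn tm h.
Qed.

Let active_big n t : active n t -> A <= level g n t.
Proof. by case. Qed.

Lemma active_disjoint m n t : active m t -> active n t -> m = n.
Proof.
have lt i j : active i t -> active j t -> ~ (i < j).
  move=> [bi Ui] [bj Uj] ij.
  have Qi : cell c i t \/ cell c (i + 1) t by case: Ui => [[? _]|[[? _] _]]; [left|right].
  have Qj : cell c j t \/ cell c (j + 1) t by case: Uj => [[? _]|[[? _] _]]; [left|right].
  have ji : j = i + 1 by case: Qi => Qi; case: Qj => Qj; have := cell_inj Qi Qj; lia.
  move: Uj; rewrite ji => -[[Qj' nI]|[[Qj' _] _]]; last first.
    by case: Qi => Qi; have := cell_inj Qi Qj'; lia.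
  case: Ui => [[Qi' _]|[_ [//|]]]; first by have := cell_inj Qi' Qj'; lia.
  by apply; rewrite -ji.
move=> am an; case: (ltgtP m n) => // h; first by have := lt _ _ am an h.
by have := lt _ _ an am h.
Qed.

(** The second and third existence conditions serve the points where one of the two
    candidates is excluded by an aliasing condition; the two exclusions never occur
    together. *)
Lemma active_one n : {ae mu, forall t, cell c n t -> active n t \/ active (n - 1) t}.
Proof.
have [a1 a2 _] := hA n; have [_ _ a3] := hA (n - 1).
rewrite subrK in a3.
have s1 := ae_shift (p n) (gsupp n); have s2 := ae_shift (- p (n - 1)) (gsupp (n - 1)).
apply: (aeS2 (aeS2 a1 (aeS2 a2 a3 (fun t x y => conj x y)) (fun t x y => conj x y))
  (aeS2 s1 s2 (fun t x y => conj x y))) => t [h1 [h2 h3]] [h4 h5] tQ.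
have disj : Iminus b c d n t -> ~ Iplus b c d (n - 1) t.
  rewrite /Iminus /Iplus /= !in_itv /= => /andP[_ u1] /andP[u2 _].
  have := geo_disj geo n; lra.
have p0 m : 0 < p m by rewrite invr_gt0; exact: geo_b geo m.
have [tm|tm] := pselect (Iminus b c d n t).
  right; split.
    apply: h2; split => //; rewrite /supp /translation /= opprK.
    apply: (proj2 h4); move: tm; rewrite /Iminus /= !in_itv /= => /andP[u1 u2].
    have := p0 n => q0; apply/andP; split; lra.
  by right; rewrite subrK; split; [split => //; exact: disj|left].
have [tp|tp] := pselect (Iplus b c d (n - 1) t).
  left; split; last by left.
  apply: h3; split => //; rewrite /supp /translation /=.
  apply: (proj2 h5); move: tp; rewrite /Iplus /= !in_itv /= => /andP[u1 u2].
  have := p0 (n - 1) => q0; apply/andP; split; lra.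
have [bn|bn] := pselect (big n t); first by left; split => //; left.
right; split; first by have [|] := h1 tQ.
by right; rewrite subrK; split; [|right].
Qed.

Let p0 n : 0 < p n.
Proof. by rewrite invr_gt0; exact: geo_b geo n. Qed.

Let b0 n : 0 < b n.
Proof. exact: geo_b geo n. Qed.

Lemma active_lower_bound n t : active n t -> A ^+ 2 * b n <= abs2 (g n t).
Proof.
move=> /active_big Ag; rewrite -ler_pdivlMr // mulrC -level_sqr.
by rewrite ler_pXn2r ?nnegrE ?level_ge0 // ltW.
Qed.

Lemma active_neq0 n t : active n t -> g n t != 0.
Proof.
move=> /active_lower_bound h0; rewrite -abs2_eq0 gt_eqF //.
by apply: lt_le_trans h0; rewrite mulr_gt0 // exprn_gt0.
Qed.

Lemma active_window n t : active n t -> c n <= t < c (n + 1 + 1).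
Proof.
have h1 := geo_step geo n; have h2 := geo_step geo (n + 1); have e0 := geo_eps geo.
by case=> _ [[]|[[]]]; rewrite /cell /= in_itv /= => /andP[u1 u2] *;
  apply/andP; split; lra.
Qed.

Lemma active_minus n t : Iminus b c d n t -> ~ active n t.
Proof.
move=> tm [_ [[_ /(_ tm)//]|[[tQ _] _]]]; move: tm tQ.
rewrite /Iminus /cell /= !in_itv /= => /andP[_ u1] /andP[u2 _].
have := geo_d geo n; have := geo_far geo n; have := geo_eps geo; lra.
Qed.

Lemma active_plus n t : Iplus b c d n t -> ~ active n t.
Proof.
move=> tp [_ [[tQ _]|[[_ /(_ tp)//] _]]]; move: tp tQ.
rewrite /Iplus /cell /= !in_itv /= => /andP[u1 _] /andP[_ u2].
have := geo_c geo n; have := geo_eps geo; lra.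
Qed.

Lemma invJ (z : R[i]) : (z^*)^-1 = z * ((abs2 z)^-1)%:C.
Proof.
have [->|z0] := eqVneq z 0; first by rewrite conjc0 invr0 mul0r.
have zJ : z^* != 0 by rewrite conjc_eq0.
apply: (mulIf zJ); rewrite mulVf // mulrAC mulzJ -rmorphM /= mulfV //.
by rewrite abs2_eq0.
Qed.

Lemma cmeasurable_dual_window n : cmeasurable (dual_window n).
Proof.
apply: cmeasurableM; first exact: cmeasurable_cindic (measurable_active n).
apply: cmeasurableM; first exact: cmeasurable_cst.
rewrite (_ : (fun t => _) = (fun t => g n t * ((abs2 (g n t)) `^ (-1))%:C)).
  apply: cmeasurableM; first exact: L2_cmeasurable.
  apply: cmeasurable_real; apply: (measurableT_comp (measurable_powR (-1))).
  by apply: measurable_abs2; exact: L2_cmeasurable.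
by apply/funext => t; rewrite invJ powR_inv1 // abs2_ge0.
Qed.

Lemma dual_window_bound n t : abs2 (dual_window n t) <= b n / A ^+ 2.
Proof.
have A20 : 0 < A ^+ 2 by rewrite exprn_gt0.
rewrite /dual_window; case: (cindicP (active n) t) => -[tE ->]; last first.
  by rewrite mul0r abs20 divr_ge0 // ltW.
rewrite mul1r abs2M abs2_real abs2V abs2J.
have lb := active_lower_bound tE.
have g0 : 0 < abs2 (g n t) by apply: lt_le_trans lb; rewrite mulr_gt0.
rewrite ler_pdivrMr // mulrAC ler_pdivlMr // expr2 -mulrA ler_pM2l //.
by rewrite mulrC.
Qed.

Lemma L2_dual_window n : L2 (dual_window n).
Proof.
have foo : (mu `[c n, c (n + 1 + 1)[%classic < +oo)%E.
  by rewrite lebesgue_measure_itv /=; case: ifP => _; rewrite ?ltry // -EFinB ltry.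
have := L2_cindic (mItv `[c n, c (n + 1 + 1)[) foo => hW.
have Mb0 : 0 <= b n / A ^+ 2 by rewrite divr_ge0 // ?sqr_ge0 // ltW.
have [h0 _] := L2_mul_bounded hW (cmeasurable_dual_window n) Mb0
  (aeT (dual_window_bound n)).
move: h0; congr L2; apply/funext => t; rewrite /dual_window.
case: (cindicP (active n) t) => -[tE ->]; last by rewrite mul0r mulr0.
by rewrite cindicT ?mul1r //= in_itv /=; exact: active_window.
Qed.

Lemma dual_window_supp n : ae_subset (supp (dual_window n)) [set` `[c n, d n]].
Proof.
apply: (aeS (gsupp n)) => t [+ _]; apply: contraPP => /not_implyP[ht tcd].
case: (cindicP (active n) t) => -[tE E]; last first.
  by exfalso; move: ht; rewrite /supp /= /dual_window E mul0r eqxx.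
by move=> /(_ (active_neq0 tE)).
Qed.

Lemma dual_window_conditions : duality_conditions g dual_window b c d.
Proof.
have term n t : (p n)%:C * dual_window n t * (g n t)^* = cindic (active n) t.
  rewrite /dual_window; case: (cindicP (active n) t) => -[tE ->]; last first.
    by rewrite mul0r mulr0 mul0r.
  have gJ : (g n t)^* != 0 by rewrite conjc_eq0; exact: active_neq0.
  have bJ : (b n)%:C != 0 :> R[i] by rewrite -abs2_eq0 abs2_real expf_eq0 /= gt_eqF.
  rewrite mul1r fmorphV /= mulrA mulVf // mul1r mulVf //.
move=> n; split.
- apply: (aeS (active_one n)) => t h0 tQ.
  have {}h0 := h0 tQ; rewrite !term.
  have ne : n != n - 1 by lia.
  case: h0 => tE.
    rewrite (cindicT tE) cindicF ?addr0 // => tE'.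
    by have := active_disjoint tE tE'; lia.
  rewrite (cindicT tE) cindicF ?add0r // => tE'.
  by have := active_disjoint tE' tE; lia.
- apply: aeT => t /active_minus tE.
  by rewrite /dual_window cindicF // !mul0r.
- apply: aeT => t /active_plus tE.
  by rewrite /dual_window cindicF // !mul0r.
Qed.

Lemma sum_Nm_disjoint (F : seq int) f : uniq F -> L2 f ->
  \sum_(n <- F) norm2 (fun t => cindic (active n) t * f t) <= norm2 f.
Proof.
move=> uF hf.
pose S t := \sum_(n <- F) abs2 (cindic (active n) t * f t).
have hn n := L2_integ (L2_cindicM (measurable_active n) hf).
have [iS ->] : mu.-integrable [set: R] (EFin \o S) /\
    \sum_(n <- F) norm2 (fun t => cindic (active n) t * f t) = Rintegral mu [set: R] S.
  rewrite /S; elim: (F) => [|n s [ih1 ih2]].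
    rewrite big_nil; under eq_fun do rewrite big_nil.
    by split; [exact: integ0|rewrite Rintegral_cst // mul0r].
  rewrite big_cons ih2; under eq_fun do rewrite big_cons.
  split; first exact: integD (hn n) ih1.
  rewrite -[LHS](RintegralD measurableT (hn n) ih1).
  by congr Rintegral; apply/funext => t; rewrite big_cons.
apply: le_Rintegral => //; first exact: L2_integ.
move=> t _; rewrite /S.
have [[n nF tE]|no] := pselect (exists2 n, n \in F & active n t).
  rewrite (bigD1_seq n) //= cindicT // mul1r big1 ?addr0 // => m mn.
  rewrite cindicF ?mul0r ?abs20 // => tE'.
  by move: mn; rewrite (active_disjoint tE' tE) eqxx.
rewrite big1_seq ?abs2_ge0 // => n /= nF; rewrite cindicF ?mul0r ?abs20 // => tE.
by apply: no; exists n.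
Qed.

(** In one row, Bessel's inequality after folding bounds the coefficients by the
    energy of f on the active set of that row. *)
Lemma dual_window_bessel : bessel dual_window b.
Proof.
have A20 : 0 < A ^+ 2 by rewrite exprn_gt0.
apply/(besselP b L2_dual_window); exists (4 / A ^+ 2); split.
- by move=> k; exact: L2_gabor (L2_dual_window _).
- by rewrite divr_gt0.
move=> f hf J.
have Mb0 n : 0 <= b n / A ^+ 2 by rewrite divr_ge0 // ltW.
have row n (K : {fset int}) :
    \sum_(m <- K) abs2 (inner f (gabor dual_window b (m, n))) <=
    4 / A ^+ 2 * norm2 (fun t => cindic (active n) t * f t).
  have w0 : {ae mu, forall t, ~ (c n <= t < c n + 2 * p n) -> dual_window n t = 0}.
    by apply: (supp_two_periods geo); apply: ae_supp_zero; exact: dual_window_supp.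
  apply: le_trans (gabor_row_bessel (b0 n) (L2_dual_window n) (Mb0 n)
    (aeT (dual_window_bound n)) w0 K hf) _.
  have hEf := L2_cindicM (measurable_active n) hf.
  have [] := @L2_mul_bounded R _ (fun t => (dual_window n t)^*) _ hEf
    (cmeasurableJ (cmeasurable_dual_window n)) (Mb0 n) _.
    by apply: aeT => t; rewrite abs2J; exact: dual_window_bound.
  rewrite (_ : (fun t => cindic (active n) t * f t * _) =
      (fun t => f t * (dual_window n t)^*)); last first.
    apply/funext => t; rewrite /dual_window.
    by case: (cindicP (active n) t) => -[_ ->]; rewrite ?mul1r // !mul0r conjc0 mulr0.
  set N1 := norm2 _; set N2 := norm2 _ => _ le.
  have -> : 4 / A ^+ 2 * N2 = p n * (4 * (b n / A ^+ 2 * N2)).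
    by field; rewrite !gt_eqF.
  by rewrite !ler_pM2l.
rewrite (partition_big_imfset _ (fun k => k.2)) /=.
apply: le_trans (_ : \sum_(n <- [fset k.2 | k in J]%fset)
  4 / A ^+ 2 * norm2 (fun t => cindic (active n) t * f t) <= _).
  apply: ler_sum => n _.
  pose Jn := [fset k in J | k.2 == n]%fset.
  rewrite (_ : \sum_(k <- J | _) _ = \sum_(m <- [fset k.1 | k in Jn]%fset)
    abs2 (inner f (gabor dual_window b (m, n)))); first exact: row.
  rewrite big_imfset /=; last first.
    move=> [m1 n1] [m2 n2]; rewrite !inE /= => /andP[_ /eqP ->] /andP[_ /eqP ->].
    by move=> ->.
  rewrite big_fset_condE /= [LHS]big_seq [RHS]big_seq.
  by apply: eq_bigr => -[m n']; rewrite !inE /= => /andP[_ /eqP ->].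
rewrite -mulr_sumr ler_pM2l ?divr_gt0 //.
by apply: (sum_Nm_disjoint _ hf); exact: fset_uniq.
Qed.

End Construction.

End ExistenceOfDual.

Theorem corollary5 (R : realType) (g : int -> R -> R[i]) (b c d : int -> R)
  (hgL2 : forall n : int, L2 (g n))
  (hgB : bessel g b)
  (hgsupp : forall n : int, ae_eq_set (supp (g n)) [set` `[c n, d n]])
  (hcd : forall n : int, c n < d n)
  (hb : forall n : int, 1 / (d n - c n) < b n)
  (heps : exists2 eps : R, 0 < eps & forall n : int,
     d (n - 1) <= c (n + 1) /\
     Num.max (Num.max ((d n - c n) / 2) (c (n + 1) - c n)) (d n - d (n - 1))
       + eps <= (b n)^-1)
  (hb2 : forall n : int,
     0 < b n < b (n - 1) / (b (n - 1) * (d n - c (n - 1)) - 1))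
  (hcd' : forall n : int, c n <= d (n - 1)) :
  (forall h : int -> R -> R[i],
     (forall n : int, L2 (h n)) -> bessel h b ->
     (forall n : int, ae_subset (supp (h n)) [set` `[c n, d n]]) ->
     dual_frames g h b <-> duality_conditions g h b c d)
  /\
  ((exists h : int -> R -> R[i],
      [/\ forall n : int, L2 (h n), bessel h b,
          forall n : int, ae_subset (supp (h n)) [set` `[c n, d n]] &
          duality_conditions g h b c d])
   <->
   (exists2 A : R, 0 < A & forall n : int,
      [/\ {ae mu, forall t : R, t \in `[c n, c (n + 1)[ ->
             A <= (Num.sqrt (b n))^-1 * cabs (g n t) \/
             A <= (Num.sqrt (b (n - 1)))^-1 * cabs (g (n - 1) t)},
          {ae mu, forall t : R,
             (supp (translation (- (b n)^-1) (g n)) `&` Iminus b c d n) t ->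
             A <= (Num.sqrt (b (n - 1)))^-1 * cabs (g (n - 1) t)} &
          {ae mu, forall t : R,
             (supp (translation (b n)^-1 (g n)) `&` Iplus b c d n) t ->
             A <= (Num.sqrt (b (n + 1)))^-1 * cabs (g (n + 1) t)}])).
Proof.
have [eps e0 hmax] := heps.
have geo : geometry b c d eps by exact: geometry_of_hypotheses.
split.
  move=> h hh hB hs; apply: (dual_framesP geo) => //.
    exact: gsupp_zero hgsupp.
  by move=> n; exact: ae_supp_zero (hs n).
split=> [[h [hh hB hs dc]]|[A A0 hA]].
  exact: (existence_necessary geo hh hB hs dc).
exists (dual_window g b c d A); split.
- exact: (L2_dual_window geo hgL2 A0).
- exact: (dual_window_bessel geo hgL2 hgsupp A0).
- exact: (dual_window_supp geo hgsupp A0).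
- exact: (dual_window_conditions geo hgsupp A0 hA).
Qed.
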